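(* Let $W:\mathbb{R}\to\mathbb{R}$ be a smooth $2\pi$-periodic function with zero mean and $W(-x)=W(x)$, with Fourier series $W(x)=\sum_{m\in\mathbb{Z}} w_{2m}e^{imx}$ satisfying $\sum_{m\in\mathbb{Z}}(1+m^2)^s|w_{2m}|^2<\infty$ for all $s>\frac12$, where $w_0=0$ and $w_{2m}=w_{-2m}=\bar w_{2m}$ for all $m\in\mathbb{N}$. Fix $n\in\mathbb{N}$ such that $w_{2n}\neq 0$. Let $\omega^2=\frac{n^2}{4}+\epsilon\Omega$ with $\Omega\in\mathbb{R}$. The nonlinear elliptic problem $$U''(x)+\omega^2U(x)+\epsilon W(x)U(x)=\sigma|U(x)|^2U(x),\qquad x\in\mathbb{R},$$ has a non-trivial solution $U(x)$ of the form $$U(x)=\sqrt{\epsilon}\sum_{m\in\mathbb{Z}'}U_m e^{\frac{i}{2}mx},\qquad \mathbf{U}=\{U_m\}_{m\in\mathbb{Z}'}\in l^2_s(\mathbb{Z}'),$$ for any $s>\frac12$ and sufficiently small $\epsilon>0$, if and only if there exists a non-trivial solution $(a,b)\in\mathbb{C}^2$ of the bifurcation equations $$\left\{\begin{array}{l}\Omega a+w_{2n}b-\sigma(|a|^2+2|b|^2)a=\epsilon A_\epsilon(a,b),\\ \Omega b+w_{-2n}a-\sigma(2|a|^2+|b|^2)b=\epsilon B_\epsilon(a,b),\end{array}\right.$$ where $A_\epsilon(a,b)$ and $B_\epsilon(a,b)$ are analytic functions of $\epsilon$ near $\epsilon=0$ satisfying the bounds $$\forall|\epsilon|<\epsilon_0,\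 \forall |a|+|b|<\delta:\quad |A_\epsilon(a,b)|\le C_A(|a|+|b|),\qquad |B_\epsilon(a,b)|\le C_B(|a|+|b|),$$ for sufficiently small $\epsilon_0>0$, fixed $\delta>0$, and some constants $C_A,C_B>0$ which are independent of $\epsilon$ and depend on $\delta$. Moreover, $A_\epsilon(a,b)=\overline{B_\epsilon(\bar b,\bar a)}$ for all $(a,b)\in\mathbb{C}^2$, and the solution $U$ corresponding to $(a,b)$ satisfies $$\forall\, 0<\epsilon<\epsilon_0:\quad \left\|U(x)-\sqrt{\epsilon}\left(ae^{\frac{inx}{2}}+be^{-\frac{inx}{2}}\right)\right\|_{C_b^0(\mathbb{R})}\le C\epsilon^{3/2}$$ for some $\epsilon$-independent constant $C>0$.
   Context: Here $U:\mathbb{R}\to\mathbb{C}$; $\omega^2$, $\epsilon$, $\sigma$ are real parameters ($\sigma$ and $\Omega$ are fixed independently of $\epsilon$). $\mathbb{Z}'\subset\mathbb{Z}$ is the set of all even integers if $n$ is even (then $U$ is $2\pi$-periodic) and the set of all odd integers if $n$ is odd (then $U$ is $2\pi$-anti-periodic). The space $l^2_s(\mathbb{Z}')$ consists of complex sequences $\mathbf{U}=\{U_m\}_{m\in\mathbb{Z}'}$ with $\|\mathbf{U}\|^2_{l^2_s(\mathbb{Z}')}=\sum_{m\in\mathbb{Z}'}\left(1+\frac{m^2}{4}\right)^s|U_m|^2<\infty$. For $s>\frac12$ the Fourier series for $U$ converges absolutely and uniformly. $C_b^0(\mathbb{R})$ is the space of bounded continuous functions with the supremum norm. The pair $(a,b)$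 corresponding to $U$ is $(a,b)=(U_n,U_{-n})$.
   Formalization: The equivalence and error bound are proved for |a|+|b|<δ and for U whose modes other than ±n have l²_s norm below ρ (δ, ρ>0 arbitrary, ε₀ and C depending on s, δ, ρ); without this, O(1) solutions, e.g. near the constant n/2 for n even, σ=1, Ω<-|w_{2n}|, refute the claim. *)

(* Defs.v *)
(* Stdlib reals with Coquelicot. *)
From Stdlib Require Export Reals ZArith.
From Coquelicot Require Export Coquelicot.
Open Scope R_scope.

(* Sums over Z are limits of the symmetric partial sums over |m| <= N.  For
   nonnegative terms this is summability; the Fourier series below are
   absolutely convergent, so the order of summation does not matter there. *)
Definition Zpartial {G : AbelianMonoid} (f : Z -> G) (N : nat) : G :=
  sum_n (fun k => f (Z.of_nat k - Z.of_nat N)%Z) (2 * N).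

Definition is_Zsum {V : NormedModule R_AbsRing} (f : Z -> V) (l : V) : Prop :=
  filterlim (Zpartial f) eventually (locally l).

Definition cis (t : R) : C := (cos t, sin t).

(* A sequence indexed by Z' = {m | m = n mod 2} is encoded by its extension
   by zero to Z. *)
Definition supported_Z' (n : nat) (u : Z -> C) : Prop :=
  forall m : Z, Z.even m <> Z.even (Z.of_nat n) -> u m = RtoC 0.

Definition l2s_term (s : R) (u : Z -> C) (m : Z) : R :=
  Rpower (1 + (IZR m) ^ 2 / 4) s * (Cmod (u m)) ^ 2.

Definition in_l2s (s : R) (n : nat) (u : Z -> C) : Prop :=
  supported_Z' n u /\ ex_finite_lim_seq (Zpartial (l2s_term s u)).

Definition l2s_norm (s : R) (u : Z -> C) : R :=
  sqrt (real (Lim_seq (Zpartial (l2s_term s u)))).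

Definition smooth (W : R -> R) : Prop :=
  forall (k : nat) (x : R), ex_derive_n W k x.

Definition elliptic_solution
    (omega2 eps sigma : R) (W : R -> R) (U : R -> C) : Prop :=
  exists U1 U2 : R -> C,
    forall x : R,
      is_derive (K := R_AbsRing) (V := C_R_NormedModule) U x (U1 x) /\
      is_derive (K := R_AbsRing) (V := C_R_NormedModule) U1 x (U2 x) /\
      (U2 x + RtoC omega2 * U x + RtoC eps * RtoC (W x) * U x
       = RtoC sigma * RtoC ((Cmod (U x)) ^ 2) * U x)%C.

Definition has_form (eps : R) (u : Z -> C) (U : R -> C) : Prop :=
  forall x : R,
    is_Zsum (V := C_R_NormedModule)
      (fun m => (RtoC (sqrt eps) * (u m * cis (IZR m * x / 2)))%C) (U x).

Definition nontrivial_fun (U : R -> C) : Prop := exists x : R, U x <> RtoC 0.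

Definition nontrivial_pair (a b : C) : Prop := (a, b) <> (RtoC 0, RtoC 0).

Definition nontrivial_solution
    (W : R -> R) (Omega sigma s eps : R) (n : nat)
    (u : Z -> C) (U : R -> C) : Prop :=
  elliptic_solution ((INR n) ^ 2 / 4 + eps * Omega) eps sigma W U /\
  nontrivial_fun U /\ in_l2s s n u /\ has_form eps u U.

Definition remainder (n : nat) (u : Z -> C) (m : Z) : C :=
  if (Z.abs m =? Z.of_nat n)%Z then RtoC 0 else u m.

(* The reduction is local: without a bound on u that is uniform in eps, the
   form sqrt eps * u would also admit solutions U of order one, which the
   bifurcation equations do not see. *)
Definition in_range (s : R) (n : nat) (delta rho : R) (u : Z -> C) : Prop :=
  Cmod (u (Z.of_nat n)) + Cmod (u (- Z.of_nat n)%Z) < delta /\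
  l2s_norm s (remainder n u) < rho.

Definition bifurcation_eqs
    (w : Z -> C) (Omega sigma eps : R) (n : nat)
    (A B : R -> C -> C -> C) (a b : C) : Prop :=
  (RtoC Omega * a + w (2 * Z.of_nat n)%Z * b
   - RtoC sigma * RtoC ((Cmod a) ^ 2 + 2 * (Cmod b) ^ 2) * a
   = RtoC eps * A eps a b)%C /\
  (RtoC Omega * b + w (- (2 * Z.of_nat n))%Z * a
   - RtoC sigma * RtoC (2 * (Cmod a) ^ 2 + (Cmod b) ^ 2) * b
   = RtoC eps * B eps a b)%C.

Definition analytic_near_0 (eps0 : R) (f : R -> C) : Prop :=
  exists c : nat -> C,
    forall eps : R, Rabs eps < eps0 ->
      is_pseries (K := R_AbsRing) (V := C_R_NormedModule) c eps (f eps).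

Definition Cb0_norm (f : R -> C) : Rbar :=
  Lub_Rbar (fun r => exists x : R, r = Cmod (f x)).

(* Main.v *)
Require Import Defs.
From Stdlib Require Import Reals ZArith List Permutation Classical ClassicalEpsilon FunctionalExtensionality Lra Lia.
From Coquelicot Require Import Coquelicot.
Open Scope R_scope.

(* Idea.  In the Fourier modes of U / sqrt eps the equation reads
   ((m^2 - n^2)/4) u_m + eps (nlin u)_m = 0 with nlin u = - Om u - u * w + sg u * u * dag u.
   The modes m <> +-n give the fixed point equation u = core a b + eps * ell * nlin u,
   the modes +-n the bifurcation equations (nlin u)_{+-n} = 0.  The fixed point is found
   at once as a power series in eps, by Picard iteration in the weighted l^1 algebra of
   sequences indexed by (mode, power of eps): multiplication by eps shifts the second
   index and so contracts by the weight eta.  The iteration does not refer to the weights,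
   hence A and B depend neither on s nor on delta and rho.  Evaluating the series in eps and
   evaluating a Fourier series at x are both push-forwards along homomorphisms, which
   commute with convolution.  Any solution in l^2_s lies in l^1, where the fixed point is
   unique in a ball of fixed radius for small eps; and the constructed one has
   arbitrarily many moments, hence lies in l^2_s and can be differentiated termwise. *)

(** * Unconditional sums *)

(** The order of the quantifiers shapes the construction: [A] and [B] are fixed before [s], [delta]
    and [rho], and their conjugation symmetry is claimed for all [eps], [a] and [b], also where the
    series may diverge. Hence sums and limits are total functions with default values, and weights
    enter only in proofs of convergence. Solving for a series in eps yields analyticity by
    construction. Complex conjugation spoils holomorphy in [a] and [b], but it leaves the powers of
    the real parameter eps alone. Weighted l^1 replaces l^2_s because a submultiplicative weight
    makes it an algebra with constant 1. Two levels of decay are needed: existence in a weight of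
    order [r], at least 2 and at least [s], and uniqueness in weight 0, because a given solution
    with [s] near 1/2 is used only through its absolute summability. Its second derivative is
    therefore never taken termwise; a Green identity with the exponentials finds its coefficients
    instead. *)

Lemma Cmod_le_abs (z : C) : Cmod z <= Rabs (fst z) + Rabs (snd z).
Proof.
  pose proof (Rabs_pos (fst z)). pose proof (Rabs_pos (snd z)).
  unfold Cmod. rewrite <- (sqrt_Rsqr (Rabs (fst z) + Rabs (snd z))) by lra.
  apply sqrt_le_1_alt. rewrite <- (pow2_abs (fst z)), <- (pow2_abs (snd z)).
  unfold Rsqr. nra.
Qed.

Lemma Cmod_fst (z : C) : Rabs (fst z) <= Cmod z.
Proof. eapply Rle_trans; [apply Rmax_l|apply Rmax_Cmod]. Qed.

Lemma Cmod_snd (z : C) : Rabs (snd z) <= Cmod z.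
Proof. eapply Rle_trans; [apply Rmax_r|apply Rmax_Cmod]. Qed.

Lemma Cmod_minus_le (z w : C) : Cmod (z - w) <= Cmod z + Cmod w.
Proof. rewrite <- (Cmod_opp w). apply Cmod_triangle. Qed.

Lemma Cminus_eq_0 (z w : C) : (z - w = 0)%C -> z = w.
Proof. intros H. replace z with ((z - w) + w)%C by ring. rewrite H. ring. Qed.

Lemma Cmod_dist_eq_0 (z w : C) :
  (forall e, 0 < e -> Cmod (z - w) <= e) -> z = w.
Proof.
  intros H. apply Cminus_eq_0, Cmod_eq_0.
  apply Rle_antisym; [apply le_epsilon; intros e He; rewrite Rplus_0_l; auto|apply Cmod_ge_0].
Qed.

Section FiniteSums.
Context {A : Type}.

Definition rsum (g : A -> R) (l : list A) : R :=
  fold_right (fun a s => g a + s) 0 l.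

Definition csum (f : A -> C) (l : list A) : C :=
  fold_right (fun a s => f a + s)%C (RtoC 0) l.

Lemma rsum_app g l1 l2 : rsum g (l1 ++ l2) = rsum g l1 + rsum g l2.
Proof. induction l1; simpl; [ring|rewrite IHl1; ring]. Qed.

Lemma rsum_perm g l1 l2 : Permutation l1 l2 -> rsum g l1 = rsum g l2.
Proof. induction 1; simpl; try lra. Qed.

Lemma csum_app f l1 l2 : csum f (l1 ++ l2) = (csum f l1 + csum f l2)%C.
Proof. induction l1; simpl; [ring|rewrite IHl1; ring]. Qed.

Lemma csum_perm f l1 l2 : Permutation l1 l2 -> csum f l1 = csum f l2.
Proof. induction 1; simpl; [easy|now f_equal|ring|congruence]. Qed.

Lemma csum_parts f l :
  csum f l = (rsum (fun a => fst (f a)) l, rsum (fun a => snd (f a)) l).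
Proof. induction l; simpl; [easy|rewrite IHl; easy]. Qed.

Lemma rsum_ext g h l : (forall a, In a l -> g a = h a) -> rsum g l = rsum h l.
Proof. induction l; simpl; intros H; [easy|]. rewrite (H a), IHl; auto. Qed.

Lemma csum_ext f h l : (forall a, In a l -> f a = h a) -> csum f l = csum h l.
Proof. induction l; simpl; intros H; [easy|]. rewrite (H a), IHl; auto. Qed.

Lemma rsum_le g h l : (forall a, In a l -> g a <= h a) -> rsum g l <= rsum h l.
Proof.
  induction l; simpl; intros H; [lra|].
  specialize (IHl (fun b Hb => H b (or_intror Hb))).
  specialize (H a (or_introl eq_refl)). lra.
Qed.

Lemma rsum_nonneg g l : (forall a, 0 <= g a) -> 0 <= rsum g l.
Proof. intros H; induction l; simpl; [lra|specialize (H a); lra]. Qed.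

Lemma rsum_plus g h l : rsum (fun a => g a + h a) l = rsum g l + rsum h l.
Proof. induction l; simpl; [ring|rewrite IHl; ring]. Qed.

Lemma rsum_scal c g l : rsum (fun a => c * g a) l = c * rsum g l.
Proof. induction l; simpl; [ring|rewrite IHl; ring]. Qed.

Lemma csum_plus f h l : csum (fun a => f a + h a)%C l = (csum f l + csum h l)%C.
Proof. induction l; simpl; [ring|rewrite IHl; ring]. Qed.

Lemma csum_scal c f l : csum (fun a => c * f a)%C l = (c * csum f l)%C.
Proof. induction l; simpl; [ring|rewrite IHl; ring]. Qed.

Lemma csum_conj f l : csum (fun a => Cconj (f a)) l = Cconj (csum f l).
Proof.
  induction l; simpl; [unfold Cconj; simpl; now rewrite Ropp_0|].
  rewrite IHl. unfold Cconj, Cplus; simpl; f_equal; ring.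
Qed.

Lemma Cmod_csum_le f l : Cmod (csum f l) <= rsum (fun a => Cmod (f a)) l.
Proof.
  induction l; simpl; [rewrite Cmod_0; lra|].
  eapply Rle_trans; [apply Cmod_triangle|lra].
Qed.

(** Excluded middle supplies the decidable equality that [nodup] and [in_dec] ask for, on every
    index type. *)
Lemma classic_dec (x y : A) : {x = y} + {x <> y}.
Proof. apply excluded_middle_informative. Qed.

Lemma NoDup_complement (l l' : list A) :
  NoDup l -> NoDup l' -> incl l l' ->
  exists r, Permutation l' (l ++ r) /\ NoDup r /\ (forall a, In a r -> ~ In a l).
Proof.
  intros Hl Hl' Hi.
  exists (filter (fun a => if in_dec classic_dec a l then false else true) l').
  assert (Hin : forall a, In a (filter (fun a => if in_dec classic_dec a l then false else true) l')
            <-> In a l' /\ ~ In a l).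
  { intros a. rewrite filter_In. destruct (in_dec classic_dec a l); intuition easy. }
  split; [|split].
  - apply NoDup_Permutation; auto.
    + apply NoDup_app; auto using NoDup_filter.
      intros a Ha Hb. now apply Hin in Hb.
    + intros a. rewrite in_app_iff, Hin.
      destruct (in_dec classic_dec a l); intuition.
  - now apply NoDup_filter.
  - intros a Ha. now apply Hin in Ha.
Qed.

Lemma rsum_incl g l l' :
  (forall a, 0 <= g a) -> NoDup l -> NoDup l' -> incl l l' -> rsum g l <= rsum g l'.
Proof.
  intros Hg H1 H2 H3.
  destruct (NoDup_complement l l' H1 H2 H3) as (r & Hp & _ & _).
  rewrite (rsum_perm _ _ _ Hp), rsum_app.
  pose proof (rsum_nonneg g r Hg). lra.
Qed.

Lemma NoDup_union (l1 l2 : list A) :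
  exists l, NoDup l /\ incl l1 l /\ incl l2 l.
Proof.
  exists (nodup classic_dec (l1 ++ l2)). split; [apply NoDup_nodup|].
  split; intros a Ha; apply nodup_In, in_app_iff; auto.
Qed.

End FiniteSums.

Lemma rsum_map {A B : Type} (p : A -> B) g l :
  rsum g (map p l) = rsum (fun a => g (p a)) l.
Proof. induction l; simpl; [easy|now rewrite IHl]. Qed.

Lemma csum_map {A B : Type} (p : A -> B) f l :
  csum f (map p l) = csum (fun a => f (p a)) l.
Proof. induction l; simpl; [easy|now rewrite IHl]. Qed.

Section Summation.
Context {A : Type}.

(** Lists without duplicates stand for the finite subsets of an index type with no preferred
    enumeration; [has_sum] is convergence along the net of these subsets. *)
Definition bdd (g : A -> R) (M : R) : Prop :=
  forall l, NoDup l -> rsum g l <= M.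

Definition has_sum (f : A -> C) (z : C) : Prop :=
  forall e, 0 < e -> exists l0, forall l, NoDup l -> incl l0 l ->
    Cmod (csum f l - z) < e.

Definition summable (f : A -> C) : Prop := exists M, bdd (fun a => Cmod (f a)) M.

Lemma bdd_ge0 g M : bdd g M -> 0 <= M.
Proof. intros H. apply (H nil). constructor. Qed.

Lemma bdd_le g h M N :
  (forall a, g a <= h a) -> M <= N -> bdd h M -> bdd g N.
Proof.
  intros H HM Hb l Hl. eapply Rle_trans; [apply rsum_le; auto|].
  eapply Rle_trans; [apply Hb; auto|auto].
Qed.

Lemma bdd_term g M a : bdd g M -> g a <= M.
Proof.
  intros H. specialize (H (a :: nil)). simpl in H. rewrite Rplus_0_r in H.
  apply H. constructor; [easy|constructor].
Qed.

Lemma bdd_plus g h M N : bdd g M -> bdd h N -> bdd (fun a => g a + h a) (M + N).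
Proof. intros H1 H2 l Hl. rewrite rsum_plus. specialize (H1 l Hl). specialize (H2 l Hl). lra. Qed.

Lemma bdd_scal c g M : 0 <= c -> bdd g M -> bdd (fun a => c * g a) (c * M).
Proof. intros Hc H l Hl. rewrite rsum_scal. apply Rmult_le_compat_l; auto. Qed.

Lemma bdd_sup g M : bdd g M -> exists S, is_lub (fun r => exists l, NoDup l /\ r = rsum g l) S.
Proof.
  intros H. destruct (completeness (fun r => exists l, NoDup l /\ r = rsum g l)) as [S HS].
  - exists M. intros r (l & Hl & ->). auto.
  - exists (rsum g nil), nil. split; [constructor|easy].
  - now exists S.
Qed.

Lemma bdd_approx g M :
  (forall a, 0 <= g a) -> bdd g M ->
  exists S, bdd g S /\ forall e, 0 < e -> exists l0, NoDup l0 /\ S - e < rsum g l0.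
Proof.
  intros Hg H. destruct (bdd_sup g M H) as [S [H1 H2]]. exists S. split.
  - intros l Hl. apply H1. now exists l.
  - intros e He. apply NNPP. intros Hn.
    assert (S <= S - e); [|lra].
    apply H2. intros r (l & Hl & ->). apply Rnot_lt_le. intros Hlt.
    apply Hn. now exists l.
Qed.

(** A finite set whose sum comes within [e] of the supremum leaves at most [e] to any family
    disjoint from it. *)
Lemma bdd_tail g M :
  (forall a, 0 <= g a) -> bdd g M ->
  forall e, 0 < e -> exists l0, NoDup l0 /\
    forall l, NoDup l -> (forall a, In a l -> ~ In a l0) -> rsum g l <= e.
Proof.
  intros Hg H e He. destruct (bdd_approx g M Hg H) as (S & HS & Ha).
  destruct (Ha e He) as (l0 & Hl0 & Hs). exists l0. split; auto.
  intros l Hl Hd.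
  assert (NoDup (l ++ l0)) as Hn by (apply NoDup_app; auto).
  specialize (HS _ Hn). rewrite rsum_app in HS. lra.
Qed.

(** A signed family is the difference of the non-negative families [h + g] and [g], and for these
    the supremum of the finite sums is the unconditional sum. *)
Lemma has_sum_real (h g : A -> R) M :
  (forall a, Rabs (h a) <= g a) -> bdd g M ->
  exists z, forall e, 0 < e -> exists l0, forall l, NoDup l -> incl l0 l ->
    Rabs (rsum h l - z) < e.
Proof.
  intros Hh Hb.
  assert (Hp : forall k M, (forall a, 0 <= k a) -> bdd k M ->
    exists z, forall e, 0 < e -> exists l0, forall l, NoDup l -> incl l0 l ->
    Rabs (rsum k l - z) < e).
  { clear. intros k M Hk H. destruct (bdd_approx k M Hk H) as (S & HS & Ha).
    exists S. intros e He. destruct (Ha e He) as (l0 & Hl0 & Hs). exists l0.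
    intros l Hl Hi. pose proof (rsum_incl k l0 l Hk Hl0 Hl Hi). specialize (HS l Hl).
    apply Rabs_def1; lra. }
  destruct (Hp g M) as [z1 H1]; auto.
  { intros a. eapply Rle_trans; [apply Rabs_pos|apply Hh]. }
  destruct (Hp (fun a => h a + g a) (2 * M)) as [z2 H2].
  { intros a. specialize (Hh a). apply Rabs_le_between in Hh. lra. }
  { eapply bdd_le; [|apply Rle_refl|apply (bdd_scal 2); eauto; lra].
    intros a. specialize (Hh a). apply Rabs_le_between in Hh. simpl. lra. }
  exists (z2 - z1). intros e He.
  destruct (H1 (e / 2)) as [l1 K1]; [lra|]. destruct (H2 (e / 2)) as [l2 K2]; [lra|].
  exists (l1 ++ l2). intros l Hl Hi.
  specialize (K1 l Hl (fun a Ha => Hi a (in_or_app _ _ _ (or_introl Ha)))).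
  specialize (K2 l Hl (fun a Ha => Hi a (in_or_app _ _ _ (or_intror Ha)))).
  rewrite rsum_plus in K2. apply Rabs_def2 in K1, K2. apply Rabs_def1; lra.
Qed.

Lemma summable_has_sum f : summable f -> exists z, has_sum f z.
Proof.
  intros [M H].
  destruct (has_sum_real (fun a => fst (f a)) _ M (fun a => Cmod_fst (f a)) H) as [x Hx].
  destruct (has_sum_real (fun a => snd (f a)) _ M (fun a => Cmod_snd (f a)) H) as [y Hy].
  exists (x, y). intros e He.
  destruct (Hx (e / 2)) as [l1 K1]; [lra|]. destruct (Hy (e / 2)) as [l2 K2]; [lra|].
  exists (l1 ++ l2). intros l Hl Hi.
  specialize (K1 l Hl (fun a Ha => Hi a (in_or_app _ _ _ (or_introl Ha)))).
  specialize (K2 l Hl (fun a Ha => Hi a (in_or_app _ _ _ (or_intror Ha)))).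
  eapply Rle_lt_trans; [apply Cmod_le_abs|].
  rewrite csum_parts. unfold Cminus, Cplus, Copp; simpl. unfold Rminus in *. lra.
Qed.

Lemma has_sum_dist f z w M l0 :
  has_sum f z -> (forall l, NoDup l -> incl l0 l -> Cmod (csum f l - w) <= M) ->
  Cmod (z - w) <= M.
Proof.
  intros H HM. apply le_epsilon. intros e He.
  destruct (H e He) as [l1 H1].
  destruct (NoDup_union l0 l1) as (l & Hl & Hi0 & Hi1).
  specialize (H1 l Hl Hi1). specialize (HM l Hl Hi0).
  replace (z - w)%C with ((csum f l - w) - (csum f l - z))%C by ring.
  eapply Rle_trans; [apply Cmod_minus_le|lra].
Qed.

Lemma has_sum_unique f z w : has_sum f z -> has_sum f w -> z = w.
Proof.
  intros Hz Hw. apply Cmod_dist_eq_0. intros e He.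
  destruct (Hw e He) as [l1 H1].
  apply (has_sum_dist f z w e l1 Hz). intros l Hl Hi. now apply Rlt_le, H1.
Qed.

(** The default value 0 lets [CS_conj] and [CS_bij] hold without summability, so that [dag] commutes
    with convolutions of arbitrary sequences. *)
Definition CS (f : A -> C) : C :=
  if excluded_middle_informative (summable f) then epsilon (inhabits (RtoC 0)) (has_sum f) else RtoC 0.

Lemma CS_spec f : summable f -> has_sum f (CS f).
Proof.
  intros H. unfold CS. destruct (excluded_middle_informative (summable f)); [|easy].
  apply epsilon_spec. now apply summable_has_sum.
Qed.

Lemma CS_eq f z : summable f -> has_sum f z -> CS f = z.
Proof. intros H Hz. eapply has_sum_unique; eauto using CS_spec. Qed.

Lemma CS_norm f M : bdd (fun a => Cmod (f a)) M -> Cmod (CS f) <= M.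
Proof.
  intros H. replace (CS f) with (CS f - 0)%C by ring.
  apply (has_sum_dist f (CS f) 0 M nil); [apply CS_spec; now exists M|].
  intros l Hl _. replace (csum f l - 0)%C with (csum f l) by ring.
  eapply Rle_trans; [apply Cmod_csum_le|auto].
Qed.

Lemma summable_le f h : summable h -> (forall a, Cmod (f a) <= Cmod (h a)) -> summable f.
Proof. intros [M H] Hl. exists M. eapply bdd_le; [| |apply H]; auto; lra. Qed.

Lemma summable_plus f h : summable f -> summable h -> summable (fun a => f a + h a)%C.
Proof.
  intros [M H1] [N H2]. exists (M + N). eapply bdd_le; [| |apply (bdd_plus _ _ _ _ H1 H2)]; [|lra].
  intros a. apply Cmod_triangle.
Qed.

Lemma summable_scal c f : summable f -> summable (fun a => c * f a)%C.
Proof.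
  intros [M H]. exists (Cmod c * M).
  eapply bdd_le; [| |apply (bdd_scal (Cmod c) _ _ (Cmod_ge_0 c) H)]; [|lra].
  intros a. rewrite Cmod_mult. lra.
Qed.

Lemma CS_plus f h : summable f -> summable h ->
  CS (fun a => f a + h a)%C = (CS f + CS h)%C.
Proof.
  intros H1 H2. apply CS_eq; [now apply summable_plus|].
  intros e He. destruct (CS_spec f H1 (e / 2)) as [l1 K1]; [lra|].
  destruct (CS_spec h H2 (e / 2)) as [l2 K2]; [lra|].
  exists (l1 ++ l2). intros l Hl Hi.
  specialize (K1 l Hl (fun a Ha => Hi a (in_or_app _ _ _ (or_introl Ha)))).
  specialize (K2 l Hl (fun a Ha => Hi a (in_or_app _ _ _ (or_intror Ha)))).
  rewrite csum_plus.
  replace (csum f l + csum h l - (CS f + CS h))%C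
    with ((csum f l - CS f) + (csum h l - CS h))%C by ring.
  eapply Rle_lt_trans; [apply Cmod_triangle|lra].
Qed.

Lemma CS_scal c f : summable f -> CS (fun a => c * f a)%C = (c * CS f)%C.
Proof.
  intros H. apply CS_eq; [now apply summable_scal|].
  intros e He. pose proof (Cmod_ge_0 c) as Hc.
  destruct (CS_spec f H (e / (Cmod c + 1))) as [l1 K1]; [apply Rdiv_lt_0_compat; lra|].
  exists l1. intros l Hl Hi. specialize (K1 l Hl Hi).
  rewrite csum_scal. replace (c * csum f l - c * CS f)%C with (c * (csum f l - CS f))%C by ring.
  rewrite Cmod_mult. apply Rle_lt_trans with (Cmod c * (e / (Cmod c + 1))).
  - apply Rmult_le_compat_l; lra.
  - apply Rmult_lt_reg_r with (Cmod c + 1); [lra|].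
    field_simplify; [|lra]. nra.
Qed.

Lemma CS_finite f L : NoDup L -> (forall a, ~ In a L -> f a = RtoC 0) -> CS f = csum f L.
Proof.
  intros HL Hf.
  assert (Hc : forall l, NoDup l -> incl L l -> csum f l = csum f L).
  { intros l Hl Hi. destruct (NoDup_complement L l HL Hl Hi) as (r & Hp & _ & Hr).
    rewrite (csum_perm _ _ _ Hp), csum_app.
    rewrite (csum_ext f (fun _ => RtoC 0) r); [|intros a Ha; apply Hf; auto].
    replace (csum (fun _ : A => RtoC 0) r) with (RtoC 0); [ring|].
    clear. induction r; simpl; [easy|]. rewrite <- IHr. ring. }
  apply CS_eq.
  - exists (rsum (fun a => Cmod (f a)) L). intros l Hl.
    destruct (NoDup_union L l) as (l' & Hl' & Hi & Hi').
    eapply Rle_trans.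
    { apply (rsum_incl (fun a => Cmod (f a)) l l'); auto. intros; apply Cmod_ge_0. }
    destruct (NoDup_complement L l' HL Hl' Hi) as (r & Hp & _ & Hr).
    rewrite (rsum_perm _ _ _ Hp), rsum_app.
    rewrite (rsum_ext _ (fun _ => 0 * 0) r); [rewrite rsum_scal; lra|].
    intros a Ha. rewrite Hf; [|auto]. rewrite Cmod_0; ring.
  - intros e He. exists L. intros l Hl Hi. rewrite Hc; auto.
    replace (csum f L - csum f L)%C with (RtoC 0) by ring. now rewrite Cmod_0.
Qed.

Lemma CS_zero f : (forall a, f a = RtoC 0) -> CS f = RtoC 0.
Proof. intros H. rewrite (CS_finite f nil); auto. constructor. Qed.

Lemma CS_conj f : CS (fun a => Cconj (f a)) = Cconj (CS f).
Proof.
  destruct (excluded_middle_informative (summable f)) as [H|H].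
  - apply CS_eq.
    + eapply summable_le; [apply H|]. intros a. cbv beta. rewrite Cmod_conj. lra.
    + intros e He. destruct (CS_spec f H e He) as [l0 Hl0]. exists l0. intros l Hl Hi.
      rewrite csum_conj.
      replace (Cconj (csum f l) - Cconj (CS f))%C with (Cconj (csum f l - CS f))
        by (unfold Cconj, Cminus, Cplus, Copp; simpl; f_equal; ring).
      rewrite Cmod_conj. auto.
  - unfold CS. destruct (excluded_middle_informative (summable f)); [easy|].
    destruct (excluded_middle_informative (summable (fun a => Cconj (f a)))) as [K|K].
    + contradict H. eapply summable_le; [apply K|]. intros a. cbv beta. rewrite Cmod_conj. lra.
    + unfold Cconj, RtoC; simpl. f_equal. ring.
Qed.

End Summation.

Lemma CS_ext {A : Type} (f h : A -> C) : (forall a, f a = h a) -> CS f = CS h.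
Proof. intros H. f_equal. now apply functional_extensionality. Qed.

Lemma NoDup_map_inj {A B : Type} (p : A -> B) l :
  (forall a b, p a = p b -> a = b) -> NoDup l -> NoDup (map p l).
Proof.
  intros Hp. induction 1 as [|a l Ha Hl IH]; simpl; constructor; auto.
  intros Hi. apply in_map_iff in Hi. destruct Hi as (b & Hb & Hb').
  apply Hp in Hb. congruence.
Qed.

Lemma summable_reindex {A B : Type} (p : A -> B) f :
  (forall a b, p a = p b -> a = b) -> summable f -> summable (fun a => f (p a)).
Proof.
  intros Hp [M H]. exists M. intros l Hl.
  rewrite <- (rsum_map p (fun b => Cmod (f b))). apply H. now apply NoDup_map_inj.
Qed.

Lemma CS_bij {A B : Type} (p : A -> B) (q : B -> A) f :
  (forall a, q (p a) = a) -> (forall b, p (q b) = b) ->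
  CS (fun a => f (p a)) = CS f.
Proof.
  intros H1 H2.
  assert (Ip : forall a b, p a = p b -> a = b) by (intros a b E; rewrite <- (H1 a), E; auto).
  assert (Iq : forall a b, q a = q b -> a = b) by (intros a b E; rewrite <- (H2 a), E; auto).
  destruct (excluded_middle_informative (summable f)) as [H|H].
  - apply CS_eq; [now apply summable_reindex|].
    intros e He. destruct (CS_spec f H e He) as [l0 Hl0].
    exists (map q l0). intros l Hl Hi. rewrite <- (csum_map p f).
    apply Hl0; [now apply NoDup_map_inj|].
    intros b Hb. rewrite <- (H2 b). apply in_map, Hi, in_map, Hb.
  - unfold CS. destruct (excluded_middle_informative (summable f)); [easy|].
    destruct (excluded_middle_informative (summable (fun a => f (p a)))) as [K|K]; auto.
    contradict H. apply (summable_reindex q) in K; auto.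
    replace f with (fun b => f (p (q b))); auto.
    apply functional_extensionality. intros b. now rewrite H2.
Qed.

(** * Push-forward of summable families *)

(** The ball of radius [M] in the [th]-weighted l^1 space. Only upper bounds on the norm ever
    matter, hence a predicate and not a number. *)
Definition bnd {A : Type} (th : A -> R) (f : A -> C) (M : R) : Prop :=
  bdd (fun a => th a * Cmod (f a)) M.

Lemma bnd_summable {A : Type} (th : A -> R) (f : A -> C) M c :
  0 < c -> (forall a, f a <> RtoC 0 -> c <= th a) -> (forall a, 0 <= th a) ->
  bnd th f M -> summable f.
Proof.
  intros Hc Hth Hp H. exists (/ c * M).
  eapply bdd_le; [| |apply (bdd_scal (/ c)); [|apply H]].
  - intros a. destruct (Ceq_dec (f a) 0) as [E|E].
    + rewrite E, Cmod_0. lra.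
    + specialize (Hth a E). pose proof (Cmod_ge_0 (f a)).
      apply Rmult_le_reg_l with c; auto.
      rewrite <- Rmult_assoc, Rinv_r, Rmult_1_l by lra. nra.
  - lra.
  - left. now apply Rinv_0_lt_compat.
Qed.

Lemma bnd_one {A : Type} (f : A -> C) M :
  bdd (fun a => Cmod (f a)) M -> bnd (fun _ => 1) f M.
Proof. intros H. eapply bdd_le; [| |apply H]; [intros; simpl; lra|lra]. Qed.

Lemma bnd_mono {A : Type} (th th' : A -> R) (f f' : A -> C) M M' :
  (forall a, th a * Cmod (f a) <= th' a * Cmod (f' a)) -> M <= M' ->
  bnd th' f' M -> bnd th f M'.
Proof. intros H1 H2. now apply bdd_le. Qed.

Lemma bnd_plus {A : Type} (th : A -> R) (f h : A -> C) M N :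
  (forall a, 0 <= th a) -> bnd th f M -> bnd th h N ->
  bnd th (fun a => f a + h a)%C (M + N).
Proof.
  intros Ht H1 H2. eapply bdd_le; [| |apply (bdd_plus _ _ _ _ H1 H2)]; [|lra].
  intros a. simpl. pose proof (Cmod_triangle (f a) (h a)). specialize (Ht a). nra.
Qed.

Lemma bnd_scal {A : Type} (th : A -> R) (f : A -> C) c M :
  bnd th f M -> bnd th (fun a => c * f a)%C (Cmod c * M).
Proof.
  intros H. eapply bdd_le; [| |apply (bdd_scal (Cmod c) _ _ (Cmod_ge_0 c) H)]; [|lra].
  intros a. simpl. rewrite Cmod_mult. lra.
Qed.

Lemma bnd_opp {A : Type} (th : A -> R) (f : A -> C) M :
  bnd th f M -> bnd th (fun a => - f a)%C M.
Proof. intros H. eapply bnd_mono; [|apply Rle_refl|apply H]. intros a; cbv beta. rewrite Cmod_opp. lra. Qed.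

Lemma bnd_minus {A : Type} (th : A -> R) (f h : A -> C) M N :
  (forall a, 0 <= th a) -> bnd th f M -> bnd th h N ->
  bnd th (fun a => f a - h a)%C (M + N).
Proof. intros Ht H1 H2. apply bnd_plus; auto. now apply bnd_opp. Qed.

(** A finite set of pairs lies in the product of its two projections, over which the sum
    factorises. *)
Lemma bnd_tensor {A B : Type} (th : A -> R) (tau : B -> R) (f : A -> C) (h : B -> C) M N :
  (forall a, 0 <= th a) -> (forall b, 0 <= tau b) ->
  bnd th f M -> bnd tau h N ->
  bnd (fun p => th (fst p) * tau (snd p)) (fun p => f (fst p) * h (snd p))%C (M * N).
Proof.
  intros Ht Htau H1 H2 L HL.
  pose (L1 := nodup classic_dec (map fst L)). pose (L2 := nodup classic_dec (map snd L)).
  assert (N1 : NoDup L1) by apply NoDup_nodup.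
  assert (N2 : NoDup L2) by apply NoDup_nodup.
  assert (Hpair : forall l2 a, NoDup l2 ->
    NoDup (map (fun b : B => (a : A, b)) l2)) by
    (intros l2 a Hl; apply NoDup_map_inj; auto; intros x y E; congruence).
  assert (Hprod : forall l1 l2, NoDup l1 -> NoDup l2 -> NoDup (list_prod l1 l2 : list (A * B))).
  { clear - Hpair. intros l1 l2 H1 H2. induction H1 as [|a l1 Ha _ IH]; simpl; [constructor|].
    apply NoDup_app; auto. intros [x y] Hx Hy.
    apply in_map_iff in Hx. destruct Hx as (z & E & _). injection E as -> ->.
    apply in_prod_iff in Hy. tauto. }
  eapply Rle_trans.
  { apply (rsum_incl _ L (list_prod L1 L2)); auto.
    - intros [a b]; simpl. repeat apply Rmult_le_pos; auto using Cmod_ge_0.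
    - intros [a b] Hi. apply in_prod_iff. split; apply nodup_In.
      + now apply (in_map fst) in Hi. + now apply (in_map snd) in Hi. }
  assert (E : forall l1 l2, rsum (fun p => th (fst p) * tau (snd p) * Cmod (f (fst p) * h (snd p)))
     (list_prod l1 l2) =
     rsum (fun a => th a * Cmod (f a)) l1 * rsum (fun b => tau b * Cmod (h b)) l2).
  { clear. intros l1 l2. induction l1 as [|a l1 IH]; simpl; [ring|].
    rewrite rsum_app, IH, rsum_map. simpl.
    rewrite (rsum_ext _ (fun b => (th a * Cmod (f a)) * (tau b * Cmod (h b)))).
    - rewrite rsum_scal. ring.
    - intros b _. rewrite Cmod_mult. ring. }
  rewrite E. specialize (H1 L1 N1). specialize (H2 L2 N2). cbv beta in H1, H2.
  apply Rmult_le_compat; auto; apply rsum_nonneg; intros; apply Rmult_le_pos; auto using Cmod_ge_0.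
Qed.

(** A cut-off on the whole index type, used to sum over a fibre without passing to a subtype. *)
Definition onlyif (P : Prop) (z : C) : C :=
  if excluded_middle_informative P then z else RtoC 0.

Lemma onlyif_true (P : Prop) z : P -> onlyif P z = z.
Proof. intros H. unfold onlyif. now destruct (excluded_middle_informative P). Qed.

Lemma onlyif_false (P : Prop) z : ~ P -> onlyif P z = RtoC 0.
Proof. intros H. unfold onlyif. now destruct (excluded_middle_informative P). Qed.

Lemma onlyif_iff (P Q : Prop) z : (P <-> Q) -> onlyif P z = onlyif Q z.
Proof.
  intros H. destruct (classic P).
  - rewrite !onlyif_true; tauto. - rewrite !onlyif_false; tauto.
Qed.

Lemma onlyif_mult (P : Prop) z w : (z * onlyif P w)%C = onlyif P (z * w)%C.
Proof.
  destruct (classic P).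
  - now rewrite !onlyif_true. - rewrite !onlyif_false by auto. ring.
Qed.

Lemma onlyif_conj (P : Prop) z : Cconj (onlyif P z) = onlyif P (Cconj z).
Proof.
  destruct (classic P).
  - now rewrite !onlyif_true.
  - rewrite !onlyif_false by auto. unfold Cconj, RtoC; simpl; f_equal; ring.
Qed.

Lemma Cmod_onlyif_le (P : Prop) z : Cmod (onlyif P z) <= Cmod z.
Proof.
  destruct (classic P).
  - rewrite onlyif_true; auto; lra. - rewrite onlyif_false, Cmod_0; auto. apply Cmod_ge_0.
Qed.

(** A unimodular or zero factor turns moduli into linear expressions; [push_bnd] uses it to
    interchange sums before estimating. *)
Lemma Cphase (z : C) : exists c, Cmod c <= 1 /\ (c * z)%C = RtoC (Cmod z).
Proof.
  destruct (Ceq_dec z 0) as [->|H].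
  - exists (RtoC 0). rewrite Cmod_0. split; [lra|ring].
  - assert (Hm : Cmod z <> 0) by (intros E; now apply H, Cmod_eq_0).
    assert (Hz : RtoC (Cmod z) <> RtoC 0) by (intros E; apply RtoC_inj in E; auto).
    exists (Cconj z / RtoC (Cmod z))%C. split.
    + rewrite Cmod_div, Cmod_conj, Cmod_R, Rabs_pos_eq by (auto using Cmod_ge_0).
      unfold Rdiv. rewrite Rinv_r; lra.
    + replace (Cconj z / Cmod z * z)%C with ((z * Cconj z) / Cmod z)%C by (field; auto).
      rewrite <- Cmod2_conj, RtoC_pow. simpl. field. auto.
Qed.

Lemma csum_CS {A B : Type} (F : B -> A -> C) (L : list B) :
  (forall b, In b L -> summable (F b)) ->
  summable (fun a => csum (fun b => F b a) L) /\
  csum (fun b => CS (F b)) L = CS (fun a => csum (fun b => F b a) L).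
Proof.
  induction L as [|b L IH]; simpl; intros H.
  - split; [exists 0|now rewrite CS_zero].
    intros l _. rewrite (rsum_ext _ (fun _ => 0 * 0)); [rewrite rsum_scal; lra|].
    intros; rewrite Cmod_0; ring.
  - destruct IH as [S E]; auto. split.
    + apply summable_plus; auto.
    + rewrite E, CS_plus; auto.
Qed.

Lemma csum_onlyif {B : Type} (phi : B -> C) (x : B) z L :
  NoDup L -> csum (fun b => phi b * onlyif (x = b) z)%C L = onlyif (In x L) (phi x * z)%C.
Proof.
  induction 1 as [|b L Hb HL IH]; simpl; [now rewrite onlyif_false|].
  rewrite IH. destruct (classic (b = x)) as [->|E].
  - rewrite (onlyif_false (In x L)), !onlyif_true by auto. ring.
  - rewrite (onlyif_false (x = b)) by auto.
    rewrite (onlyif_iff (b = x \/ In x L) (In x L)) by tauto. ring.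
Qed.

Definition push {A B : Type} (p : A -> B) (f : A -> C) (b : B) : C :=
  CS (fun a => onlyif (p a = b) (f a)).

Section Push.
Context {A B : Type} (p : A -> B) (th : B -> R).
Hypothesis th_pos : forall b, 0 < th b.

Lemma fibre_summable f M b :
  bnd (fun a => th (p a)) f M -> summable (fun a => onlyif (p a = b) (f a)).
Proof.
  intros H. apply (bnd_summable (fun a => th (p a)) _ M (th b)); auto.
  - intros a Ha. destruct (classic (p a = b)) as [->|E]; [lra|].
    rewrite onlyif_false in Ha by auto. easy.
  - intros a. apply Rlt_le, th_pos.
  - eapply bnd_mono; [|apply Rle_refl|apply H].
    intros a. apply Rmult_le_compat_l; [apply Rlt_le, th_pos|apply Cmod_onlyif_le].
Qed.

Lemma csum_push f M phi L :
  NoDup L -> bnd (fun a => th (p a)) f M ->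
  csum (fun b => phi b * push p f b)%C L =
  CS (fun a => onlyif (In (p a) L) (phi (p a) * f a))%C.
Proof.
  intros HL H.
  destruct (csum_CS (fun b a => phi b * onlyif (p a = b) (f a))%C L) as [_ E].
  { intros b _. apply summable_scal. eapply fibre_summable; eauto. }
  rewrite <- (CS_ext (fun a => csum (fun b => phi b * onlyif (p a = b) (f a))%C L)).
  - rewrite <- E. apply csum_ext. intros b _. unfold push. rewrite CS_scal; auto.
    eapply fibre_summable; eauto.
  - intros a. now apply csum_onlyif.
Qed.

(** With phases from [Cphase] the weighted sum of the moduli of the fibre sums over a finite [L]
    becomes one sum over [A], to which the triangle inequality applies. *)
Lemma push_bnd f M :
  bnd (fun a => th (p a)) f M -> bnd th (push p f) M.
Proof.
  intros H L HL.
  pose (c := fun b => proj1_sig (constructive_indefinite_description _ (Cphase (push p f b)))).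
  assert (Hc : forall b, Cmod (c b) <= 1 /\ (c b * push p f b)%C = RtoC (Cmod (push p f b))).
  { intros b. unfold c. now destruct (constructive_indefinite_description _ _). }
  assert (E : csum (fun b => (th b * c b) * push p f b)%C L =
              RtoC (rsum (fun b => th b * Cmod (push p f b)) L)).
  { clear HL. induction L; simpl; [easy|]. rewrite IHL, RtoC_plus, RtoC_mult.
    rewrite <- (proj2 (Hc a)). ring. }
  assert (Hr : 0 <= rsum (fun b => th b * Cmod (push p f b)) L).
  { apply rsum_nonneg. intros b. apply Rmult_le_pos; [apply Rlt_le, th_pos|apply Cmod_ge_0]. }
  rewrite <- (Rabs_pos_eq _ Hr), <- Cmod_R, <- E, (csum_push f M); auto.
  apply CS_norm. eapply bdd_le; [|apply Rle_refl|apply H].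
  intros a. eapply Rle_trans; [apply Cmod_onlyif_le|].
  rewrite !Cmod_mult, Cmod_R, Rabs_pos_eq by (apply Rlt_le, th_pos).
  destruct (Hc (p a)) as [H1 _]. pose proof (Cmod_ge_0 (f a)). pose proof (th_pos (p a)).
  pose proof (Cmod_ge_0 (c (p a))).
  apply Rmult_le_compat_r; auto. nra.
Qed.

(** Fubini along the fibres of [p], for a test function [phi] dominated by the weight. *)
Lemma push_sum f M phi K :
  (forall b, Cmod (phi b) <= K * th b) -> bnd (fun a => th (p a)) f M ->
  summable (fun a => phi (p a) * f a)%C /\
  summable (fun b => phi b * push p f b)%C /\
  CS (fun b => phi b * push p f b)%C = CS (fun a => phi (p a) * f a)%C.
Proof.
  intros Hphi H.
  (* The sign of [K] is read off at a point of [B]; if there is none, both index types are empty and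
     all sums are 0. *)
  destruct (classic (inhabited B)) as [[b0]|HB]; cycle 1.
  { assert (HA : A -> False) by (intros a; apply HB; now constructor; apply p).
    assert (Z1 : forall g : A -> C, summable g).
    { intros g. exists 0. intros [|a l] _; [apply Rle_refl|now destruct (HA a)]. }
    assert (Z2 : forall g : B -> C, summable g).
    { intros g. exists 0. intros [|a l] _; [apply Rle_refl|now destruct (HB (inhabits a))]. }
    repeat split; auto. rewrite !CS_zero; auto; intros b; [now destruct (HA b)|now destruct (HB (inhabits b))]. }
  assert (HK : 0 <= K).
  { pose proof (Hphi b0). pose proof (Cmod_ge_0 (phi b0)). pose proof (th_pos b0). nra. }
  assert (H1 : bdd (fun a => Cmod (phi (p a) * f a)) (K * M)).
  { eapply bdd_le; [|apply Rle_refl|apply (bdd_scal K _ _ HK H)].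
    intros a. cbv beta. rewrite Cmod_mult. rewrite <- Rmult_assoc.
    apply Rmult_le_compat_r; auto using Cmod_ge_0. }
  assert (S1 : summable (fun a => phi (p a) * f a)%C) by (now exists (K * M)).
  assert (S2 : summable (fun b => phi b * push p f b)%C).
  { exists (K * M). eapply bdd_le; [|apply Rle_refl|apply (bdd_scal K _ _ HK (push_bnd f M H))].
    intros b. cbv beta. rewrite Cmod_mult. rewrite <- Rmult_assoc.
    apply Rmult_le_compat_r; auto using Cmod_ge_0. }
  repeat split; auto.
  apply CS_eq; auto. intros e He.
  (* [l0] carries all but [e / 2] of the sum over [A]. Once [L] contains its image, the cut-off to
     [L] is 1 on [l0], so the error only sees terms outside [l0]. *)
  destruct (bdd_tail _ _ (fun a => Cmod_ge_0 _) H1 (e / 2)) as (l0 & N0 & T0); [lra|].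
  exists (map p l0). intros L HL Hi.
  rewrite (csum_push f M phi L HL H).
  set (h := fun a => (phi (p a) * f a)%C) in *.
  assert (S3 : summable (fun a => onlyif (In (p a) L) (h a))).
  { eapply summable_le; [apply S1|]. intros a. apply Cmod_onlyif_le. }
  change (CS (fun a => onlyif (In (p a) L) (phi (p a) * f a)%C))
    with (CS (fun a => onlyif (In (p a) L) (h a))).
  replace (CS (fun a => onlyif (In (p a) L) (h a)) - CS h)%C
    with (CS (fun a => onlyif (In (p a) L) (h a) + (-1) * h a)%C)
    by (rewrite CS_plus, CS_scal; auto; [ring|now apply summable_scal]).
  apply Rle_lt_trans with (e / 2); [|lra]. apply CS_norm.
  intros l Hl.
  pose (inl0 := fun a => if in_dec classic_dec a l0 then true else false).
  apply Rle_trans with (rsum (fun a => Cmod (h a)) (filter (fun a => negb (inl0 a)) l)).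
  - clear Hl. induction l as [|a l IH]; simpl; [lra|].
    unfold inl0 at 1. destruct (in_dec classic_dec a l0) as [Ha|Ha]; simpl.
    + rewrite onlyif_true by (apply Hi, in_map, Ha).
      replace (h a + -1 * h a)%C with (RtoC 0) by ring. rewrite Cmod_0. lra.
    + enough (Cmod (onlyif (In (p a) L) (h a) + -1 * h a) <= Cmod (h a)) by lra.
      destruct (classic (In (p a) L)).
      * rewrite onlyif_true by auto. replace (h a + -1 * h a)%C with (RtoC 0) by ring.
        rewrite Cmod_0. apply Cmod_ge_0.
      * rewrite onlyif_false by auto. replace (0 + -1 * h a)%C with (- h a)%C by ring.
        rewrite Cmod_opp. lra.
  - apply T0; [now apply NoDup_filter|].
    intros a Ha. apply filter_In in Ha. destruct Ha as [_ Ha].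
    unfold inl0 in Ha. now destruct (in_dec classic_dec a l0).
Qed.

End Push.

Lemma push_inj {A B : Type} (p : A -> B) f a :
  (forall x y, p x = p y -> x = y) -> push p f (p a) = f a.
Proof.
  intros Hp. unfold push. rewrite (CS_finite _ (a :: nil)).
  - simpl. rewrite onlyif_true; auto. ring.
  - constructor; [easy|constructor].
  - intros b Hb. rewrite onlyif_false; auto. intros E. apply Hp in E. apply Hb. now left.
Qed.

Lemma push_off {A B : Type} (p : A -> B) f b :
  (forall a, p a <> b) -> push p f b = RtoC 0.
Proof. intros H. apply CS_zero. intros a. now rewrite onlyif_false. Qed.

Lemma push_restrict {A B : Type} (p : A -> B) (f : B -> C) :
  (forall x y, p x = p y -> x = y) -> (forall b, (forall a, p a <> b) -> f b = RtoC 0) ->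
  push p (fun a => f (p a)) = f.
Proof.
  intros Hp Hf. apply functional_extensionality. intros b.
  destruct (classic (exists a, p a = b)) as [[a <-]|E].
  - now rewrite push_inj.
  - rewrite push_off; [symmetry; apply Hf|]; intros a Ha; apply E; now exists a.
Qed.

Lemma CS_inj {A B : Type} (p : A -> B) (f : B -> C) :
  (forall x y, p x = p y -> x = y) -> (forall b, (forall a, p a <> b) -> f b = RtoC 0) ->
  summable (fun a => f (p a)) -> summable f /\ CS f = CS (fun a => f (p a)).
Proof.
  intros Hp Hf [M S].
  destruct (push_sum p (fun _ => 1) (fun _ => Rlt_0_1) (fun a => f (p a)) M (fun _ => RtoC 1) 1)
    as (_ & S' & E).
  - intros b. rewrite Cmod_1. lra.
  - now apply bnd_one.
  - rewrite (push_restrict p f Hp Hf) in S', E.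
    replace (fun b => 1 * f b)%C with f in S', E
      by (apply functional_extensionality; intros; ring).
    split; auto. rewrite E. apply CS_ext. intros; ring.
Qed.

(** Push-forward along the first projection: the fibre over [a] contributes [f a] times the sum of
    [h]. *)
Lemma CS_tensor {A B : Type} (f : A -> C) (h : B -> C) :
  summable f -> summable h ->
  summable (fun q => f (fst q) * h (snd q))%C /\
  CS (fun q => f (fst q) * h (snd q))%C = (CS f * CS h)%C.
Proof.
  intros [M H1] [N H2].
  assert (Hb : bdd (fun q => Cmod (f (fst q) * h (snd q))) (M * N)).
  { eapply bdd_le; [| |apply (bnd_tensor (fun _ => 1) (fun _ => 1) f h M N)];
      auto using bnd_one; intros; simpl; lra. }
  split; [now exists (M * N)|].
  destruct (push_sum (@fst A B) (fun _ => 1) (fun _ => Rlt_0_1)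
     (fun q => f (fst q) * h (snd q))%C (M * N) (fun _ => RtoC 1) 1) as (_ & _ & E).
  - intros b. rewrite Cmod_1. lra.
  - now apply bnd_one.
  - replace (CS (fun q : A * B => f (fst q) * h (snd q))%C)
      with (CS (fun q : A * B => 1 * (f (fst q) * h (snd q)))%C)
      by (apply CS_ext; intros; ring).
    rewrite <- E. rewrite Cmult_comm, <- CS_scal by (now exists M).
    apply CS_ext. intros a. unfold push.
    assert (Sh : summable (fun b : B => f a * h b)%C) by (apply summable_scal; now exists N).
    destruct (CS_inj (fun b : B => (a, b)) (fun q => onlyif (fst q = a) (f (fst q) * h (snd q)))%C)
      as [_ E'].
    + intros x y E'. congruence.
    + intros [a' b'] Hn. apply onlyif_false. intros <-. now apply (Hn b').
    + eapply summable_le; [apply Sh|]. intros b. apply Cmod_onlyif_le.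
    + rewrite E'. cbv beta.
      rewrite (CS_ext _ (fun b => f a * h b)%C) by (intros b; now apply onlyif_true).
      rewrite CS_scal by (now exists N). ring.
Qed.

(** * Weighted convolution algebras *)

(** One structure covers the three index sets in play, namely the modes, the modes graded by powers
    of eps, and a single point, so that [nlin] and its estimates are written once. *)
Record inv_magma := InvMagma {
  car :> Type;
  madd : car -> car -> car;
  mneg : car -> car;
  neg_neg : forall a, mneg (mneg a) = a;
  neg_add : forall a b, mneg (madd a b) = madd (mneg a) (mneg b) }.
Arguments madd {_}.
Arguments mneg {_}.

Definition conv {G : inv_magma} (f h : G -> C) : G -> C :=
  push (fun q => madd (fst q) (snd q)) (fun q => f (fst q) * h (snd q))%C.

(** The coefficients of the complex conjugate function, since conjugation exchanges the modes m and
    -m. *)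
Definition dag {G : inv_magma} (f : G -> C) (a : G) : C := Cconj (f (mneg a)).

Definition nlin {G : inv_magma} (Om sg : R) (w u : G -> C) (a : G) : C :=
  (- (Om * u a) - conv u w a + sg * conv u (conv u (dag u)) a)%C.

(** Submultiplicativity makes weighted l^1 closed under [conv] with constant 1; evenness makes [dag]
    norm-preserving. *)
Record is_weight {G : inv_magma} (th : G -> R) : Prop := {
  weight_pos : forall a, 0 < th a;
  weight_add : forall a b, th (madd a b) <= th a * th b;
  weight_neg : forall a, th (mneg a) = th a }.

Lemma Cconj_R (x : R) : Cconj (RtoC x) = RtoC x.
Proof. unfold Cconj, RtoC; simpl. now rewrite Ropp_0. Qed.

Section Involution.
Context {G : inv_magma}.
Implicit Types f h u w : G -> C.

Lemma dag_conv f h : dag (conv f h) = conv (dag f) (dag h).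
Proof.
  apply functional_extensionality. intros a. unfold dag at 1, conv, push.
  rewrite <- CS_conj.
  rewrite <- (CS_bij (fun q : G * G => (mneg (fst q), mneg (snd q)))
                     (fun q : G * G => (mneg (fst q), mneg (snd q))))
    by (intros [x y]; simpl; now rewrite !neg_neg).
  apply CS_ext. intros [x y]; simpl. rewrite onlyif_conj, Cmult_conj. unfold dag.
  apply onlyif_iff. rewrite <- neg_add. split; intros E.
  - rewrite <- (neg_neg _ (madd x y)), E. apply neg_neg.
  - now rewrite E.
Qed.

Lemma dag_nlin Om sg w u : dag w = w -> dag (nlin Om sg w u) = nlin Om sg w (dag u).
Proof.
  intros Hw. apply functional_extensionality. intros a.
  assert (E : conv (dag u) w = dag (conv u w)) by now rewrite dag_conv, Hw.
  unfold nlin at 2. rewrite E, <- !dag_conv.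
  unfold dag at 1, nlin. rewrite Cplus_conj, Cminus_conj, Copp_conj, !Cmult_conj, !Cconj_R.
  reflexivity.
Qed.

End Involution.

Section Weighted.
Context {G : inv_magma} (th : G -> R).
Hypothesis Hth : is_weight th.
Implicit Types f h u w z : G -> C.

Lemma tensor_bnd_add f h M N :
  bnd th f M -> bnd th h N ->
  bnd (fun q => th (madd (fst q) (snd q))) (fun q => f (fst q) * h (snd q))%C (M * N).
Proof.
  intros H1 H2. destruct Hth as [Hp Ha _].
  eapply bnd_mono; [|apply Rle_refl|apply (bnd_tensor th th f h M N); auto; intros; apply Rlt_le; auto].
  intros q. apply Rmult_le_compat_r; auto using Cmod_ge_0.
Qed.

Lemma bnd_conv f h M N : bnd th f M -> bnd th h N -> bnd th (conv f h) (M * N).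
Proof.
  intros H1 H2. apply push_bnd; [apply Hth|]. now apply tensor_bnd_add.
Qed.

Lemma bnd_dag f M : bnd th f M -> bnd th (dag f) M.
Proof.
  intros H l Hl.
  rewrite (rsum_ext _ (fun a => th (mneg a) * Cmod (f (mneg a)))).
  - rewrite <- (rsum_map mneg (fun a => th a * Cmod (f a))). apply H.
    apply NoDup_map_inj; auto. intros a b E. rewrite <- (neg_neg _ a), E. apply neg_neg.
  - intros a _. unfold dag. now rewrite Cmod_conj, (weight_neg _ Hth).
Qed.

Lemma conv_summable f h M N a : bnd th f M -> bnd th h N ->
  summable (fun q => onlyif (madd (fst q) (snd q) = a) (f (fst q) * h (snd q))%C).
Proof.
  intros H1 H2.
  apply (fibre_summable (fun q => madd (fst q) (snd q)) th (weight_pos _ Hth) _ (M * N)).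
  now apply tensor_bnd_add.
Qed.

Lemma conv_minus_l f f' h M M' N a :
  bnd th f M -> bnd th f' M' -> bnd th h N ->
  conv (fun b => f b - f' b)%C h a = (conv f h a - conv f' h a)%C.
Proof.
  intros H1 H2 H3. unfold conv, push.
  pose proof (conv_summable f h M N a H1 H3) as S1.
  pose proof (conv_summable f' h M' N a H2 H3) as S2.
  transitivity (CS (fun q => onlyif (madd (fst q) (snd q) = a) (f (fst q) * h (snd q)) +
    (-1) * onlyif (madd (fst q) (snd q) = a) (f' (fst q) * h (snd q))))%C.
  - apply CS_ext. intros q. destruct (classic (madd (fst q) (snd q) = a)).
    + rewrite !onlyif_true by auto. ring.
    + rewrite !onlyif_false by auto. ring.
  - rewrite CS_plus, CS_scal; auto; [ring|now apply summable_scal].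
Qed.

Lemma conv_minus_r f h h' M N N' a :
  bnd th f M -> bnd th h N -> bnd th h' N' ->
  conv f (fun b => h b - h' b)%C a = (conv f h a - conv f h' a)%C.
Proof.
  intros H1 H2 H3. unfold conv, push.
  pose proof (conv_summable f h M N a H1 H2) as S1.
  pose proof (conv_summable f h' M N' a H1 H3) as S2.
  transitivity (CS (fun q => onlyif (madd (fst q) (snd q) = a) (f (fst q) * h (snd q)) +
    (-1) * onlyif (madd (fst q) (snd q) = a) (f (fst q) * h' (snd q))))%C.
  - apply CS_ext. intros q. destruct (classic (madd (fst q) (snd q) = a)).
    + rewrite !onlyif_true by auto. ring.
    + rewrite !onlyif_false by auto. ring.
  - rewrite CS_plus, CS_scal; auto; [ring|now apply summable_scal].
Qed.

Lemma nlin_bnd Om sg w u Mw M :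
  bnd th w Mw -> bnd th u M ->
  bnd th (nlin Om sg w u) ((Rabs Om + Mw) * M + Rabs sg * M ^ 3).
Proof.
  intros Hw Hu. pose proof (fun a => Rlt_le _ _ (weight_pos _ Hth a)) as Hp.
  replace ((Rabs Om + Mw) * M + Rabs sg * M ^ 3)
    with ((Cmod Om * M + M * Mw) + Cmod sg * (M * (M * M))) by (rewrite !Cmod_R; ring).
  unfold nlin. apply bnd_plus; auto.
  - apply bnd_minus; auto.
    + apply bnd_opp, bnd_scal; auto. + now apply bnd_conv.
  - apply bnd_scal. repeat apply bnd_conv; auto. now apply bnd_dag.
Qed.

(** The cubic term is changed one factor at a time, with the old factors to the left and the new
    ones to the right; the three factors account for the 3. *)
Lemma nlin_lip Om sg w u z Mw M D :
  bnd th w Mw -> bnd th u M -> bnd th z M -> bnd th (fun a => u a - z a)%C D ->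
  bnd th (fun a => nlin Om sg w u a - nlin Om sg w z a)%C
    ((Rabs Om + Mw + 3 * Rabs sg * M ^ 2) * D).
Proof.
  intros Hw Hu Hz Hd. pose proof (fun a => Rlt_le _ _ (weight_pos _ Hth a)) as Hp.
  set (d := fun a => (u a - z a)%C) in *.
  pose proof (bnd_dag _ _ Hu) as Hu'. pose proof (bnd_dag _ _ Hz) as Hz'.
  pose proof (bnd_dag _ _ Hd) as Hd'.
  pose proof (bnd_conv _ _ _ _ Hu Hu') as Huu. pose proof (bnd_conv _ _ _ _ Hz Hz') as Hzz.
  assert (E : (fun a => nlin Om sg w u a - nlin Om sg w z a)%C =
    (fun a => (- (Om * d a) - conv d w a) +
       sg * (conv d (conv u (dag u)) a + (conv z (conv d (dag u)) a + conv z (conv z (dag d)) a)))%C).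
  { assert (Edd : dag d = (fun a => dag u a - dag z a)%C).
    { apply functional_extensionality. intros a. unfold dag, d. now rewrite Cminus_conj. }
    assert (E1 : conv d (dag u) = (fun b => conv u (dag u) b - conv z (dag u) b)%C).
    { apply functional_extensionality. intros b. apply (conv_minus_l u z (dag u) M M M b); auto. }
    assert (E2 : conv z (dag d) = (fun b => conv z (dag u) b - conv z (dag z) b)%C).
    { apply functional_extensionality. intros b. rewrite Edd.
      apply (conv_minus_r z (dag u) (dag z) M M M b); auto. }
    apply functional_extensionality. intros a. rewrite E1, E2.
    pose proof (bnd_conv _ _ _ _ Hz Hu') as Hzu.
    unfold d at 2 3. rewrite (conv_minus_l u z w M M Mw a), (conv_minus_l u z _ M M (M * M) a),
      (conv_minus_r z _ _ M (M * M) (M * M) a), (conv_minus_r z _ _ M (M * M) (M * M) a); auto.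
    unfold d, nlin. ring. }
  rewrite E.
  replace ((Rabs Om + Mw + 3 * Rabs sg * M ^ 2) * D) with
    ((Cmod Om * D + D * Mw) + Cmod sg * (D * (M * M) + (M * (D * M) + M * (M * D))))
    by (rewrite !Cmod_R; ring).
  apply bnd_plus; auto.
  - apply bnd_minus; auto.
    + apply bnd_opp, bnd_scal; auto. + now apply bnd_conv.
  - apply bnd_scal, bnd_plus; auto; [|apply bnd_plus; auto]; repeat apply bnd_conv; auto.
Qed.

End Weighted.

(* Used with chi = eps^k to evaluate power series in eps (eps = 0 included), and with
   chi = e^{imx/2} and a one-point target to evaluate Fourier series. *)
Section Evaluation.
Context {G H : inv_magma} (p : G -> H) (chi : G -> C) (th : G -> R) (tau : H -> R).
Hypothesis Hth : is_weight th.
Hypothesis Htau : is_weight tau.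
Hypothesis p_add : forall a b, p (madd a b) = madd (p a) (p b).
Hypothesis p_neg : forall a, p (mneg a) = mneg (p a).
Hypothesis chi_add : forall a b, chi (madd a b) = (chi a * chi b)%C.
Hypothesis chi_neg : forall a, chi (mneg a) = Cconj (chi a).
Hypothesis chi_le : forall a, tau (p a) * Cmod (chi a) <= th a.

Definition eval (f : G -> C) : H -> C := push p (fun a => chi a * f a)%C.

Lemma twist_bnd f M : bnd th f M -> bnd (fun a => tau (p a)) (fun a => chi a * f a)%C M.
Proof.
  intros Hf. eapply bnd_mono; [|apply Rle_refl|apply Hf].
  intros a. cbv beta. rewrite Cmod_mult, <- Rmult_assoc.
  apply Rmult_le_compat_r; auto using Cmod_ge_0.
Qed.

Lemma eval_bnd f M : bnd th f M -> bnd tau (eval f) M.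
Proof. intros Hf. apply push_bnd; [apply Htau|]. now apply twist_bnd. Qed.

Lemma eval_summable f M b : bnd th f M -> summable (fun a => onlyif (p a = b) (chi a * f a)%C).
Proof. intros Hf. eapply (fibre_summable p tau); [apply Htau|]. now apply twist_bnd, Hf. Qed.

Lemma eval_plus f h M N b : bnd th f M -> bnd th h N ->
  eval (fun a => f a + h a)%C b = (eval f b + eval h b)%C.
Proof.
  intros H1 H2. unfold eval, push. rewrite <- CS_plus by eauto using eval_summable.
  apply CS_ext. intros a. destruct (classic (p a = b)).
  - rewrite !onlyif_true by auto. ring.
  - rewrite !onlyif_false by auto. ring.
Qed.

Lemma eval_scal c f M b : bnd th f M ->
  eval (fun a => c * f a)%C b = (c * eval f b)%C.
Proof.
  intros H1. unfold eval, push. rewrite <- CS_scal by eauto using eval_summable.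
  apply CS_ext. intros a. rewrite onlyif_mult. f_equal. ring.
Qed.

Lemma eval_dag f : eval (dag f) = dag (eval f).
Proof.
  apply functional_extensionality. intros b. unfold eval, dag, push.
  rewrite <- CS_conj. rewrite <- (CS_bij mneg mneg) by apply neg_neg.
  apply CS_ext. intros a. rewrite onlyif_conj, Cmult_conj, neg_neg, chi_neg.
  apply onlyif_iff. rewrite p_neg. split; intros E.
  - rewrite <- E. symmetry. apply neg_neg.
  - rewrite E. apply neg_neg.
Qed.

Lemma eval_conv f h M N : bnd th f M -> bnd th h N ->
  eval (conv f h) = conv (eval f) (eval h).
Proof.
  intros H1 H2. apply functional_extensionality. intros b.
  pose proof (weight_pos _ Htau) as Tp. pose proof (weight_pos _ Hth) as Hp.
  (* Both sides are brought to this sum over the pairs in [G] whose sum lies above [b]: the left one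
     by Fubini along [madd], the right one by Fubini along [p] in each factor. *)
  pose (S := CS (fun q : G * G => onlyif (p (madd (fst q) (snd q)) = b)
       ((chi (fst q) * f (fst q)) * (chi (snd q) * h (snd q)))%C)).
  transitivity S.
  - unfold eval, push at 1.
    (* The test function is [chi] cut off to the fibre over [b]; there [chi_le] dominates it by [th]
       with the constant [/ tau b]. *)
    destruct (push_sum (fun q : G * G => madd (fst q) (snd q)) th Hp
       (fun q => f (fst q) * h (snd q))%C (M * N)
       (fun a => onlyif (p a = b) (chi a)) (/ tau b)) as (_ & _ & E).
    + intros a. destruct (classic (p a = b)) as [<-|Ha].
      * rewrite onlyif_true by auto.
        apply Rmult_le_reg_l with (tau (p a)); auto.
        rewrite <- Rmult_assoc, Rinv_r, Rmult_1_l by (apply Rgt_not_eq, Tp). apply chi_le.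
      * rewrite onlyif_false, Cmod_0 by auto.
        apply Rmult_le_pos; apply Rlt_le; auto using Rinv_0_lt_compat.
    + now apply tensor_bnd_add.
    + fold (conv f h) in E. rewrite (CS_ext _ (fun a => onlyif (p a = b) (chi a) * conv f h a)%C).
      * rewrite E. apply CS_ext. intros q.
        rewrite (Cmult_comm (onlyif _ _)), onlyif_mult. f_equal. rewrite chi_add. ring.
      * intros a. rewrite (Cmult_comm (onlyif _ _)), onlyif_mult. f_equal. ring.
  - unfold conv, push at 1.
    destruct (push_sum (fun q : G * G => (p (fst q), p (snd q)))
       (fun q : H * H => tau (fst q) * tau (snd q))
       (fun q => Rmult_lt_0_compat _ _ (Tp _) (Tp _))
       (fun q => (chi (fst q) * f (fst q)) * (chi (snd q) * h (snd q)))%C (M * N)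
       (fun q => onlyif (madd (fst q) (snd q) = b) (RtoC 1)) (/ tau b)) as (_ & _ & E).
    + intros [x y]; simpl. destruct (classic (madd x y = b)) as [<-|Ha].
      * rewrite onlyif_true, Cmod_1 by auto.
        apply Rmult_le_reg_l with (tau (madd x y)); auto.
        rewrite <- Rmult_assoc, Rinv_r, Rmult_1_l, Rmult_1_r by (apply Rgt_not_eq, Tp).
        apply (weight_add _ Htau).
      * rewrite onlyif_false, Cmod_0 by auto.
        apply Rmult_le_pos; [apply Rlt_le; auto using Rinv_0_lt_compat|].
        apply Rmult_le_pos; apply Rlt_le; auto.
    + apply (bnd_tensor (fun a => tau (p a)) (fun a => tau (p a))
         (fun a => chi a * f a)%C (fun a => chi a * h a)%C);
        auto using twist_bnd; intros; apply Rlt_le; auto.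
    + transitivity (CS (fun q : H * H => onlyif (madd (fst q) (snd q) = b) 1 *
        push (fun q : G * G => (p (fst q), p (snd q)))
        (fun q => (chi (fst q) * f (fst q)) * (chi (snd q) * h (snd q))) q))%C.
      * rewrite E. apply CS_ext. intros q. simpl.
        rewrite p_add, (Cmult_comm (onlyif _ _)), onlyif_mult. f_equal. ring.
      * apply CS_ext. intros [x y]. simpl.
        rewrite (Cmult_comm (onlyif _ _)), onlyif_mult, Cmult_1_r. f_equal.
        unfold eval, push.
        destruct (CS_tensor (fun a => onlyif (p a = x) (chi a * f a)%C)
          (fun a => onlyif (p a = y) (chi a * h a)%C)) as [_ E'];
          [eauto using eval_summable|eauto using eval_summable|].
        rewrite <- E'. apply CS_ext. intros [a c]; simpl.
        destruct (classic (p a = x)) as [E1|E1]; destruct (classic (p c = y)) as [E2|E2].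
        -- rewrite !onlyif_true; congruence.
        -- rewrite (onlyif_false ((p a, p c) = (x, y))), (onlyif_false (p c = y)) by congruence. ring.
        -- rewrite (onlyif_false ((p a, p c) = (x, y))), (onlyif_false (p a = x)) by congruence. ring.
        -- rewrite (onlyif_false ((p a, p c) = (x, y))), (onlyif_false (p a = x)) by congruence. ring.
Qed.

Lemma eval_nlin Om sg w u Mw M :
  bnd th w Mw -> bnd th u M ->
  eval (nlin Om sg w u) = nlin Om sg (eval w) (eval u).
Proof.
  intros Hw Hu. pose proof (fun a => Rlt_le _ _ (weight_pos _ Hth a)) as Hp.
  pose proof (bnd_dag _ Hth _ _ Hu) as Hu'.
  pose proof (bnd_conv _ Hth _ _ _ _ Hu Hw) as Huw.
  pose proof (bnd_conv _ Hth _ _ _ _ Hu Hu') as Huu.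
  pose proof (bnd_conv _ Hth _ _ _ _ Hu Huu) as Huuu.
  unfold nlin at 2. rewrite <- eval_dag.
  rewrite <- (eval_conv u w M Mw), <- (eval_conv u (dag u) M M), <- (eval_conv u _ M (M * M)); auto.
  apply functional_extensionality. intros b.
  replace (nlin Om sg w u) with
    (fun a => ((- RtoC Om) * u a + (-1) * conv u w a) + sg * conv u (conv u (dag u)) a)%C
    by (apply functional_extensionality; intros a; unfold nlin; ring).
  erewrite eval_plus, eval_plus, !eval_scal; eauto using bnd_scal, bnd_plus.
  ring.
Qed.

End Evaluation.

(** * Picard iteration *)

(** [Lim_seq] is total and [real] sends infinite limits to 0, so [Clim] is defined for every
    sequence and commutes with conjugation unconditionally. *)
Definition Clim (f : nat -> C) : C :=
  (real (Lim_seq (fun K => fst (f K))), real (Lim_seq (fun K => snd (f K)))).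

Lemma Clim_conj f : Clim (fun K => Cconj (f K)) = Cconj (Clim f).
Proof.
  unfold Clim, Cconj; simpl. f_equal. rewrite Lim_seq_opp.
  now destruct (Lim_seq (fun K => snd (f K))); simpl; rewrite ?Ropp_0.
Qed.

Lemma half_pow_small c e : 0 < e -> exists K, forall j, (K <= j)%nat -> c * (1 / 2) ^ j < e.
Proof.
  intros He. destruct (pow_lt_1_zero (1 / 2)) with (y := e / (Rabs c + 1)) as [K HK].
  - rewrite Rabs_pos_eq; lra.
  - apply Rdiv_lt_0_compat; auto. pose proof (Rabs_pos c); lra.
  - exists K. intros j Hj. specialize (HK j Hj).
    rewrite Rabs_pos_eq in HK by (apply pow_le; lra).
    pose proof (Rabs_pos c). pose proof (Rle_abs c).
    assert (0 <= (1 / 2) ^ j) by (apply pow_le; lra).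
    apply (Rmult_lt_compat_r (Rabs c + 1)) in HK; [|lra].
    unfold Rdiv in HK. rewrite Rmult_assoc, Rinv_l in HK by lra. nra.
Qed.

Lemma Clim_cauchy (f : nat -> C) c :
  (forall K j, Cmod (f (K + j)%nat - f K) <= c * (1 / 2) ^ K) ->
  forall e, 0 < e -> exists K0, forall K, (K0 <= K)%nat -> Cmod (f K - Clim f) < e.
Proof.
  intros H.
  assert (Hc : forall g : C -> R, (forall z w, Rabs (g z - g w) <= Cmod (z - w)) ->
     forall e, 0 < e -> exists K0, forall K, (K0 <= K)%nat ->
       Rabs (g (f K) - real (Lim_seq (fun K => g (f K)))) < e).
  { intros g Hg. assert (Hl : ex_finite_lim_seq (fun K => g (f K))).
    { apply ex_lim_seq_cauchy_corr. intros e.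
      destruct (half_pow_small (2 * c) e (cond_pos e)) as [K HK].
      exists K. intros i j Hi Hj.
      specialize (HK K (le_n K)).
      pose proof (H K (i - K)%nat) as H1. pose proof (H K (j - K)%nat) as H2.
      replace (K + (i - K))%nat with i in H1 by lia. replace (K + (j - K))%nat with j in H2 by lia.
      eapply Rle_lt_trans; [apply Hg|].
      replace (f i - f j)%C with ((f i - f K) - (f j - f K))%C by ring.
      eapply Rle_lt_trans; [apply Cmod_minus_le|lra]. }
    apply Lim_seq_correct' in Hl. intros e He.
    apply is_lim_seq_spec in Hl. destruct (Hl (mkposreal e He)) as [K0 HK0].
    exists K0. intros K HK. now apply HK0. }
  intros e He.
  destruct (Hc fst) with (e := e / 2) as [K1 H1]; [|lra|].
  { intros z w. apply (Cmod_fst (z - w)). }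
  destruct (Hc snd) with (e := e / 2) as [K2 H2]; [|lra|].
  { intros z w. apply (Cmod_snd (z - w)). }
  exists (max K1 K2). intros K HK.
  specialize (H1 K ltac:(lia)). specialize (H2 K ltac:(lia)).
  eapply Rle_lt_trans; [apply Cmod_le_abs|]. unfold Clim. simpl. unfold Rminus in *. lra.
Qed.

(** Fatou for the weighted l^1 norm: pointwise limits pass through a finite list, and [M] does not
    depend on the list. *)
Lemma bnd_limit {A : Type} (th : A -> R) (F : nat -> A -> C) f M :
  (forall a, 0 <= th a) ->
  (forall a e, 0 < e -> exists K0, forall K, (K0 <= K)%nat -> Cmod (F K a - f a) < e) ->
  (exists K1, forall K, (K1 <= K)%nat -> bnd th (F K) M) -> bnd th f M.
Proof.
  intros Hp Hc [K1 HK1] l Hl.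
  apply le_epsilon. intros e He.
  assert (G : forall l e, 0 < e -> exists K0, forall K, (K0 <= K)%nat ->
     rsum (fun a => th a * Cmod (f a)) l <= rsum (fun a => th a * Cmod (F K a)) l + e).
  { clear - Hp Hc. induction l as [|a l IH]; intros e He; simpl.
    - exists 0%nat. intros; lra.
    - destruct (IH (e / 2)) as [K1 H1]; [lra|].
      destruct (Hc a (e / 2 / (th a + 1))) as [K2 H2].
      { specialize (Hp a). apply Rdiv_lt_0_compat; lra. }
      exists (max K1 K2). intros K HK.
      specialize (H1 K ltac:(lia)). specialize (H2 K ltac:(lia)).
      enough (th a * Cmod (f a) <= th a * Cmod (F K a) + e / 2) by lra.
      assert (Cmod (f a) <= Cmod (F K a) + e / 2 / (th a + 1)).
      { replace (f a) with (F K a - (F K a - f a))%C by ring.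
        eapply Rle_trans; [apply Cmod_minus_le|lra]. }
      assert (th a * (e / 2 / (th a + 1)) <= e / 2).
      { specialize (Hp a). apply Rmult_le_reg_r with (th a + 1); [lra|].
        unfold Rdiv. rewrite !Rmult_assoc, Rinv_l by lra. nra. }
      specialize (Hp a). nra. }
  destruct (G l e He) as [K0 HK0].
  specialize (HK0 (max K0 K1) ltac:(lia)). specialize (HK1 (max K0 K1) ltac:(lia) l Hl).
  cbv beta in HK1. lra.
Qed.

Section Contraction.
Context {A : Type} (th : A -> R) (step : (A -> C) -> A -> C) (M : R).
Hypothesis th_pos : forall a, 0 < th a.
Hypothesis step_bnd : forall f, bnd th f M -> bnd th (step f) M.
Hypothesis step_lip : forall f h D, bnd th f M -> bnd th h M ->
  bnd th (fun a => f a - h a)%C D -> bnd th (fun a => step f a - step h a)%C (D / 2).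

Lemma bnd_small_eq (f h : A -> C) c :
  (forall j, bnd th (fun a => f a - h a)%C (c * (1 / 2) ^ j)) -> f = h.
Proof.
  intros H. apply functional_extensionality. intros a. apply Cmod_dist_eq_0.
  intros e He. destruct (half_pow_small c (th a * e)) as [K HK].
  { apply Rmult_lt_0_compat; auto. }
  specialize (HK K (le_n K)). specialize (H K). apply bdd_term with (a := a) in H. cbv beta in H.
  apply Rmult_le_reg_l with (th a); auto. lra.
Qed.

Lemma fixpoint_unique f h :
  bnd th f M -> bnd th h M -> step f = f -> step h = h -> f = h.
Proof.
  intros Hf Hh Ef Eh. apply (bnd_small_eq f h (M + M)). intros j.
  induction j as [|j IH].
  - simpl. rewrite Rmult_1_r. apply bnd_minus; auto. intros a; now apply Rlt_le.
  - rewrite <- Ef, <- Eh. replace ((M + M) * (1 / 2) ^ S j) with ((M + M) * (1 / 2) ^ j / 2)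
      by (simpl; field). now apply step_lip.
Qed.

Definition picard (K : nat) : A -> C := Nat.iter K step (fun _ => RtoC 0).

Definition fixpoint (a : A) : C := Clim (fun K => picard K a).

Hypothesis M_pos : 0 <= M.

Lemma picard_bnd K : bnd th (picard K) M.
Proof.
  induction K as [|K IH]; simpl; [|now apply step_bnd].
  intros l _. rewrite (rsum_ext _ (fun _ => 0 * 0)); [rewrite rsum_scal; lra|].
  intros a _. rewrite Cmod_0; ring.
Qed.

Lemma picard_diff K : bnd th (fun a => picard (S K) a - picard K a)%C (2 * M * (1 / 2) ^ K).
Proof.
  induction K as [|K IH].
  - simpl pow. rewrite Rmult_1_r. replace (2 * M) with (M + M) by ring.
    apply bnd_minus; try apply picard_bnd. intros a; now apply Rlt_le.
  - replace (2 * M * (1 / 2) ^ S K) with (2 * M * (1 / 2) ^ K / 2) by (simpl; field).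
    apply (step_lip (picard (S K)) (picard K)); auto using picard_bnd.
Qed.

Lemma picard_cauchy K j :
  bnd th (fun a => picard (K + j) a - picard K a)%C (4 * M * (1 / 2) ^ K).
Proof.
  assert (H : bnd th (fun a => picard (K + j) a - picard K a)%C
      (4 * M * (1 / 2) ^ K - 4 * M * (1 / 2) ^ (K + j))).
  { induction j as [|j IH].
    - rewrite Nat.add_0_r. intros l _. rewrite (rsum_ext _ (fun _ => 0 * 0)); [rewrite rsum_scal; lra|].
      intros a _. replace (picard K a - picard K a)%C with (RtoC 0) by ring. rewrite Cmod_0; ring.
    - replace (fun a => picard (K + S j) a - picard K a)%C with
        (fun a => (picard (S (K + j)) a - picard (K + j) a) + (picard (K + j) a - picard K a))%C
        by (apply functional_extensionality; intros a; rewrite Nat.add_succ_r; ring).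
      eapply bdd_le; [intros a; apply Rle_refl| |
        apply (bnd_plus th _ _ _ _ (fun a => Rlt_le _ _ (th_pos a)) (picard_diff (K + j)) IH)].
      rewrite Nat.add_succ_r. simpl. lra. }
  eapply bdd_le; [intros a; apply Rle_refl| |apply H].
  assert (0 <= (1 / 2) ^ (K + j)) by (apply pow_le; lra). nra.
Qed.

Lemma picard_lim a e : 0 < e ->
  exists K0, forall K, (K0 <= K)%nat -> Cmod (picard K a - fixpoint a) < e.
Proof.
  apply (Clim_cauchy (fun K => picard K a) (4 * M / th a)).
  intros K j. pose proof (bdd_term _ _ a (picard_cauchy K j)) as H. cbv beta in H.
  apply Rmult_le_reg_l with (th a); auto. eapply Rle_trans; [apply H|].
  right. field. apply Rgt_not_eq, th_pos.
Qed.

Lemma fixpoint_bnd : bnd th fixpoint M.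
Proof.
  apply (bnd_limit th picard).
  - intros a; now apply Rlt_le. - apply picard_lim.
  - exists 0%nat. intros; apply picard_bnd.
Qed.

Lemma fixpoint_eq : step fixpoint = fixpoint.
Proof.
  assert (H : forall K, bnd th (fun a => fixpoint a - picard K a)%C (4 * M * (1 / 2) ^ K)).
  { intros K. apply (bnd_limit th (fun j a => picard (K + j) a - picard K a)%C).
    - intros a; now apply Rlt_le.
    - intros a e He. destruct (picard_lim a e He) as [K0 H0]. exists K0. intros j Hj.
      replace (picard (K + j) a - picard K a - (fixpoint a - picard K a))%C
        with (picard (K + j) a - fixpoint a)%C by ring. apply H0; lia.
    - exists 0%nat. intros j _. apply picard_cauchy. }
  apply (bnd_small_eq _ _ (4 * M)). intros K.
  (* Comparison with the iterate [S K] on both sides: either difference is of order [(1 / 2) ^ K],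
     and [K] is arbitrary. *)
  replace (fun a => step fixpoint a - fixpoint a)%C with
    (fun a => (step fixpoint a - step (picard K) a) - (fixpoint a - picard (S K) a))%C
    by (apply functional_extensionality; intros a; simpl; ring).
  replace (4 * M * (1 / 2) ^ K) with (4 * M * (1 / 2) ^ K / 2 + 4 * M * (1 / 2) ^ S K)
    by (simpl; field).
  apply bnd_minus; auto.
  - intros a; now apply Rlt_le.
  - apply step_lip; auto using fixpoint_bnd, picard_bnd.
Qed.

End Contraction.

(** * Index sets, weights and the non-resonant inverse *)

Definition modes : inv_magma := InvMagma Z Z.add Z.opp Z.opp_involutive Z.opp_add_distr.

(* The pair (m, k) stands for the monomial eps^k e^{imx/2}. *)
Definition graded_modes : inv_magma.
Proof.
  refine (InvMagma (Z * nat) (fun p q => ((fst p + fst q)%Z, (snd p + snd q)%nat))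
    (fun p => ((- fst p)%Z, snd p)) _ _).
  - intros [m k]; simpl. now rewrite Z.opp_involutive.
  - intros [m k] [m' k']; simpl. now rewrite Z.opp_add_distr.
Defined.

Definition point : inv_magma :=
  InvMagma unit (fun _ _ => tt) (fun _ => tt) (fun a => match a with tt => eq_refl end) (fun _ _ => eq_refl).

Definition wt (r : nat) (m : Z) : R := (1 + Rabs (IZR m)) ^ r.

(** In the second index this is the norm of power series that converge absolutely for eps of modulus
    at most [eta]. *)
Definition gwt (r : nat) (eta : R) (q : Z * nat) : R := wt r (fst q) * eta ^ snd q.

Lemma wt_ge_1 r m : 1 <= wt r m.
Proof. apply pow_R1_Rle. pose proof (Rabs_pos (IZR m)). lra. Qed.

Lemma wt_weight r : is_weight (G := modes) (wt r).
Proof.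
  constructor.
  - intros m. pose proof (wt_ge_1 r m). lra.
  - intros a b. unfold wt. rewrite <- Rpow_mult_distr. apply pow_incr.
    simpl. rewrite plus_IZR. pose proof (Rabs_triang (IZR a) (IZR b)).
    pose proof (Rabs_pos (IZR a)). pose proof (Rabs_pos (IZR b)).
    pose proof (Rabs_pos (IZR a + IZR b)). nra.
  - intros a. unfold wt. simpl. now rewrite opp_IZR, Rabs_Ropp.
Qed.

Lemma gwt_weight r eta : 0 < eta -> is_weight (G := graded_modes) (gwt r eta).
Proof.
  intros He. destruct (wt_weight r) as [W1 W2 W3]. constructor.
  - intros q. apply Rmult_lt_0_compat; auto. now apply pow_lt.
  - intros [a k] [b j]. unfold gwt. simpl. rewrite pow_add.
    replace (wt r a * eta ^ k * (wt r b * eta ^ j)) with ((wt r a * wt r b) * (eta ^ k * eta ^ j)) by ring.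
    apply Rmult_le_compat_r; [|apply W2].
    apply Rmult_le_pos; apply pow_le; lra.
  - intros [a k]. unfold gwt. simpl. f_equal. apply W3.
Qed.

(** A sequence that does not depend on eps, seen as a series with only a constant term; [raise]
    below is multiplication by eps. *)
Definition lift0 (f : Z -> C) (q : Z * nat) : C :=
  match snd q with O => f (fst q) | S _ => RtoC 0 end.

Definition raise (f : Z * nat -> C) (q : Z * nat) : C :=
  match snd q with O => RtoC 0 | S k => f (fst q, k) end.

Lemma lift0_bnd r eta f M : 0 < eta -> bnd (wt r) f M -> bnd (gwt r eta) (lift0 f) M.
Proof.
  intros He H.
  replace (lift0 f) with (push (fun m => (m, O)) f).
  - apply push_bnd; [apply (gwt_weight r eta He)|].
    eapply bnd_mono; [|apply Rle_refl|apply H]. intros m. unfold gwt; simpl. lra.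
  - apply (push_restrict (fun m => (m, O)) (lift0 f)).
    + congruence.
    + intros [m [|k]] E; simpl; [now destruct (E m)|easy].
Qed.

Lemma raise_bnd r eta f M : 0 < eta -> bnd (gwt r eta) f M -> bnd (gwt r eta) (raise f) (eta * M).
Proof.
  intros He H.
  replace (raise f) with (push (fun q => (fst q, S (snd q))) f).
  - apply push_bnd; [apply (gwt_weight r eta He)|].
    eapply bdd_le; [|apply Rle_refl|apply (bdd_scal eta); [lra|apply H]].
    intros m. unfold gwt; simpl. right; ring.
  - rewrite <- (push_restrict (fun q => (fst q, S (snd q))) (raise f)).
    + f_equal. apply functional_extensionality. now intros [m k].
    + intros [x k] [y j] E; simpl in E. congruence.
    + intros [m [|k]] E; simpl; [easy|now destruct (E (m, k))].
Qed.

Definition core (n : nat) (a b : C) (m : Z) : C :=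
  if (m =? Z.of_nat n)%Z then a else if (m =? - Z.of_nat n)%Z then b else RtoC 0.

(* Inverse of the non-resonant part of d^2/dx^2 + n^2/4 on the modes of the parity of n. *)
Definition ell (n : nat) (m : Z) : R :=
  if (Bool.eqb (Z.even m) (Z.even (Z.of_nat n)) && negb (Z.abs m =? Z.of_nat n)%Z)%bool
  then 4 / ((INR n) ^ 2 - (IZR m) ^ 2) else 0.

(** The difference of squares is a product of two non-zero integers. There are thus no small
    divisors, and [ell] is bounded by 4 uniformly in [n] and [m]. *)
Lemma ell_denominator n m : Z.abs m <> Z.of_nat n -> 1 <= Rabs ((INR n) ^ 2 - (IZR m) ^ 2).
Proof.
  intros H. rewrite INR_IZR_INZ, !pow_IZR, <- minus_IZR, <- abs_IZR. apply IZR_le.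
  replace (Z.of_nat n ^ Z.of_nat 2 - m ^ Z.of_nat 2)%Z with
    ((Z.of_nat n - m) * (Z.of_nat n + m))%Z by (change (Z.of_nat 2) with 2%Z; ring).
  rewrite Z.abs_mul. nia.
Qed.

Lemma ell_le n m : Rabs (ell n m) <= 4.
Proof.
  unfold ell. destruct (Bool.eqb _ _); simpl; [|rewrite Rabs_R0; lra].
  destruct (Z.eqb_spec (Z.abs m) (Z.of_nat n)) as [E|E]; simpl; [rewrite Rabs_R0; lra|].
  pose proof (ell_denominator n m E) as H. rewrite Rabs_div, (Rabs_pos_eq 4).
  - apply Rmult_le_reg_r with (Rabs ((INR n) ^ 2 - (IZR m) ^ 2)); [lra|].
    unfold Rdiv. rewrite Rmult_assoc, Rinv_l by lra. lra.
  - lra.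
  - intros E0. simpl in H, E0. rewrite E0, Rabs_R0 in H. lra.
Qed.

Lemma ell_bnd {A : Type} (p : A -> Z) (th : A -> R) n f M :
  (forall a, 0 <= th a) -> bnd th f M -> bnd th (fun a => ell n (p a) * f a)%C (4 * M).
Proof.
  intros Hp H. eapply bdd_le; [|apply Rle_refl|apply (bdd_scal 4); [lra|apply H]].
  intros a. cbv beta. rewrite Cmod_mult, Cmod_R.
  pose proof (ell_le n (p a)). pose proof (Cmod_ge_0 (f a)). specialize (Hp a).
  replace (th a * (Rabs (ell n (p a)) * Cmod (f a))) with (Rabs (ell n (p a)) * (th a * Cmod (f a))) by ring.
  apply Rmult_le_compat_r; auto. now apply Rmult_le_pos.
Qed.

Section Picard.
Context (n : nat) (Om sg : R) (w : Z -> C).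

Definition gstep (a b : C) (f : Z * nat -> C) (q : Z * nat) : C :=
  (lift0 (core n a b) q +
   raise (fun q => ell n (fst q) * nlin (G := graded_modes) Om sg (lift0 w) f q) q)%C.

Definition gsol (a b : C) : Z * nat -> C := fixpoint (gstep a b).

Lemma raise_minus f h q : (raise f q - raise h q = raise (fun q => f q - h q) q)%C.
Proof. unfold raise. destruct q as [m [|k]]; simpl; ring. Qed.

Context (r : nat) (Mw s0 eta : R).
Hypothesis Hw : bnd (wt r) w Mw.
Hypothesis Heta : 0 < eta.
(** On the ball of radius [2 * s0] the Lipschitz constant of [nlin] is the bracket, with 12 coming
    from [3 * 2 ^ 2]. The factor 4 of [ell] and the factor [eta] of [raise] then leave the
    contraction factor 1/2. *)
Hypothesis eta_small : 8 * eta * (Rabs Om + Mw + 12 * Rabs sg * s0 ^ 2) <= 1.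
Context (a b : C).
Hypothesis Hab : bnd (wt r) (core n a b) s0.

Let Hg := gwt_weight r eta Heta.
Let Hgp := fun q => Rlt_le _ _ (weight_pos _ Hg q).

Lemma gstep_bnd f : bnd (gwt r eta) f (2 * s0) -> bnd (gwt r eta) (gstep a b f) (2 * s0).
Proof.
  intros Hf. pose proof (bdd_ge0 _ _ Hab) as Hs. pose proof (bdd_ge0 _ _ Hw) as HMw.
  pose proof (Rabs_pos Om). pose proof (Rabs_pos sg).
  eapply bdd_le; [intros q; apply Rle_refl| |apply (bnd_plus (gwt r eta))].
  2: apply Hgp.
  2: now apply lift0_bnd, Hab.
  2: { apply raise_bnd; auto. apply ell_bnd; [apply Hgp|].
       apply (nlin_bnd _ Hg); [now apply lift0_bnd, Hw|apply Hf]. }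
  (* The core uses up [s0] of the radius; the Lipschitz condition keeps the nonlinear part below the
     other [s0], with the subtracted term to spare. *)
  replace (s0 + eta * (4 * ((Rabs Om + Mw) * (2 * s0) + Rabs sg * (2 * s0) ^ 3)))
    with (s0 * (1 + (8 * eta * (Rabs Om + Mw + 12 * Rabs sg * s0 ^ 2) - 64 * eta * Rabs sg * s0 ^ 2)))
    by ring.
  assert (0 <= 64 * eta * Rabs sg * s0 ^ 2).
  { apply Rmult_le_pos; [nra|apply pow2_ge_0]. }
  nra.
Qed.

Lemma gstep_lip f h D : bnd (gwt r eta) f (2 * s0) -> bnd (gwt r eta) h (2 * s0) ->
  bnd (gwt r eta) (fun q => f q - h q)%C D ->
  bnd (gwt r eta) (fun q => gstep a b f q - gstep a b h q)%C (D / 2).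
Proof.
  intros Hf Hh Hd. pose proof (bdd_ge0 _ _ Hd) as HD.
  replace (fun q => gstep a b f q - gstep a b h q)%C with
    (raise (fun q => ell n (fst q) * (nlin (G := graded_modes) Om sg (lift0 w) f q
              - nlin (G := graded_modes) Om sg (lift0 w) h q))%C).
  - eapply bdd_le; [intros q; apply Rle_refl| |].
    2: { apply raise_bnd; auto. apply ell_bnd; [apply Hgp|].
         apply (nlin_lip _ Hg Om sg (lift0 w) f h Mw (2 * s0) D); auto. now apply lift0_bnd, Hw. }
    replace (eta * (4 * ((Rabs Om + Mw + 3 * Rabs sg * (2 * s0) ^ 2) * D))) with
      (8 * eta * (Rabs Om + Mw + 12 * Rabs sg * s0 ^ 2) * (D / 2)) by field.
    nra.
  - apply functional_extensionality. intros q. unfold gstep.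
    match goal with |- _ = (?x + ?y - (?x + ?z))%C => replace (x + y - (x + z))%C with (y - z)%C by ring end.
    rewrite raise_minus. unfold raise. destruct (snd q); auto. ring.
Qed.

Lemma gsol_spec :
  bnd (gwt r eta) (gsol a b) (2 * s0) /\ gstep a b (gsol a b) = gsol a b.
Proof.
  pose proof (bdd_ge0 _ _ Hab) as Hs. split.
  - apply fixpoint_bnd; auto using gstep_bnd, gstep_lip; [apply Hg|lra].
  - apply (fixpoint_eq (gwt r eta) _ (2 * s0)); auto using gstep_bnd, gstep_lip; [apply Hg|lra].
Qed.

End Picard.

(** * Evaluation of the power series in eps *)

Lemma CS_nat_split (g : nat -> C) :
  summable g -> CS g = (g O + CS (fun k => g (S k)))%C.
Proof.
  intros H.
  assert (HS : summable (fun k => g (S k))) by (apply summable_reindex; auto; congruence).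
  set (g1 := fun k => match k with O => RtoC 0 | S _ => g k end).
  destruct (CS_inj S g1) as [H1 E1]; [congruence| |exact HS|].
  { intros [|k] Hk; [easy|now destruct (Hk k)]. }
  set (g0 := fun k => match k with O => g O | S _ => RtoC 0 end).
  assert (E0 : CS g0 = g O).
  { rewrite (CS_finite g0 (O :: nil)); [simpl; ring|repeat constructor; easy|].
    intros [|k] Hk; [destruct Hk; now left|easy]. }
  rewrite <- E0. unfold g1 in E1 at 2. rewrite <- E1, <- CS_plus; auto.
  - apply CS_ext. intros [|k]; simpl; ring.
  - eapply summable_le; [apply H|]. intros [|k]; simpl; [lra|rewrite Cmod_0; apply Cmod_ge_0].
Qed.

Definition gpow (eps : R) (q : Z * nat) : C := RtoC (eps ^ snd q).

Definition eps_eval (eps : R) : (Z * nat -> C) -> Z -> C :=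
  eval (G := graded_modes) (H := modes) fst (gpow eps).

Lemma gpow_le r eta eps q : Rabs eps <= eta -> wt r (fst q) * Cmod (gpow eps q) <= gwt r eta q.
Proof.
  intros H. pose proof (wt_ge_1 r (fst q)). unfold gpow, gwt. rewrite Cmod_R, <- RPow_abs.
  apply Rmult_le_compat_l; [lra|]. apply pow_incr. split; auto. apply Rabs_pos.
Qed.

Lemma gpow_add eps (p q : graded_modes) : gpow eps (madd p q) = (gpow eps p * gpow eps q)%C.
Proof. unfold gpow. simpl. now rewrite pow_add, RtoC_mult. Qed.

Lemma gpow_neg eps (q : graded_modes) : gpow eps (mneg q) = Cconj (gpow eps q).
Proof. unfold gpow. simpl. now rewrite Cconj_R. Qed.

Lemma eps_eval_series r eta eps f M m :
  0 < eta -> Rabs eps <= eta -> bnd (gwt r eta) f M ->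
  summable (fun k => RtoC (eps ^ k) * f (m, k))%C /\
  eps_eval eps f m = CS (fun k => RtoC (eps ^ k) * f (m, k))%C.
Proof.
  intros He Hl Hf.
  pose proof (eval_summable (G := graded_modes) (H := modes) fst (gpow eps) _ _
    (wt_weight r) (fun q => gpow_le r eta eps q Hl) f M m Hf) as Hs.
  pose proof (summable_reindex (fun k => (m, k)) _ (fun x y E => f_equal snd E) Hs) as Hk.
  cbv beta in Hk. simpl in Hk.
  assert (E : (fun k => onlyif (m = m) (gpow eps (m, k) * f (m, k))%C) =
              (fun k => RtoC (eps ^ k) * f (m, k))%C).
  { apply functional_extensionality. intros k. now rewrite onlyif_true. }
  rewrite E in Hk. split; [rewrite <- E; now rewrite E|].
  unfold eps_eval, eval, push. simpl.
  destruct (CS_inj (fun k => (m, k)) (fun q : Z * nat => onlyif (fst q = m) (gpow eps q * f q)%C))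
    as [_ E2].
  - congruence.
  - intros [m' k] Hn. apply onlyif_false. simpl. intros <-. now apply (Hn k).
  - simpl. now rewrite E.
  - rewrite E2. simpl. now rewrite E.
Qed.

Lemma eps_eval_lift0 eps f : eps_eval eps (lift0 f) = f.
Proof.
  apply functional_extensionality. intros m. unfold eps_eval, eval, push.
  rewrite (CS_finite _ ((m, O) :: nil)).
  - simpl. rewrite onlyif_true by easy. unfold gpow, lift0; simpl. ring.
  - repeat constructor. easy.
  - intros [m' [|k]] H; simpl.
    + apply onlyif_false. intros <-. apply H. now left.
    + unfold lift0; simpl. rewrite Cmult_0_r. unfold onlyif. now destruct (excluded_middle_informative _).
Qed.

Lemma core_dag n a b : (1 <= n)%nat -> core n (Cconj b) (Cconj a) = dag (G := modes) (core n a b).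
Proof.
  intros Hn. apply functional_extensionality. intros m. unfold dag, core. simpl.
  destruct (Z.eqb_spec m (Z.of_nat n)), (Z.eqb_spec (- m) (Z.of_nat n)),
    (Z.eqb_spec m (- Z.of_nat n)), (Z.eqb_spec (- m) (- Z.of_nat n)); try lia; auto.
  now rewrite Cconj_R.
Qed.

Section Solution.
Context (n : nat) (Om sg : R) (w : Z -> C).

Definition gnl (a b : C) : Z * nat -> C :=
  nlin (G := graded_modes) Om sg (lift0 w) (gsol n Om sg w a b).

(* The coefficient of eps^0 in gnl a b is nlin (core n a b), i.e. the left-hand side of the
   bifurcation equations up to sign; the higher ones, divided by eps, make up A and B. *)
Definition reduced (m : Z) (eps : R) (a b : C) : C :=
  CS (fun k => RtoC (eps ^ k) * gnl a b (m, S k))%C.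

Definition usol (eps : R) (a b : C) : Z -> C := eps_eval eps (gsol n Om sg w a b).

(** Each Picard iterate has the symmetry, because [core] exchanges its two entries, [ell] is real
    and even, and [nlin] commutes with [dag]; [Clim] passes it on even without convergence. The
    relation between [A] and [B] thus holds for all [a] and [b]. *)
Lemma gsol_dag a b : (1 <= n)%nat -> dag (G := modes) w = w ->
  gsol n Om sg w (Cconj b) (Cconj a) = dag (G := graded_modes) (gsol n Om sg w a b).
Proof.
  intros Hn Hw.
  assert (Hwl : dag (G := graded_modes) (lift0 w) = lift0 w).
  { apply functional_extensionality. intros [m [|k]]; unfold dag, lift0; simpl.
    - change (dag (G := modes) w m = w m). now rewrite Hw.
    - apply Cconj_R. }
  assert (HP : forall K, picard (gstep n Om sg w (Cconj b) (Cconj a)) K =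
     dag (G := graded_modes) (picard (gstep n Om sg w a b) K)).
  { induction K as [|K IH].
    - apply functional_extensionality. intros q. unfold dag. simpl. now rewrite Cconj_R.
    - change (gstep n Om sg w (Cconj b) (Cconj a) (picard (gstep n Om sg w (Cconj b) (Cconj a)) K)
        = dag (G := graded_modes) (gstep n Om sg w a b (picard (gstep n Om sg w a b) K))).
      rewrite IH. apply functional_extensionality. intros [m k].
      unfold dag at 2, gstep. rewrite <- (dag_nlin _ _ _ _ Hwl), core_dag by auto.
      rewrite Cplus_conj. unfold lift0, raise, dag. simpl. destruct k; simpl.
      + now rewrite Cconj_R.
      + rewrite Cmult_conj, !Cconj_R. do 3 f_equal.
        unfold ell. now rewrite Z.even_opp, Z.abs_opp, opp_IZR, <- (Rsqr_pow2 (- _)), <- Rsqr_neg, Rsqr_pow2. }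
  unfold gsol, fixpoint. apply functional_extensionality. intros q.
  unfold dag. rewrite <- Clim_conj. f_equal. apply functional_extensionality. intros K.
  now rewrite HP.
Qed.

Lemma reduced_dag m eps a b : (1 <= n)%nat -> dag (G := modes) w = w ->
  reduced m eps a b = Cconj (reduced (- m) eps (Cconj b) (Cconj a)).
Proof.
  intros Hn Hw. unfold reduced. rewrite <- CS_conj. apply CS_ext. intros k.
  rewrite Cmult_conj, Cconj_R. f_equal. unfold gnl. rewrite gsol_dag by auto.
  rewrite <- dag_nlin.
  - unfold dag; simpl. now rewrite Z.opp_involutive, Cconj_conj.
  - apply functional_extensionality. intros [m' [|k']]; unfold dag, lift0; simpl.
    + change (dag (G := modes) w m' = w m'). now rewrite Hw.
    + apply Cconj_R.
Qed.

Context (r : nat) (Mw s0 eta : R).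
Hypothesis Hw : bnd (wt r) w Mw.
Hypothesis Heta : 0 < eta.
Hypothesis eta_small : 8 * eta * (Rabs Om + Mw + 12 * Rabs sg * s0 ^ 2) <= 1.
Context (a b : C).
Hypothesis Hab : bnd (wt r) (core n a b) s0.

(** The bound of [nlin_bnd] at radius [2 * s0], divided by [s0]. The split-off factor [s0] later
    becomes a multiple of |a| + |b| and makes the bounds on [A] and [B] linear. *)
Definition nlin_const := 2 * (Rabs Om + Mw) + 8 * Rabs sg * s0 ^ 2.

Lemma gnl_bnd : bnd (gwt r eta) (gnl a b) (nlin_const * s0).
Proof.
  destruct (gsol_spec n Om sg w r Mw s0 eta Hw Heta eta_small a b Hab) as [H _].
  unfold nlin_const.
  replace ((2 * (Rabs Om + Mw) + 8 * Rabs sg * s0 ^ 2) * s0) with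
    ((Rabs Om + Mw) * (2 * s0) + Rabs sg * (2 * s0) ^ 3) by ring.
  apply (nlin_bnd (G := graded_modes) _ (gwt_weight r eta Heta)); auto. now apply lift0_bnd.
Qed.

(** Dropping the order-0 term and lowering the remaining orders by one costs the factor [/ eta]. *)
Lemma reduced_bdd m : bdd (fun k => eta ^ k * Cmod (gnl a b (m, S k))) (/ eta * (nlin_const * s0)).
Proof.
  intros l Hl.
  eapply Rle_trans; [apply (rsum_le _ (fun k => / eta * (gwt r eta (m, S k) * Cmod (gnl a b (m, S k)))))|].
  - intros k _. unfold gwt; simpl. pose proof (wt_ge_1 r m).
    assert (0 <= eta ^ k * Cmod (gnl a b (m, S k))).
    { apply Rmult_le_pos; [apply pow_le; lra|apply Cmod_ge_0]. }
    replace (/ eta * (wt r m * (eta * eta ^ k) * Cmod (gnl a b (m, S k)))) with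
      (wt r m * (eta ^ k * Cmod (gnl a b (m, S k)))) by (field; lra).
    nra.
  - rewrite rsum_scal. apply Rmult_le_compat_l; [left; now apply Rinv_0_lt_compat|].
    rewrite <- (rsum_map (fun k => (m, S k)) (fun q => gwt r eta q * Cmod (gnl a b q))).
    apply gnl_bnd. apply NoDup_map_inj; auto. congruence.
Qed.

Context (eps : R).
Hypothesis eps_small : Rabs eps <= eta.

Lemma reduced_term_bdd m :
  bdd (fun k => Cmod (RtoC (eps ^ k) * gnl a b (m, S k))) (/ eta * (nlin_const * s0)).
Proof.
  eapply bdd_le; [|apply Rle_refl|apply (reduced_bdd m)].
  intros k. cbv beta. rewrite Cmod_mult, Cmod_R, <- RPow_abs.
  apply Rmult_le_compat_r; [apply Cmod_ge_0|]. apply pow_incr. split; auto. apply Rabs_pos.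
Qed.

Lemma reduced_le m : Cmod (reduced m eps a b) <= / eta * (nlin_const * s0).
Proof. apply CS_norm, reduced_term_bdd. Qed.

Lemma usol_bnd : bnd (wt r) (usol eps a b) (2 * s0).
Proof.
  destruct (gsol_spec n Om sg w r Mw s0 eta Hw Heta eta_small a b Hab) as [H _].
  apply (eval_bnd (G := graded_modes) (H := modes) fst (gpow eps) (gwt r eta) (wt r) (wt_weight r)); auto.
  intros q. now apply gpow_le.
Qed.

Lemma usol_nlin : nlin (G := modes) Om sg w (usol eps a b) = eps_eval eps (gnl a b).
Proof.
  destruct (gsol_spec n Om sg w r Mw s0 eta Hw Heta eta_small a b Hab) as [H _].
  unfold usol. rewrite <- (eps_eval_lift0 eps w) at 1.
  unfold eps_eval, gnl. symmetry.
  apply (eval_nlin (G := graded_modes) (H := modes) fst (gpow eps) (gwt r eta) (wt r)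
    (gwt_weight r eta Heta) (wt_weight r)) with (Mw := Mw) (M := 2 * s0);
    auto using gpow_add, gpow_neg, lift0_bnd.
  intros q. now apply gpow_le.
Qed.

Lemma usol_eq m :
  usol eps a b m = (core n a b m + eps * (ell n m * nlin (G := modes) Om sg w (usol eps a b) m))%C.
Proof.
  destruct (gsol_spec n Om sg w r Mw s0 eta Hw Heta eta_small a b Hab) as [H Heq].
  rewrite usol_nlin. unfold usol.
  destruct (eps_eval_series r eta eps _ _ m Heta eps_small H) as [S1 ->].
  destruct (eps_eval_series r eta eps _ _ m Heta eps_small gnl_bnd) as [S2 ->].
  rewrite CS_nat_split by auto.
  assert (E0 : gsol n Om sg w a b (m, O) = core n a b m).
  { rewrite <- Heq. unfold gstep, lift0, raise. simpl. ring. }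
  assert (ES : forall k, gsol n Om sg w a b (m, S k) = (ell n m * gnl a b (m, k))%C).
  { intros k. rewrite <- Heq. unfold gstep, lift0 at 1, raise. simpl. unfold gnl. ring. }
  rewrite E0, <- CS_scal by auto. rewrite <- CS_scal by (now apply summable_scal).
  simpl pow. rewrite Cmult_1_l. f_equal. apply CS_ext.
  intros k. rewrite ES, RtoC_mult. ring.
Qed.

Lemma usol_nlin_split m :
  nlin (G := modes) Om sg w (usol eps a b) m =
  (gnl a b (m, O) + eps * reduced m eps a b)%C.
Proof.
  rewrite usol_nlin.
  destruct (eps_eval_series r eta eps _ _ m Heta eps_small gnl_bnd) as [S2 ->].
  rewrite CS_nat_split by auto. unfold reduced. rewrite <- CS_scal.
  - simpl. rewrite Cmult_1_l. f_equal. apply CS_ext. intros k. rewrite RtoC_mult. ring.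
  - eexists. apply reduced_term_bdd.
Qed.

End Solution.

(** Evaluation at eps = 0 keeps exactly the order-0 coefficients, and there the fixed point is
    [core n a b] itself. *)
Lemma gnl_order0 n Om sg w r Mw s0 eta a b m :
  bnd (wt r) w Mw -> 0 < eta -> 8 * eta * (Rabs Om + Mw + 12 * Rabs sg * s0 ^ 2) <= 1 ->
  bnd (wt r) (core n a b) s0 ->
  gnl n Om sg w a b (m, O) = nlin (G := modes) Om sg w (core n a b) m.
Proof.
  intros Hw He Hs Hab.
  assert (H0 : Rabs 0 <= eta) by (rewrite Rabs_R0; lra).
  assert (E : usol n Om sg w 0 a b = core n a b).
  { apply functional_extensionality. intros x.
    rewrite (usol_eq n Om sg w r Mw s0 eta Hw He Hs a b Hab 0 H0). now rewrite Cmult_0_l, Cplus_0_r. }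
  rewrite <- E, (usol_nlin_split n Om sg w r Mw s0 eta Hw He Hs a b Hab 0 H0). now rewrite Cmult_0_l, Cplus_0_r.
Qed.

Lemma conv_core n a b (h : Z -> C) m : (1 <= n)%nat ->
  conv (G := modes) (core n a b) h m = (a * h (m - Z.of_nat n)%Z + b * h (m + Z.of_nat n)%Z)%C.
Proof.
  intros Hn. unfold conv, push.
  rewrite (CS_finite _ ((Z.of_nat n, (m - Z.of_nat n)%Z) :: ((- Z.of_nat n)%Z, (m + Z.of_nat n)%Z) :: nil)).
  - simpl. unfold core. rewrite !onlyif_true by lia.
    rewrite Z.eqb_refl. replace (- Z.of_nat n =? Z.of_nat n)%Z with false by (symmetry; apply Z.eqb_neq; lia).
    rewrite Z.eqb_refl. ring.
  - constructor; [|repeat constructor; easy]. simpl. intros [E|[]]. injection E. lia.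
  - intros [x y] H. simpl in *.
    unfold core. destruct (Z.eqb_spec x (Z.of_nat n)) as [->|E1].
    { apply onlyif_false. intros E. apply H. left. f_equal. lia. }
    destruct (Z.eqb_spec x (- Z.of_nat n)) as [->|E2].
    { apply onlyif_false. intros E. apply H. right; left. f_equal. lia. }
    rewrite Cmult_0_l. unfold onlyif. now destruct (excluded_middle_informative _).
Qed.

Lemma core_at n a b : (1 <= n)%nat ->
  core n a b (Z.of_nat n) = a /\ core n a b (- Z.of_nat n) = b /\
  forall m, Z.abs m <> Z.of_nat n -> core n a b m = RtoC 0.
Proof.
  intros Hn. unfold core. rewrite !Z.eqb_refl. repeat split.
  - replace (- Z.of_nat n =? Z.of_nat n)%Z with false by (symmetry; apply Z.eqb_neq; lia). auto.
  - intros m Hm. destruct (Z.eqb_spec m (Z.of_nat n)); [lia|].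
    destruct (Z.eqb_spec m (- Z.of_nat n)); [lia|auto].
Qed.

(** At mode n, [a] meets the mode 0 of |U|^2, which is |a|^2 + |b|^2, and [b] meets its mode 2n,
    which is a times the conjugate of b; the latter supplies the second |b|^2. The entries at 3n and
    -3n vanish, and [w 0 = 0] removes the self-coupling. *)
Lemma nlin_core n Om sg (w : Z -> C) a b : (1 <= n)%nat -> w 0%Z = RtoC 0 ->
  nlin (G := modes) Om sg w (core n a b) (Z.of_nat n) =
    (- (Om * a + w (2 * Z.of_nat n)%Z * b
        - sg * RtoC ((Cmod a) ^ 2 + 2 * (Cmod b) ^ 2) * a))%C /\
  nlin (G := modes) Om sg w (core n a b) (- Z.of_nat n)%Z =
    (- (Om * b + w (- (2 * Z.of_nat n))%Z * a
        - sg * RtoC (2 * (Cmod a) ^ 2 + (Cmod b) ^ 2) * b))%C.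
Proof.
  intros Hn Hw0. unfold nlin. rewrite !conv_core by auto. unfold dag. change (@mneg modes) with Z.opp.
  set (N := Z.of_nat n) in *. assert (HN : (1 <= N)%Z) by lia.
  destruct (core_at n a b Hn) as (Ca & Cb & C0). fold N in Ca, Cb, C0.
  replace (N - N)%Z with 0%Z by lia. replace (N + N)%Z with (2 * N)%Z by lia.
  replace (- N - N)%Z with (- (2 * N))%Z by lia. replace (- N + N)%Z with 0%Z by lia.
  replace (- (0 - N))%Z with N by lia. replace (- (0 + N))%Z with (- N)%Z by lia.
  replace (- (2 * N - N))%Z with (- N)%Z by lia. replace (- (- (2 * N) + N))%Z with N by lia.
  rewrite Ca, Cb, (C0 (- (2 * N + N))%Z), (C0 (- (- (2 * N) - N))%Z), Hw0 by lia.
  rewrite Cconj_R, !RtoC_plus, !RtoC_mult, !Cmod2_conj. split; ring.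
Qed.

(** * Absolutely convergent Fourier series *)

Lemma cis_plus s t : cis (s + t) = (cis s * cis t)%C.
Proof. unfold cis, Cmult; simpl. rewrite cos_plus, sin_plus. f_equal; ring. Qed.

Lemma cis_opp t : cis (- t) = Cconj (cis t).
Proof. unfold cis, Cconj; simpl. now rewrite cos_neg, sin_antisym. Qed.

Lemma cis_0 : cis 0 = RtoC 1.
Proof. unfold cis. now rewrite cos_0, sin_0. Qed.

Lemma Cmod_cis t : Cmod (cis t) = 1.
Proof.
  unfold Cmod, cis; simpl. rewrite !Rmult_1_r.
  pose proof (sin2_cos2 t) as H. unfold Rsqr in H. rewrite Rplus_comm, H. apply sqrt_1.
Qed.

(** Frequencies are half-integers, so 4 pi is a common period for even and odd modes alike. *)
Lemma cis_2PI (m : Z) : cis (IZR m * (4 * PI) / 2) = RtoC 1.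
Proof.
  assert (E1 : cis (2 * PI) = RtoC 1) by (unfold cis; now rewrite cos_2PI, sin_2PI).
  assert (Hn : forall k : nat, cis (INR k * (2 * PI)) = RtoC 1).
  { induction k as [|k IH]; [rewrite Rmult_0_l; apply cis_0|].
    rewrite S_INR, Rmult_plus_distr_r, Rmult_1_l, cis_plus, IH, E1. ring. }
  replace (IZR m * (4 * PI) / 2) with (IZR m * (2 * PI)) by field.
  destruct (Z_le_gt_dec 0 m) as [H|H].
  - rewrite <- (Z2Nat.id m H), <- INR_IZR_INZ. apply Hn.
  - replace (IZR m * (2 * PI)) with (- (IZR (- m) * (2 * PI))) by (rewrite opp_IZR; ring).
    rewrite cis_opp, <- (Z2Nat.id (- m)), <- INR_IZR_INZ, Hn by lia. apply Cconj_R.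
Qed.

Lemma cis_lip s t : Cmod (cis s - cis t) <= 2 * Rabs (s - t).
Proof.
  assert (L : forall f f' : R -> R, (forall x, is_derive f x (f' x)) -> (forall x, Rabs (f' x) <= 1) ->
     Rabs (f s - f t) <= Rabs (s - t)).
  { intros f f' Hd Hb.
    destruct (MVT_gen f t s f') as (c & _ & E).
    - intros x _. apply Hd.
    - intros x _. apply derivable_continuous_pt. exists (f' x). now apply is_derive_Reals.
    - rewrite E, Rabs_mult. pose proof (Rabs_pos (s - t)). specialize (Hb c). nra. }
  eapply Rle_trans; [apply Cmod_le_abs|]. unfold cis; simpl.
  pose proof (L cos (fun x => - sin x)) as L1. pose proof (L sin cos) as L2.
  unfold Rminus in L1, L2.
  enough (Rabs (cos s + - cos t) <= Rabs (s + - t) /\ Rabs (sin s + - sin t) <= Rabs (s + - t))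
    by (unfold Rminus; lra).
  split; [apply L1|apply L2]; intros x; try apply is_derive_cos; try apply is_derive_sin;
    rewrite ?Rabs_Ropp; apply Rabs_le; pose proof (SIN_bound x); pose proof (COS_bound x); lra.
Qed.

(** * Derivatives of complex-valued functions of a real variable *)

Definition Cderiv (f : R -> C) (x : R) (l : C) : Prop :=
  forall e, 0 < e -> exists d, 0 < d /\
    forall y, Rabs (y - x) < d -> Cmod (f y - f x - RtoC (y - x) * l) <= e * Rabs (y - x).

Lemma C_R_norm (z : C) : norm (V := C_R_NormedModule) z = Cmod z.
Proof.
  destruct z as [x y]. unfold Cmod. simpl.
  change (sqrt (Rabs x ^ 2 + Rabs y ^ 2) = sqrt (x * (x * 1) + y * (y * 1))).
  rewrite !pow2_abs. f_equal; ring.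
Qed.

(** The explicit remainder estimate in [Cmod] is the form that products and infinite sums are
    handled in; this lemma translates to and from the library notion. *)
Lemma is_derive_Cderiv f x l :
  is_derive (K := R_AbsRing) (V := C_R_NormedModule) f x l <-> Cderiv f x l.
Proof.
  assert (E : forall y, norm (V := C_R_NormedModule) (minus (minus (f y) (f x)) (scal (minus y x) l))
     = Cmod (f y - f x - RtoC (y - x) * l)).
  { intros y. rewrite C_R_norm. f_equal. destruct l as [l1 l2].
    unfold minus, plus, opp, scal, Cminus, Cplus, Copp, Cmult, RtoC; simpl.
    unfold prod_plus, prod_opp, prod_scal; simpl.
    unfold plus, opp, scal; simpl. unfold mult; simpl. f_equal; ring. }
  split.
  - intros [_ H] e He. destruct (H x (fun P HP => HP) (mkposreal e He)) as [d Hd].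
    exists d. split; [apply cond_pos|]. intros y Hy. specialize (Hd y Hy). now rewrite E in Hd.
  - intros H. split; [apply is_linear_scal_l|].
    intros x' Hx'. replace x' with x by now apply is_filter_lim_locally_unique.
    intros [e He]. destruct (H e He) as (d & Hd & Hy).
    exists (mkposreal d Hd). intros y Hb. rewrite E. now apply Hy.
Qed.

Lemma Cderiv_unique f x l l' : Cderiv f x l -> Cderiv f x l' -> l = l'.
Proof.
  intros H1 H2. apply Cmod_dist_eq_0. intros e He.
  destruct (H1 (e / 2)) as (d1 & P1 & K1); [lra|]. destruct (H2 (e / 2)) as (d2 & P2 & K2); [lra|].
  set (h := Rmin d1 d2 / 2).
  pose proof (Rmin_l d1 d2). pose proof (Rmin_r d1 d2).
  assert (Hh : 0 < h) by (unfold h; pose proof (Rmin_pos d1 d2 P1 P2); lra).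
  assert (Ea : Rabs (x + h - x) = h) by (replace (x + h - x) with h by ring; apply Rabs_pos_eq; lra).
  specialize (K1 (x + h)). specialize (K2 (x + h)).
  rewrite Ea in K1, K2. unfold h in K1, K2 at 1.
  specialize (K1 ltac:(unfold h; lra)). specialize (K2 ltac:(unfold h; lra)). fold h in K1, K2.
  replace (x + h - x) with h in K1, K2 by ring.
  apply Rmult_le_reg_l with h; auto.
  replace (h * Cmod (l - l')) with (Cmod (RtoC h * (l - l'))) by (rewrite Cmod_mult, Cmod_R, Rabs_pos_eq; lra).
  replace (RtoC h * (l - l'))%C with
    ((f (x + h)%R - f x - RtoC h * l') - (f (x + h)%R - f x - RtoC h * l))%C by ring.
  eapply Rle_trans; [apply Cmod_minus_le|lra].
Qed.

Lemma Cderiv_minus f g x l m :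
  Cderiv f x l -> Cderiv g x m -> Cderiv (fun y => f y - g y)%C x (l - m)%C.
Proof.
  intros H1 H2 e He.
  destruct (H1 (e / 2)) as (d1 & P1 & K1); [lra|]. destruct (H2 (e / 2)) as (d2 & P2 & K2); [lra|].
  exists (Rmin d1 d2). split; [now apply Rmin_pos|]. intros y Hy.
  pose proof (Rmin_l d1 d2). pose proof (Rmin_r d1 d2).
  specialize (K1 y ltac:(lra)). specialize (K2 y ltac:(lra)).
  replace (f y - g y - (f x - g x) - RtoC (y - x) * (l - m))%C with
    ((f y - f x - RtoC (y - x) * l) - (g y - g x - RtoC (y - x) * m))%C by ring.
  eapply Rle_trans; [apply Cmod_minus_le|lra].
Qed.

Lemma Cderiv_mult f g x l m :
  Cderiv f x l -> Cderiv g x m -> Cderiv (fun y => f y * g y)%C x (l * g x + f x * m)%C.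
Proof.
  intros H1 H2 e He.
  pose proof (Cmod_ge_0 (f x)). pose proof (Cmod_ge_0 (g x)).
  pose proof (Cmod_ge_0 l). pose proof (Cmod_ge_0 m).
  (* The remainder of the product has three terms. [G] bounds [g] near [x]; [e1] keeps the first two
     terms together below [e / 2], and [d3] does so for the third. *)
  set (G := Cmod (g x) + Cmod m + 1). set (e1 := e / (2 * (G + Cmod (f x)))).
  assert (HG : 1 <= G) by (unfold G; lra).
  assert (He1 : 0 < e1) by (apply Rdiv_lt_0_compat; lra).
  set (d3 := e / (2 * (Cmod l * (Cmod m + 1) + 1))).
  assert (Hd3 : 0 < d3) by (apply Rdiv_lt_0_compat; nra).
  destruct (H1 e1 He1) as (d1 & P1 & K1). destruct (H2 (Rmin e1 1)) as (d2 & P2 & K2).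
  { apply Rmin_pos; lra. }
  exists (Rmin (Rmin d1 d2) (Rmin d3 1)). split; [repeat apply Rmin_pos; lra|].
  intros y Hy.
  pose proof (Rmin_l (Rmin d1 d2) (Rmin d3 1)). pose proof (Rmin_r (Rmin d1 d2) (Rmin d3 1)).
  pose proof (Rmin_l d1 d2). pose proof (Rmin_r d1 d2). pose proof (Rmin_l d3 1). pose proof (Rmin_r d3 1).
  pose proof (Rmin_l e1 1). pose proof (Rmin_r e1 1).
  specialize (K1 y ltac:(lra)). specialize (K2 y ltac:(lra)).
  set (h := Rabs (y - x)) in *. assert (Hh : 0 <= h) by apply Rabs_pos.
  set (F := (f y - f x - RtoC (y - x) * l)%C) in *.
  set (E := (g y - g x - RtoC (y - x) * m)%C) in *.
  assert (Dg : Cmod (g y - g x) <= (Cmod m + 1) * h).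
  { replace (g y - g x)%C with (RtoC (y - x) * m + E)%C by (unfold E; ring).
    eapply Rle_trans; [apply Cmod_triangle|]. rewrite Cmod_mult, Cmod_R. fold h. nra. }
  assert (Gy : Cmod (g y) <= G).
  { replace (g y) with (g x + (g y - g x))%C by ring.
    eapply Rle_trans; [apply Cmod_triangle|]. unfold G. nra. }
  replace (f y * g y - f x * g x - RtoC (y - x) * (l * g x + f x * m))%C with
    (F * g y + f x * E + RtoC (y - x) * l * (g y - g x))%C by (unfold F, E; ring).
  eapply Rle_trans; [eapply Rle_trans; [apply Cmod_triangle|apply Rplus_le_compat_r, Cmod_triangle]|].
  rewrite !Cmod_mult, Cmod_R. fold h.
  assert (B1 : Cmod F * Cmod (g y) <= (e1 * h) * G)
    by (apply Rmult_le_compat; auto using Cmod_ge_0).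
  assert (B2 : Cmod (f x) * Cmod E <= Cmod (f x) * (e1 * h)) by (apply Rmult_le_compat_l; auto; nra).
  assert (B3 : h * Cmod l * Cmod (g y - g x) <= h * Cmod l * ((Cmod m + 1) * d3)).
  { apply Rmult_le_compat_l; [now apply Rmult_le_pos|]. nra. }
  assert (E1 : e1 * (G + Cmod (f x)) = e / 2) by (unfold e1; field; lra).
  assert (E3 : d3 * (Cmod l * (Cmod m + 1) + 1) = e / 2) by (unfold d3; field; nra).
  assert (Cmod l * (Cmod m + 1) * d3 <= e / 2) by nra.
  nra.
Qed.

Lemma Cderiv_linear c x : Cderiv (fun y => RtoC y * c)%C x c.
Proof.
  intros e He. exists 1. split; [lra|]. intros y _.
  replace (RtoC y * c - RtoC x * c - RtoC (y - x) * c)%C with (RtoC 0) by (rewrite RtoC_minus; ring).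
  rewrite Cmod_0. apply Rmult_le_pos; [lra|apply Rabs_pos].
Qed.

Lemma Cderiv_parts (f1 f2 : R -> R) x l1 l2 :
  is_derive f1 x l1 -> is_derive f2 x l2 -> Cderiv (fun y => (f1 y, f2 y)) x (l1, l2).
Proof.
  assert (P : forall f l, is_derive f x l -> forall e, 0 < e -> exists d, 0 < d /\
    forall y, Rabs (y - x) < d -> Rabs (f y - f x - (y - x) * l) <= e * Rabs (y - x)).
  { intros f l [_ H] e He. destruct (H x (fun P HP => HP) (mkposreal e He)) as [d Hd].
    exists d. split; [apply cond_pos|]. exact Hd. }
  intros H1 H2 e He.
  destruct (P _ _ H1 (e / 2)) as (d1 & P1 & K1); [lra|].
  destruct (P _ _ H2 (e / 2)) as (d2 & P2 & K2); [lra|].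
  exists (Rmin d1 d2). split; [now apply Rmin_pos|]. intros y Hy.
  pose proof (Rmin_l d1 d2). pose proof (Rmin_r d1 d2).
  specialize (K1 y ltac:(lra)). specialize (K2 y ltac:(lra)).
  eapply Rle_trans; [apply Cmod_le_abs|].
  unfold Cminus, Cplus, Copp, Cmult, RtoC; simpl.
  replace (f1 y + - f1 x + - ((y - x) * l1 - 0 * l2)) with (f1 y - f1 x - (y - x) * l1) by ring.
  replace (f2 y + - f2 x + - ((y - x) * l2 + 0 * l1)) with (f2 y - f2 x - (y - x) * l2) by ring.
  lra.
Qed.

Lemma Cderiv_zero_const f : (forall x, Cderiv f x (RtoC 0)) -> forall x y, f x = f y.
Proof.
  intros H.
  assert (L : forall x y, x < y -> f x = f y).
  { intros x y Hxy. apply (eq_is_derive (V := C_R_NormedModule) f x y); auto.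
    intros t _. apply is_derive_Cderiv, H. }
  intros x y. destruct (Rtotal_order x y) as [?|[->|?]]; auto. symmetry; auto.
Qed.

(** Outside a finite set the remainders are controlled uniformly in [y] by the Lipschitz bound [g];
    on the finite set ordinary differentiability suffices. *)
Lemma Cderiv_CS {A : Type} (F : A -> R -> C) (F' : A -> C) (g : A -> R) M x :
  (forall a, Cderiv (F a) x (F' a)) ->
  (forall a y, Cmod (F a y - F a x) <= g a * Rabs (y - x)) ->
  (forall a, Cmod (F' a) <= g a) -> bdd g M ->
  (forall y, summable (fun a => F a y)) ->
  Cderiv (fun y => CS (fun a => F a y)) x (CS F').
Proof.
  intros Hd Hl Hb Hg Hs e He.
  assert (Hg0 : forall a, 0 <= g a) by (intros a; eapply Rle_trans; [apply Cmod_ge_0|apply Hb]).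
  assert (HsF' : summable F') by (exists M; eapply bdd_le; [apply Hb|apply Rle_refl|apply Hg]).
  (* Each remainder is at most [2 * Rabs (y - x) * g a], so a tail of [e / 4] costs [e / 2]. *)
  destruct (bdd_tail g M Hg0 Hg (e / 4)) as (l0 & N0 & T0); [lra|].
  set (Rm := fun a y => (F a y - F a x - RtoC (y - x) * F' a)%C).
  assert (HR : forall a y, Cmod (Rm a y) <= 2 * Rabs (y - x) * g a).
  { intros a y. unfold Rm. eapply Rle_trans; [apply Cmod_minus_le|].
    rewrite Cmod_mult, Cmod_R. specialize (Hl a y). specialize (Hb a).
    pose proof (Rabs_pos (y - x)). nra. }
  assert (Hfin : forall l e, 0 < e -> exists d, 0 < d /\ forall y, Rabs (y - x) < d ->
     rsum (fun a => Cmod (Rm a y)) l <= e * Rabs (y - x)).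
  { induction l as [|a l IH]; intros e' He'; simpl.
    - exists 1. split; [lra|]. intros y _. apply Rmult_le_pos; [lra|apply Rabs_pos].
    - destruct (IH (e' / 2)) as (d1 & P1 & K1); [lra|].
      destruct (Hd a (e' / 2)) as (d2 & P2 & K2); [lra|].
      exists (Rmin d1 d2). split; [now apply Rmin_pos|]. intros y Hy.
      pose proof (Rmin_l d1 d2). pose proof (Rmin_r d1 d2).
      specialize (K1 y ltac:(lra)). specialize (K2 y ltac:(lra)). fold (Rm a y) in K2. lra. }
  destruct (Hfin l0 (e / 2)) as (d & Hd0 & K); [lra|].
  exists d. split; auto. intros y Hy.
  replace (CS (fun a => F a y) - CS (fun a => F a x) - RtoC (y - x) * CS F')%C
    with (CS (fun a => Rm a y)).
  2: { rewrite (CS_ext (fun a => Rm a y) (fun a => F a y + ((-1) * F a x + (- RtoC (y - x)) * F' a))%C)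
         by (intros a; unfold Rm; ring).
       rewrite CS_plus, CS_plus, !CS_scal; auto using summable_plus, summable_scal. ring. }
  apply CS_norm. intros l Hl'.
  pose (q := fun a => if in_dec classic_dec a l0 then true else false).
  assert (Esplit : forall l, rsum (fun a => Cmod (Rm a y)) l =
     rsum (fun a => Cmod (Rm a y)) (filter q l) + rsum (fun a => Cmod (Rm a y)) (filter (fun a => negb (q a)) l)).
  { clear. induction l as [|a l IH]; simpl; [ring|]. rewrite IH. destruct (q a); simpl; ring. }
  rewrite Esplit.
  assert (B1 : rsum (fun a => Cmod (Rm a y)) (filter q l) <= e / 2 * Rabs (y - x)).
  { eapply Rle_trans; [|apply (K y Hy)]. apply rsum_incl; auto using NoDup_filter.
    - intros a; apply Cmod_ge_0.
    - intros a Ha. apply filter_In in Ha. destruct Ha as [_ Ha]. unfold q in Ha.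
      now destruct (in_dec classic_dec a l0). }
  assert (B2 : rsum (fun a => Cmod (Rm a y)) (filter (fun a => negb (q a)) l) <= 2 * Rabs (y - x) * (e / 4)).
  { eapply Rle_trans; [apply (rsum_le _ (fun a => 2 * Rabs (y - x) * g a)); intros a _; apply HR|].
    rewrite rsum_scal. apply Rmult_le_compat_l; [pose proof (Rabs_pos (y - x)); lra|].
    apply T0; [now apply NoDup_filter|].
    intros a Ha. apply filter_In in Ha. destruct Ha as [_ Ha]. unfold q in Ha.
    now destruct (in_dec classic_dec a l0). }
  lra.
Qed.

(** * Termwise differentiation and identification of Fourier coefficients *)

Definition fs (u : Z -> C) (x : R) : C := CS (fun m => cis (IZR m * x / 2) * u m)%C.

(** The multiplier i m / 2 of d/dx. *)
Definition dmul (m : Z) : C := (0, IZR m / 2).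

Lemma Cmod_dmul m : Cmod (dmul m) = Rabs (IZR m) / 2.
Proof.
  unfold Cmod, dmul; simpl. replace (0 * (0 * 1) + IZR m / 2 * (IZR m / 2 * 1)) with (Rsqr (IZR m / 2))
    by (unfold Rsqr; ring).
  rewrite sqrt_Rsqr_abs. unfold Rdiv. rewrite Rabs_mult, (Rabs_pos_eq (/ 2)); lra.
Qed.

Lemma fs_summable u x : summable u -> summable (fun m => cis (IZR m * x / 2) * u m)%C.
Proof. intros H. eapply summable_le; [apply H|]. intros m. cbv beta. rewrite Cmod_mult, Cmod_cis. lra. Qed.

Lemma fs_plus u v x : summable u -> summable v -> fs (fun m => u m + v m)%C x = (fs u x + fs v x)%C.
Proof.
  intros H1 H2. unfold fs. rewrite <- CS_plus by now apply fs_summable.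
  apply CS_ext. intros m. ring.
Qed.

Lemma fs_scal c u x : summable u -> fs (fun m => c * u m)%C x = (c * fs u x)%C.
Proof.
  intros H1. unfold fs. rewrite <- CS_scal by now apply fs_summable.
  apply CS_ext. intros m. ring.
Qed.

Lemma fs_le u M x : bdd (fun m => Cmod (u m)) M -> Cmod (fs u x) <= M.
Proof.
  intros H. apply CS_norm. eapply bdd_le; [|apply Rle_refl|apply H].
  intros m. cbv beta. rewrite Cmod_mult, Cmod_cis. lra.
Qed.

Lemma fs_periodic u x : fs u (x + 4 * PI) = fs u x.
Proof.
  apply CS_ext. intros m. f_equal.
  replace (IZR m * (x + 4 * PI) / 2) with (IZR m * x / 2 + IZR m * (4 * PI) / 2) by field.
  rewrite cis_plus, cis_2PI. ring.
Qed.

Lemma Cderiv_cis m x :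
  Cderiv (fun y => cis (IZR m * y / 2)) x (dmul m * cis (IZR m * x / 2))%C.
Proof.
  replace (dmul m * cis (IZR m * x / 2))%C with
    ((- (IZR m / 2 * sin (IZR m * x / 2)))%R, (IZR m / 2 * cos (IZR m * x / 2))%R)
    by (unfold dmul, cis, Cmult; simpl; f_equal; ring).
  apply Cderiv_parts; auto_derive; auto; unfold Rdiv; ring.
Qed.

Lemma cis_mode_lip m x y :
  Cmod (cis (IZR m * y / 2) - cis (IZR m * x / 2)) <= Rabs (IZR m) * Rabs (y - x).
Proof.
  eapply Rle_trans; [apply cis_lip|].
  replace (IZR m * y / 2 - IZR m * x / 2) with (IZR m * (y - x) * / 2) by field.
  rewrite !Rabs_mult, (Rabs_pos_eq (/ 2)); lra.
Qed.

Lemma Cderiv_const_mult f x l c : Cderiv f x l -> Cderiv (fun y => f y * c)%C x (l * c)%C.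
Proof.
  intros H. replace (l * c)%C with (l * c + f x * 0)%C by ring.
  apply (Cderiv_mult f (fun _ => c)); auto.
  intros e He. exists 1. split; [lra|]. intros y _.
  replace (c - c - RtoC (y - x) * 0)%C with (RtoC 0) by ring.
  rewrite Cmod_0. apply Rmult_le_pos; [lra|apply Rabs_pos].
Qed.

Lemma fs_deriv u x :
  summable u -> summable (fun m => dmul m * u m)%C ->
  Cderiv (fs u) x (fs (fun m => dmul m * u m)%C x).
Proof.
  intros H1 [M H2]. unfold fs.
  apply (Cderiv_CS (fun m y => cis (IZR m * y / 2) * u m)%C _
    (fun m => 2 * Cmod (dmul m * u m)) (2 * M)).
  - intros m. replace (cis (IZR m * x / 2) * (dmul m * u m))%C with
      (dmul m * cis (IZR m * x / 2) * u m)%C by ring.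
    apply Cderiv_const_mult, Cderiv_cis.
  - intros m y. replace (cis (IZR m * y / 2) * u m - cis (IZR m * x / 2) * u m)%C with
      ((cis (IZR m * y / 2) - cis (IZR m * x / 2)) * u m)%C by ring.
    rewrite !Cmod_mult, Cmod_dmul. pose proof (cis_mode_lip m x y). pose proof (Cmod_ge_0 (u m)). nra.
  - intros m. rewrite Cmod_mult, Cmod_cis. pose proof (Cmod_ge_0 (dmul m * u m)). lra.
  - apply bdd_scal; auto; lra.
  - intros y. now apply fs_summable.
Qed.

(** Orthogonality of the exponentials without integrals: the termwise primitive of [fs c] is [c 0]
    times y plus a series of period 4 pi, and it differs from [H] by a constant. Over one period the
    increments are [4 * PI * c 0] and 0. *)
Lemma mean_zero c (H : R -> C) :
  summable c -> (forall x, Cderiv H x (fs c x)) -> H (4 * PI) = H 0 -> c 0%Z = RtoC 0.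
Proof.
  intros [M Hc] HH Hper.
  (* Off mode 0 integration divides by [dmul m], of modulus at least 1/2, so the primitive stays
     absolutely convergent. *)
  set (F := fun m y => if Z.eq_dec m 0 then (RtoC y * c m)%C else (cis (IZR m * y / 2) * (/ dmul m * c m))%C).
  assert (Hd : forall m, m <> 0%Z -> dmul m <> RtoC 0 /\ 1 / 2 <= Cmod (dmul m)).
  { intros m Hm. assert (1 <= Rabs (IZR m)) by (rewrite <- abs_IZR; apply IZR_le; lia).
    split; [|rewrite Cmod_dmul; lra]. intros E. assert (Cmod (dmul m) = 0) by (rewrite E; apply Cmod_0).
    rewrite Cmod_dmul in H1. lra. }
  assert (Hs : forall y, summable (fun m => F m y)).
  { intros y. exists ((2 + Rabs y) * M).
    eapply bdd_le; [|apply Rle_refl|apply (bdd_scal (2 + Rabs y)); [pose proof (Rabs_pos y); lra|apply Hc]].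
    intros m. unfold F. pose proof (Rabs_pos y). pose proof (Cmod_ge_0 (c m)).
    destruct (Z.eq_dec m 0) as [E|E].
    - rewrite Cmod_mult, Cmod_R. nra.
    - destruct (Hd m E) as [D1 D2]. rewrite !Cmod_mult, Cmod_cis, Cmod_inv by auto.
      assert (/ Cmod (dmul m) <= 2) by (replace 2 with (/ (1 / 2)) by field; apply Rinv_le_contravar; lra).
      nra. }
  assert (HP : forall x, Cderiv (fun y => CS (fun m => F m y)) x (fs c x)).
  { intros x. apply (Cderiv_CS F _ (fun m => 2 * Cmod (c m)) (2 * M)); auto.
    - intros m. unfold F. destruct (Z.eq_dec m 0) as [E|E].
      + subst m. replace (0 * x / 2) with 0 by field. rewrite cis_0, Cmult_1_l. apply Cderiv_linear.
      + destruct (Hd m E) as [D1 _].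
        replace (cis (IZR m * x / 2) * c m)%C with (dmul m * cis (IZR m * x / 2) * (/ dmul m * c m))%C
          by (field; auto).
        apply Cderiv_const_mult, Cderiv_cis.
    - intros m y. unfold F. pose proof (Cmod_ge_0 (c m)). pose proof (Rabs_pos (y - x)).
      destruct (Z.eq_dec m 0) as [E|E].
      + replace (RtoC y * c m - RtoC x * c m)%C with (RtoC (y - x) * c m)%C by (rewrite RtoC_minus; ring).
        rewrite Cmod_mult, Cmod_R. nra.
      + destruct (Hd m E) as [D1 D2].
        replace (cis (IZR m * y / 2) * (/ dmul m * c m) - cis (IZR m * x / 2) * (/ dmul m * c m))%C
          with ((cis (IZR m * y / 2) - cis (IZR m * x / 2)) * (/ dmul m * c m))%C by ring.
        rewrite !Cmod_mult, Cmod_inv, Cmod_dmul by auto. rewrite Cmod_dmul in D2.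
        pose proof (cis_mode_lip m x y).
        apply Rle_trans with (Rabs (IZR m) * Rabs (y - x) * (/ (Rabs (IZR m) / 2) * Cmod (c m))).
        * apply Rmult_le_compat_r; auto. apply Rmult_le_pos; auto. apply Rlt_le, Rinv_0_lt_compat. lra.
        * right. field. lra.
    - intros m. rewrite Cmod_mult, Cmod_cis. pose proof (Cmod_ge_0 (c m)). lra.
    - apply bdd_scal; auto; lra. }
  pose proof (Cderiv_zero_const (fun y => H y - CS (fun m => F m y))%C) as HQ.
  specialize (HQ ltac:(intros x; replace (RtoC 0) with (fs c x - fs c x)%C by ring; now apply Cderiv_minus) (4 * PI) 0).
  cbv beta in HQ. rewrite Hper in HQ.
  assert (E : CS (fun m => F m (4 * PI)%R + (-1) * F m 0)%C = RtoC 0).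
  { rewrite CS_plus, CS_scal by auto using summable_scal.
    replace (CS (fun m : Z => F m (4 * PI)%R)) with (H 0 - (H 0 - CS (fun m : Z => F m (4 * PI)%R)))%C by ring.
    rewrite HQ. ring. }
  rewrite (CS_finite _ (0%Z :: nil)) in E.
  - simpl in E. unfold F in E. destruct (Z.eq_dec 0 0) as [_|E0]; [|easy].
    replace (RtoC (4 * PI) * c 0%Z + -1 * (0 * c 0%Z) + 0)%C with (RtoC (4 * PI) * c 0%Z)%C in E by ring.
    apply Cmod_eq_0. assert (Ep : Cmod (RtoC (4 * PI) * c 0%Z) = 0) by (rewrite E; apply Cmod_0).
    rewrite Cmod_mult, Cmod_R in Ep. pose proof PI_RGT_0. rewrite Rabs_pos_eq in Ep by lra.
    apply Rmult_integral in Ep. destruct Ep; lra.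
  - repeat constructor. easy.
  - intros m Hm. unfold F. destruct (Z.eq_dec m 0) as [E0|E0]; [subst; destruct Hm; now left|].
    rewrite cis_2PI. replace (IZR m * 0 / 2) with 0 by field. rewrite cis_0. ring.
Qed.

Lemma fs_shift c k x : summable c ->
  fs (fun m => c (m + k)%Z) x = (cis (IZR (- k) * x / 2) * fs c x)%C.
Proof.
  intros H. unfold fs. rewrite <- CS_scal by now apply fs_summable. symmetry.
  rewrite <- (CS_bij (fun m => (m + k)%Z) (fun m => (m - k)%Z)) by (intros; lia).
  apply CS_ext. intros m. rewrite Cmult_assoc, <- cis_plus. do 2 f_equal.
  rewrite plus_IZR, opp_IZR. field.
Qed.

Lemma summable_shift (c : Z -> C) k : summable c -> summable (fun m => c (m + k)%Z).
Proof. apply (summable_reindex (fun m => (m + k)%Z)). intros; lia. Qed.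

(** Multiplication by an exponential moves coefficient k to mode 0, where [mean_zero] applies with a
    constant primitive. *)
Lemma fs_unique c : summable c -> (forall x, fs c x = RtoC 0) -> forall k, c k = RtoC 0.
Proof.
  intros Hs H k. change (c k) with ((fun m => c (m + k)%Z) 0%Z).
  apply (mean_zero _ (fun _ => RtoC 0)); auto using summable_shift.
  intros x. rewrite fs_shift, H by auto. rewrite Cmult_0_r.
  intros e He. exists 1. split; [lra|]. intros y _.
  replace (0 - 0 - RtoC (y - x) * 0)%C with (RtoC 0) by ring.
  rewrite Cmod_0. apply Rmult_le_pos; [lra|apply Rabs_pos].
Qed.

(** Green's identity: with e the exponential of mode -k, the derivative of U' e - U e' is U'' e - U
    e''. The latter is an absolutely convergent Fourier series with [phi k - dmul k * dmul k * u k]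
    at mode 0, and the former bracket is 4 pi-periodic. No decay of [u] beyond summability
    enters. *)
Lemma coefficient_equation (U U1 U2 : R -> C) u phi :
  summable u -> summable phi ->
  (forall x, U x = fs u x) -> (forall x, U2 x = fs phi x) ->
  (forall x, Cderiv U x (U1 x)) -> (forall x, Cderiv U1 x (U2 x)) ->
  forall k, phi k = (dmul k * dmul k * u k)%C.
Proof.
  intros Su Sp HU HU2 D1 D2 k.
  set (c := fun m => (phi m + (- (dmul k * dmul k)) * u m)%C).
  assert (Sc : summable c) by (apply summable_plus; auto; now apply summable_scal).
  assert (P0 : U (4 * PI) = U 0) by (rewrite !HU, <- (fs_periodic u 0); f_equal; ring).
  (* [U1] is not yet known as a series; its periodicity comes from that of [U] and uniqueness of
     derivatives. *)
  assert (P1 : U1 (4 * PI) = U1 0).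
  { apply (Cderiv_unique U 0); auto. intros e He. destruct (D1 (4 * PI) e He) as (d & Hd & K).
    exists d. split; auto. intros y Hy. specialize (K (y + 4 * PI)).
    replace (y + 4 * PI - 4 * PI) with (y - 0) in K by ring.
    specialize (K Hy). rewrite P0 in K. rewrite (HU (y + 4 * PI)), fs_periodic, <- HU in K. auto. }
  assert (Z0 : c k = RtoC 0).
  { change (c k) with ((fun m => c (m + k)%Z) 0%Z).
    apply (mean_zero _ (fun x => U1 x * cis (IZR (- k) * x / 2) - U x * (dmul (- k) * cis (IZR (- k) * x / 2)))%C).
    - now apply summable_shift.
    - intros x. rewrite fs_shift by auto.
      unfold c. rewrite fs_plus, fs_scal, <- HU, <- HU2 by (auto; now apply summable_scal).
      replace (cis (IZR (- k) * x / 2) * (U2 x + - (dmul k * dmul k) * U x))%C with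
        ((U2 x * cis (IZR (- k) * x / 2) + U1 x * (dmul (- k) * cis (IZR (- k) * x / 2))) -
         (U1 x * (dmul (- k) * cis (IZR (- k) * x / 2)) +
          U x * (dmul (- k) * cis (IZR (- k) * x / 2) * dmul (- k))))%C.
      + pose proof (Cderiv_cis (- k) x) as Dc.
        apply Cderiv_minus.
        * apply (Cderiv_mult U1 (fun y => cis (IZR (- k) * y / 2))); auto.
        * apply (Cderiv_mult U (fun y => dmul (- k) * cis (IZR (- k) * y / 2))%C); auto.
          replace (fun y => dmul (- k) * cis (IZR (- k) * y / 2))%C
            with (fun y => cis (IZR (- k) * y / 2) * dmul (- k))%C
            by (apply functional_extensionality; intros; ring).
          now apply (Cderiv_const_mult (fun y => cis (IZR (- k) * y / 2))).
      + replace (dmul (- k)) with (- dmul k)%C; [ring|].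
        unfold dmul, Copp; simpl. rewrite opp_IZR. f_equal; field.
    - rewrite P0, P1, cis_2PI. replace (IZR (- k) * 0 / 2) with 0 by field. now rewrite cis_0. }
  unfold c in Z0. replace (phi k) with ((phi k + - (dmul k * dmul k) * u k) + dmul k * dmul k * u k)%C by ring.
  rewrite Z0. ring.
Qed.

Lemma conv_point (F H : point -> C) : conv F H tt = (F tt * H tt)%C.
Proof.
  unfold conv, push. rewrite (CS_finite _ ((tt, tt) :: nil)).
  - simpl. rewrite onlyif_true by easy. ring.
  - repeat constructor. easy.
  - intros [[] []] Hn. destruct Hn. now left.
Qed.

Lemma fs_nlin Om sg w u x Mw M :
  bnd (wt 0) w Mw -> bnd (wt 0) u M ->
  fs (nlin (G := modes) Om sg w u) x =
  (- (Om * fs u x) - fs u x * fs w x + sg * (fs u x * RtoC ((Cmod (fs u x)) ^ 2)))%C.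
Proof.
  intros Hw Hu.
  assert (E : forall f, fs f x = eval (G := modes) (H := point) (fun _ => tt) (fun m => cis (IZR m * x / 2)) f tt).
  { intros f. unfold fs, eval, push. apply CS_ext. intros m. now rewrite onlyif_true. }
  rewrite !E.
  assert (Htau : is_weight (G := point) (fun _ => 1)) by (constructor; intros; lra).
  rewrite (eval_nlin (G := modes) (H := point) (fun _ => tt) (fun m => cis (IZR m * x / 2)) (wt 0) (fun _ => 1)
     (wt_weight 0) Htau) with (Mw := Mw) (M := M); auto.
  - unfold nlin. rewrite !conv_point. unfold dag. rewrite Cmod2_conj. simpl. ring.
  - intros a b. simpl. rewrite <- cis_plus. f_equal. rewrite plus_IZR. field.
  - intros a. simpl. rewrite <- cis_opp. f_equal. rewrite opp_IZR. field.
  - intros a. rewrite Cmod_cis. unfold wt. simpl. lra.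
Qed.

(** * Weighted l^2 and l^1 spaces *)

Definition Zrange (N : nat) : list Z :=
  map (fun k => (Z.of_nat k - Z.of_nat N)%Z) (seq 0 (S (2 * N))).

Lemma in_Zrange N m : In m (Zrange N) <-> (Z.abs m <= Z.of_nat N)%Z.
Proof.
  unfold Zrange. rewrite in_map_iff. split.
  - intros (k & <- & Hk). apply in_seq in Hk. lia.
  - intros H. exists (Z.to_nat (m + Z.of_nat N)). split; [lia|]. apply in_seq. lia.
Qed.

Lemma NoDup_Zrange N : NoDup (Zrange N).
Proof. apply NoDup_map_inj; [intros; lia|apply seq_NoDup]. Qed.

Lemma Zrange_cover (l : list Z) : exists N0, forall N, (N0 <= N)%nat -> incl l (Zrange N).
Proof.
  induction l as [|m l [N0 IH]].
  - exists O. intros N _ x [].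
  - exists (max N0 (Z.to_nat (Z.abs m))). intros N HN x [<-|Hx].
    + apply in_Zrange. lia. + apply IH; auto; lia.
Qed.

Lemma sum_n_csum (f : nat -> C) N :
  sum_n (G := C_R_NormedModule) f N = csum f (seq 0 (S N)).
Proof.
  induction N as [|N IH].
  - rewrite sum_O. simpl. now rewrite Cplus_0_r.
  - rewrite sum_Sn, IH, (seq_S (S N)), csum_app. simpl csum at 3.
    rewrite Cplus_0_r. reflexivity.
Qed.

Lemma Zpartial_csum (f : Z -> C) N : Zpartial (G := C_R_NormedModule) f N = csum f (Zrange N).
Proof. unfold Zpartial, Zrange. now rewrite sum_n_csum, csum_map. Qed.

Lemma Zpartial_rsum (g : Z -> R) N : Zpartial g N = rsum g (Zrange N).
Proof.
  unfold Zpartial, Zrange. rewrite rsum_map.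
  generalize (2 * N)%nat. intros K. induction K as [|K IH].
  - rewrite sum_O. simpl. now rewrite Rplus_0_r.
  - rewrite sum_Sn, IH, (seq_S (S K)), rsum_app. simpl rsum at 3. now rewrite Rplus_0_r.
Qed.

Lemma filterlim_Cmod (f : nat -> C) l :
  (forall e, 0 < e -> exists N0, forall N, (N0 <= N)%nat -> Cmod (f N - l) < e) ->
  filterlim f eventually (locally (T := C_R_NormedModule) l).
Proof.
  intros H. apply (filterlim_locally (U := C_R_NormedModule)). intros e.
  destruct (H e (cond_pos e)) as [N0 HN]. exists N0. intros N HN0.
  specialize (HN N HN0). split.
  - eapply Rle_lt_trans; [apply (Cmod_fst (f N - l))|exact HN].
  - eapply Rle_lt_trans; [apply (Cmod_snd (f N - l))|exact HN].
Qed.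

Lemma is_Zsum_CS (f : Z -> C) : summable f -> is_Zsum (V := C_R_NormedModule) f (CS f).
Proof.
  intros H. unfold is_Zsum. apply filterlim_Cmod. intros e He.
  destruct (CS_spec f H e He) as [l0 Hl0]. destruct (Zrange_cover l0) as [N0 HN0].
  exists N0. intros N HN. rewrite Zpartial_csum. apply Hl0; auto using NoDup_Zrange.
Qed.

Lemma is_Zsum_unique (f : Z -> C) l :
  summable f -> is_Zsum (V := C_R_NormedModule) f l -> l = CS f.
Proof.
  intros H Hl. apply (filterlim_locally_unique (V := C_R_NormedModule) (Zpartial f) l (CS f) Hl).
  now apply is_Zsum_CS.
Qed.

Lemma Zpartial_bdd (g : Z -> R) :
  (forall m, 0 <= g m) -> ex_finite_lim_seq (Zpartial g) ->
  bdd g (real (Lim_seq (Zpartial g))).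
Proof.
  intros Hg Hl l Hnd. destruct (Zrange_cover l) as [N0 HN0].
  eapply Rle_trans; [apply (rsum_incl g l (Zrange N0)); auto using NoDup_Zrange|].
  rewrite <- Zpartial_rsum.
  apply Lim_seq_correct' in Hl.
  apply (is_lim_seq_incr_compare _ _ Hl).
  intros N. rewrite !Zpartial_rsum. apply rsum_incl; auto using NoDup_Zrange.
  intros m. rewrite !in_Zrange. lia.
Qed.

Lemma bdd_Zpartial (g : Z -> R) M :
  (forall m, 0 <= g m) -> bdd g M ->
  ex_finite_lim_seq (Zpartial g) /\ real (Lim_seq (Zpartial g)) <= M.
Proof.
  intros Hg Hb.
  assert (Hex : ex_finite_lim_seq (Zpartial g)).
  { apply (ex_finite_lim_seq_incr _ M).
    - intros N. rewrite !Zpartial_rsum. apply rsum_incl; auto using NoDup_Zrange.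
      intros m. rewrite !in_Zrange. lia.
    - intros N. rewrite Zpartial_rsum. apply Hb, NoDup_Zrange. }
  split; auto. apply Lim_seq_correct' in Hex.
  apply (is_lim_seq_le (Zpartial g) (fun _ => M) (real (Lim_seq (Zpartial g))) M); auto.
  - intros N. rewrite Zpartial_rsum. apply Hb, NoDup_Zrange.
  - apply is_lim_seq_const.
Qed.

(** The discrete form of integral comparison: [exp t >= 1 + t] at [t = p * (ln (x + 1) - ln x)],
    together with [/ (x + 1) <= ln (x + 1) - ln x]. *)
Lemma Rpower_telescope p x : 0 < p -> 0 < x ->
  p * Rpower (x + 1) (- p - 1) <= Rpower x (- p) - Rpower (x + 1) (- p).
Proof.
  intros Hp Hx. set (y := x + 1).
  assert (Hy : 0 < y) by (unfold y; lra).
  assert (Hln : / y <= ln y - ln x).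
  { assert (H : 1 + ln (x / y) <= x / y).
    { eapply Rle_trans; [apply exp_ineq1_le|]. rewrite exp_ln; [lra|]. now apply Rdiv_lt_0_compat. }
    rewrite ln_div in H by auto. replace (x / y) with (1 - / y) in H by (unfold y; field; lra). lra. }
  assert (E1 : Rpower x (- p) = Rpower y (- p) * exp (p * (ln y - ln x))).
  { unfold Rpower. rewrite <- exp_plus. f_equal. ring. }
  assert (E2 : Rpower y (- p - 1) = Rpower y (- p) * / y).
  { unfold Rminus. rewrite Rpower_plus, Rpower_Ropp, Rpower_Ropp, Rpower_1; auto. }
  rewrite E1, E2. pose proof (exp_ineq1_le (p * (ln y - ln x))).
  assert (0 < Rpower y (- p)) by apply exp_pos.
  assert (p * / y <= p * (ln y - ln x)) by (apply Rmult_le_compat_l; lra).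
  nra.
Qed.

Lemma Rpower_series_bdd p N : 0 < p ->
  rsum (fun k => Rpower (INR (S k)) (- p - 1)) (seq 0 N) <= 1 + / p.
Proof.
  intros Hp. assert (Hi : 0 < / p) by now apply Rinv_0_lt_compat.
  assert (H : rsum (fun k => Rpower (INR (S k)) (- p - 1)) (seq 0 (S N))
     <= 1 + / p * (1 - Rpower (INR (S N)) (- p))).
  { induction N as [|N IH].
    - assert (E1 : forall z, Rpower 1 z = 1)
        by (intros z; unfold Rpower; rewrite ln_1, Rmult_0_r; apply exp_0).
      simpl. rewrite !E1. lra.
    - rewrite seq_S, rsum_app. change (0 + S N)%nat with (S N).
      change (rsum (fun k => Rpower (INR (S k)) (- p - 1)) (S N :: nil))
        with (Rpower (INR (S (S N))) (- p - 1) + 0).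
      pose proof (Rpower_telescope p (INR (S N)) Hp (lt_0_INR _ (Nat.lt_0_succ N))) as T.
      rewrite <- (S_INR (S N)) in T.
      apply (Rmult_le_compat_l (/ p)) in T; [|lra].
      rewrite <- Rmult_assoc, Rinv_l, Rmult_1_l in T by lra. lra. }
  assert (0 < Rpower (INR (S N)) (- p)) by apply exp_pos.
  eapply Rle_trans; [|eapply Rle_trans; [apply H|nra]].
  apply rsum_incl; auto using seq_NoDup.
  - intros k. apply Rlt_le, exp_pos.
  - intros k Hk. apply in_seq in Hk. apply in_seq. lia.
Qed.

(** Two half-lines cover the integers; 0 is counted twice, which is harmless for a bound. *)
Lemma summable_Z (h : nat -> R) M :
  (forall k, 0 <= h k) -> bdd h M -> exists M', bdd (fun m : Z => h (Z.abs_nat m)) M'.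
Proof.
  intros Hh Hb.
  assert (Hc : summable (fun k => RtoC (h k))).
  { exists M. eapply bdd_le; [|apply Rle_refl|apply Hb].
    intros k. rewrite Cmod_R, Rabs_pos_eq; auto; lra. }
  destruct (CS_inj Z.of_nat (fun m => if (0 <=? m)%Z then RtoC (h (Z.abs_nat m)) else RtoC 0)) as [S1 _].
  { intros x y E; lia. }
  { intros m Hm. destruct (Z.leb_spec 0 m); auto. destruct (Hm (Z.abs_nat m)). lia. }
  { eapply summable_le; [apply Hc|]. intros k.
    destruct (Z.leb_spec 0 (Z.of_nat k)); [|lia]. replace (Z.abs_nat (Z.of_nat k)) with k by lia. lra. }
  destruct (CS_inj (fun k => (- Z.of_nat k)%Z) (fun m => if (m <=? 0)%Z then RtoC (h (Z.abs_nat m)) else RtoC 0)) as [S2 _].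
  { intros x y E; lia. }
  { intros m Hm. destruct (Z.leb_spec m 0); auto. destruct (Hm (Z.abs_nat m)). lia. }
  { eapply summable_le; [apply Hc|]. intros k.
    destruct (Z.leb_spec (- Z.of_nat k) 0); [|lia]. replace (Z.abs_nat (- Z.of_nat k)) with k by lia. lra. }
  destruct S1 as [M1 B1]. destruct S2 as [M2 B2]. exists (M1 + M2).
  eapply bdd_le; [|apply Rle_refl|apply (bdd_plus _ _ _ _ B1 B2)].
  intros m. cbv beta. specialize (Hh (Z.abs_nat m)).
  destruct (Z.leb_spec 0 m), (Z.leb_spec m 0); try lia;
    rewrite ?Cmod_R, ?Cmod_0, ?Rabs_R0, ?Rabs_pos_eq; auto; lra.
Qed.

Lemma Rpower_modes_bdd s : 1 / 2 < s ->
  exists H, bdd (fun m : Z => Rpower (1 + (IZR m) ^ 2 / 4) (- s)) H.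
Proof.
  (* Then [- p - 1] is [- 2 * s], and the comparison with the powers of [1 + |m|] rests on
     [(1 + x) ^ 2 <= 8 * (1 + x ^ 2 / 4)]. *)
  intros Hs. set (p := 2 * s - 1). assert (Hp : 0 < p) by (unfold p; lra).
  assert (H0 : bdd (fun k => Rpower (INR (S k)) (- p - 1)) (1 + / p)).
  { intros l Hl. eapply Rle_trans; [|apply (Rpower_series_bdd p (S (list_max l)) Hp)].
    apply rsum_incl; auto using seq_NoDup.
    - intros k. apply Rlt_le, exp_pos.
    - intros k Hk. apply in_seq. pose proof (proj1 (list_max_le l _) (Nat.le_refl _)) as Hm.
      rewrite Forall_forall in Hm. specialize (Hm k Hk). lia. }
  destruct (summable_Z (fun k => Rpower (INR (S k)) (- p - 1)) _ (fun k => Rlt_le _ _ (exp_pos _)) H0) as [M HM].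
  exists (Rpower 8 s * M).
  eapply bdd_le; [|apply Rle_refl|apply (bdd_scal (Rpower 8 s) _ _ (Rlt_le _ _ (exp_pos _)) HM)].
  intros m. cbv beta. rewrite S_INR, INR_IZR_INZ, Zabs2Nat.id_abs, abs_IZR.
  set (x := Rabs (IZR m)). assert (Hx : 0 <= x) by apply Rabs_pos.
  rewrite <- (pow2_abs (IZR m)). fold x.
  replace (- p - 1) with (- (s + s)) by (unfold p; ring).
  rewrite !Rpower_Ropp, Rpower_plus, Rpower_mult_distr by lra.
  set (a := Rpower (1 + x ^ 2 / 4) s). set (c := Rpower ((x + 1) * (x + 1)) s).
  assert (Ha : 0 < a) by apply exp_pos. assert (Hc : 0 < c) by apply exp_pos.
  assert (H : c <= Rpower 8 s * a).
  { unfold a, c. rewrite Rpower_mult_distr by nra. apply Rle_Rpower_l; [lra|]. split; nra. }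
  apply Rmult_le_reg_l with (a * c); [now apply Rmult_lt_0_compat|].
  replace (a * c * / a) with c by (field; lra).
  replace (a * c * (Rpower 8 s * / c)) with (Rpower 8 s * a) by (field; lra). exact H.
Qed.

Lemma l2s_term_ge0 s u m : 0 <= l2s_term s u m.
Proof. apply Rmult_le_pos; [apply Rlt_le, exp_pos|apply pow2_ge_0]. Qed.

(** Young's inequality in each term, [2 * z <= / y + y * z ^ 2] with [y] the Sobolev weight, does
    the work of Cauchy-Schwarz. *)
Lemma l2s_l1 s u Q H :
  bdd (fun m : Z => Rpower (1 + (IZR m) ^ 2 / 4) (- s)) H -> bdd (l2s_term s u) Q ->
  bdd (fun m => Cmod (u m)) ((H + Q) / 2).
Proof.
  intros HH HQ. replace ((H + Q) / 2) with (/ 2 * (H + Q)) by field.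
  eapply bdd_le; [|apply Rle_refl|apply (bdd_scal (/ 2)); [lra|apply (bdd_plus _ _ _ _ HH HQ)]].
  intros m. cbv beta. unfold l2s_term. rewrite Rpower_Ropp.
  set (y := Rpower (1 + IZR m ^ 2 / 4) s). assert (Hy : 0 < y) by apply exp_pos.
  set (z := Cmod (u m)).
  assert (E : / y + y * z ^ 2 - 2 * z = / y * (1 - y * z) ^ 2) by (field; lra).
  assert (0 <= / y * (1 - y * z) ^ 2).
  { apply Rmult_le_pos; [apply Rlt_le, Rinv_0_lt_compat, Hy|apply pow2_ge_0]. }
  lra.
Qed.

(** The l^2 sum is at most the largest term times the l^1 sum; the Sobolev weight of order [s] is
    below the square of [wt r]. *)
Lemma l1_l2s s r u M : s <= INR r -> bnd (wt r) u M -> bdd (l2s_term s u) (M ^ 2).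
Proof.
  intros Hs Hb. pose proof (bdd_ge0 _ _ Hb) as HM.
  replace (M ^ 2) with (M * M) by ring.
  eapply bdd_le; [|apply Rle_refl|apply (bdd_scal M _ _ HM Hb)].
  intros m. cbv beta. pose proof (bdd_term _ _ m Hb) as Ht. cbv beta in Ht.
  pose proof (wt_ge_1 r m) as W1. pose proof (Cmod_ge_0 (u m)).
  apply Rle_trans with ((wt r m * Cmod (u m)) * (wt r m * Cmod (u m))).
  - unfold l2s_term. replace (wt r m * Cmod (u m) * (wt r m * Cmod (u m)))
      with ((wt r m * wt r m) * Cmod (u m) ^ 2) by ring.
    apply Rmult_le_compat_r; [apply pow2_ge_0|].
    pose proof (pow2_ge_0 (IZR m)).
    eapply Rle_trans; [apply (Rle_Rpower _ s (INR r)); [lra|auto]|].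
    rewrite Rpower_pow by lra. unfold wt. rewrite <- Rpow_mult_distr.
    apply pow_incr. rewrite <- (pow2_abs (IZR m)) in *. pose proof (Rabs_pos (IZR m)). nra.
  - apply Rmult_le_compat_r; auto. apply Rmult_le_pos; lra.
Qed.

Lemma l2s_remainder_le s n u m : l2s_term s (remainder n u) m <= l2s_term s u m.
Proof.
  unfold l2s_term, remainder. apply Rmult_le_compat_l; [apply Rlt_le, exp_pos|].
  destruct (Z.abs m =? Z.of_nat n)%Z; [|lra]. rewrite Cmod_0. pose proof (pow2_ge_0 (Cmod (u m))). lra.
Qed.

Lemma l2s_norm_bdd s u rho :
  ex_finite_lim_seq (Zpartial (l2s_term s u)) -> l2s_norm s u < rho ->
  bdd (l2s_term s u) (rho ^ 2).
Proof.
  intros Hex Hn. pose proof (Zpartial_bdd _ (l2s_term_ge0 s u) Hex) as Hb.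
  eapply bdd_le; [intros; apply Rle_refl| |apply Hb].
  unfold l2s_norm in Hn. set (L := real (Lim_seq (Zpartial (l2s_term s u)))) in *.
  assert (HL : 0 <= L) by apply (bdd_ge0 _ _ Hb).
  rewrite <- (sqrt_sqrt L HL). pose proof (sqrt_pos L). nra.
Qed.

(** The hypotheses on [w] speak of even indices only. The odd entries, which carry no information
    about [W], are cut off before convolving. *)
Definition even_part (w : Z -> C) (m : Z) : C := if Z.even m then w m else RtoC 0.

Lemma even_part_bnd w r :
  (forall s : R, 1 / 2 < s ->
     ex_finite_lim_seq (Zpartial (fun m : Z => Rpower (1 + (IZR m) ^ 2) s * (Cmod (w (2 * m)%Z)) ^ 2))) ->
  exists Mw, bnd (wt r) (even_part w) Mw.
Proof.
  (* The power beyond [r] pays for the passage from l^2 to l^1 by Young's inequality against the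
     summable inverse weight of exponent 1. *)
  intros Hw. set (s := INR r + 1).
  assert (Hs : 1 / 2 < s) by (unfold s; pose proof (pos_INR r); lra).
  specialize (Hw s Hs). apply Zpartial_bdd in Hw.
  2: { intros m. apply Rmult_le_pos; [apply Rlt_le, exp_pos|apply pow2_ge_0]. }
  set (Q := real _) in Hw.
  destruct (Rpower_modes_bdd 1) as [H HH]; [lra|].
  assert (B : bdd (fun m : Z => wt r (2 * m) * Cmod (w (2 * m)%Z)) (/ 2 * (H + 8 ^ r * Q))).
  { pose proof (bdd_scal (8 ^ r) _ _ (pow_le 8 r ltac:(lra)) Hw) as Hw8.
    eapply bdd_le; [|apply Rle_refl|
      apply (bdd_scal (/ 2) _ _ ltac:(lra) (bdd_plus _ _ _ _ HH Hw8))].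
    intros m. cbv beta. set (c := Cmod (w (2 * m)%Z)). set (x := Rabs (IZR m)).
    assert (Hx : 0 <= x) by apply Rabs_pos.
    assert (Hy : 1 <= 1 + IZR m ^ 2) by (pose proof (pow2_ge_0 (IZR m)); lra).
    assert (E8 : wt r (2 * m) ^ 2 <= 8 ^ r * (1 + IZR m ^ 2) ^ r).
    { unfold wt. replace (((1 + Rabs (IZR (2 * m))) ^ r) ^ 2) with (((1 + Rabs (IZR (2 * m))) ^ 2) ^ r)
        by (rewrite <- !pow_mult; f_equal; lia).
      rewrite <- Rpow_mult_distr. apply pow_incr.
      rewrite mult_IZR, Rabs_mult, (Rabs_pos_eq 2) by lra. rewrite <- (pow2_abs (IZR m)).
      fold x. split; [apply pow2_ge_0|]. nra. }
    assert (Es : Rpower (1 + IZR m ^ 2) s = (1 + IZR m ^ 2) ^ r * (1 + IZR m ^ 2)).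
    { unfold s. rewrite Rpower_plus, Rpower_pow, Rpower_1 by lra. reflexivity. }
    rewrite Es, Rpower_Ropp, Rpower_1 by lra.
    set (W := wt r (2 * m)) in *. set (y := 1 + IZR m ^ 2) in *.
    assert (Hi : / y <= / (1 + IZR m ^ 2 / 4)).
    { apply Rinv_le_contravar; unfold y in *; lra. }
    assert (E : / y + y * (W * c) ^ 2 - 2 * (W * c) = / y * (1 - y * (W * c)) ^ 2) by (field; lra).
    assert (0 <= / y * (1 - y * (W * c)) ^ 2).
    { apply Rmult_le_pos; [apply Rlt_le, Rinv_0_lt_compat; lra|apply pow2_ge_0]. }
    assert (y * (W * c) ^ 2 <= 8 ^ r * (y ^ r * y * c ^ 2)).
    { replace (y * (W * c) ^ 2) with (W ^ 2 * (y * c ^ 2)) by ring.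
      replace (8 ^ r * (y ^ r * y * c ^ 2)) with ((8 ^ r * y ^ r) * (y * c ^ 2)) by ring.
      apply Rmult_le_compat_r; auto. apply Rmult_le_pos; [lra|apply pow2_ge_0]. }
    lra. }
  exists (/ 2 * (H + 8 ^ r * Q)).
  rewrite <- (push_restrict (fun m => (2 * m)%Z) (even_part w)).
  - apply push_bnd; [apply (wt_weight r)|].
    eapply bdd_le; [|apply Rle_refl|apply B]. intros m. unfold even_part.
    rewrite Z.even_mul. simpl orb. apply Rle_refl.
  - intros x y E. lia.
  - intros m Hm. unfold even_part. destruct (Z.even m) eqn:E; auto.
    apply Z.even_spec in E. destruct E as [k ->]. now destruct (Hm k).
Qed.

Lemma even_part_fs w W x :
  summable (even_part w) ->
  is_Zsum (V := C_R_NormedModule) (fun m => (w (2 * m)%Z * cis (IZR m * x))%C) (RtoC W) ->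
  fs (even_part w) x = RtoC W.
Proof.
  intros Hs HW.
  assert (S1 : summable (fun m : Z => cis (IZR (2 * m) * x / 2) * even_part w (2 * m))%C).
  { apply (summable_reindex (fun m => (2 * m)%Z) (fun m : Z => cis (IZR m * x / 2) * even_part w m)%C);
      [intros; lia|]. now apply fs_summable. }
  assert (E : (fun m : Z => cis (IZR (2 * m) * x / 2) * even_part w (2 * m))%C =
              (fun m : Z => w (2 * m)%Z * cis (IZR m * x))%C).
  { apply functional_extensionality. intros m. unfold even_part.
    rewrite Z.even_mul. simpl orb. cbv iota. rewrite mult_IZR.
    replace (2 * IZR m * x / 2) with (IZR m * x) by field. ring. }
  unfold fs.
  destruct (CS_inj (fun m => (2 * m)%Z) (fun m : Z => cis (IZR m * x / 2) * even_part w m)%C) as [_ E2].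
  - intros; lia.
  - intros m Hm. unfold even_part. destruct (Z.even m) eqn:E'; [|apply Cmult_0_r].
    apply Z.even_spec in E'. destruct E' as [k ->]. now destruct (Hm k).
  - exact S1.
  - rewrite E2. symmetry. rewrite E in *. now apply is_Zsum_unique.
Qed.

Lemma even_part_dag w :
  w 0%Z = RtoC 0 ->
  (forall m : Z, (1 <= m)%Z -> w (2 * m)%Z = w (- (2 * m))%Z /\ w (- (2 * m))%Z = Cconj (w (2 * m)%Z)) ->
  dag (G := modes) (even_part w) = even_part w.
Proof.
  intros H0 Hw. apply functional_extensionality. intros m. unfold dag, even_part.
  change (mneg (i := modes) m) with (- m)%Z. rewrite Z.even_opp.
  destruct (Z.even m) eqn:E; [|apply Cconj_R].
  apply Z.even_spec in E. destruct E as [k ->].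
  destruct (Z.eq_dec k 0) as [->|Hk].
  - simpl. rewrite H0. apply Cconj_R.
  - destruct (Z_lt_le_dec k 0) as [Hk'|Hk'].
    + destruct (Hw (- k)%Z ltac:(lia)) as [E1 E2].
      replace (2 * - k)%Z with (- (2 * k))%Z in * by ring. rewrite Z.opp_involutive in *. congruence.
    + destruct (Hw k ltac:(lia)) as [E1 E2]. rewrite E2. apply Cconj_conj.
Qed.

(** * The elliptic equation in Fourier modes *)

Lemma bdd_finite {A : Type} (g : A -> R) L :
  (forall a, 0 <= g a) -> NoDup L -> (forall a, ~ In a L -> g a = 0) -> bdd g (rsum g L).
Proof.
  intros Hg HL H0 l Hl. destruct (NoDup_union L l) as (l' & Hl' & Hi & Hi').
  eapply Rle_trans; [apply (rsum_incl g l l'); auto|].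
  destruct (NoDup_complement L l' HL Hl' Hi) as (r & Hp & _ & Hr).
  rewrite (rsum_perm _ _ _ Hp), rsum_app.
  rewrite (rsum_ext g (fun _ => 0 * 0) r); [rewrite rsum_scal; lra|].
  intros a Ha. rewrite H0; auto; ring.
Qed.

Lemma core_support n a b m : ~ In m (Z.of_nat n :: (- Z.of_nat n)%Z :: nil) -> core n a b m = RtoC 0.
Proof.
  intros Hm. simpl in Hm. unfold core.
  destruct (Z.eqb_spec m (Z.of_nat n)); [now destruct Hm; left|].
  destruct (Z.eqb_spec m (- Z.of_nat n)); [now destruct Hm; right; left|easy].
Qed.

Lemma NoDup_pm n : (1 <= n)%nat -> NoDup (Z.of_nat n :: (- Z.of_nat n)%Z :: nil).
Proof. intros Hn. constructor; [|repeat constructor; easy]. simpl. lia. Qed.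

Lemma core_bnd r n a b : (1 <= n)%nat ->
  bnd (wt r) (core n a b) (wt r (Z.of_nat n) * (Cmod a + Cmod b)).
Proof.
  intros Hn. destruct (core_at n a b Hn) as (Ca & Cb & _).
  eapply bdd_le; [intros; apply Rle_refl| |apply (bdd_finite _ _ (fun m => Rmult_le_pos _ _
    (Rlt_le _ _ (weight_pos _ (wt_weight r) m)) (Cmod_ge_0 _)) (NoDup_pm n Hn))].
  - simpl. rewrite Ca, Cb. right.
    pose proof (weight_neg _ (wt_weight r) (Z.of_nat n)) as Hw. simpl in Hw. rewrite Hw. ring.
  - intros m Hm. rewrite core_support, Cmod_0 by auto. ring.
Qed.

Lemma fs_core n a b x : (1 <= n)%nat ->
  fs (core n a b) x = (a * cis (INR n * x / 2) + b * cis (- (INR n * x / 2)))%C.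
Proof.
  intros Hn. destruct (core_at n a b Hn) as (Ca & Cb & _).
  unfold fs. rewrite (CS_finite _ _ (NoDup_pm n Hn)).
  - simpl. rewrite Ca, Cb, opp_IZR, <- INR_IZR_INZ.
    replace (- INR n * x / 2) with (- (INR n * x / 2)) by field. ring.
  - intros m Hm. rewrite core_support by auto. ring.
Qed.

(** With [true] for even, [Bool.eqb] is addition of parities. *)
Lemma conv_parity (f h : Z -> C) p q :
  (forall m, Z.even m <> p -> f m = RtoC 0) -> (forall m, Z.even m <> q -> h m = RtoC 0) ->
  forall m, Z.even m <> Bool.eqb p q -> conv (G := modes) f h m = RtoC 0.
Proof.
  intros Hf Hh m Hm. apply CS_zero. intros [x y]. simpl.
  destruct (Bool.bool_dec (Z.even x) p) as [Ex|Ex].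
  - destruct (Bool.bool_dec (Z.even y) q) as [Ey|Ey].
    + apply onlyif_false. intros <-. apply Hm. now rewrite Z.even_add, Ex, Ey.
    + rewrite (Hh y Ey), Cmult_0_r. unfold onlyif. now destruct (excluded_middle_informative _).
  - rewrite (Hf x Ex), Cmult_0_l. unfold onlyif. now destruct (excluded_middle_informative _).
Qed.

Lemma nlin_parity n Om sg w u : supported_Z' n u ->
  supported_Z' n (nlin (G := modes) Om sg (even_part w) u).
Proof.
  intros Hu. set (p := Z.even (Z.of_nat n)).
  assert (Hw : forall m, Z.even m <> true -> even_part w m = RtoC 0).
  { intros m Hm. unfold even_part. now destruct (Z.even m). }
  assert (Hd : forall m, Z.even m <> p -> dag (G := modes) u m = RtoC 0).
  { intros m Hm. unfold dag. change (mneg (i := modes) m) with (- m)%Z.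
    rewrite Hu; [apply Cconj_R|]. now rewrite Z.even_opp. }
  intros m Hm. unfold nlin. rewrite (Hu m Hm).
  rewrite (conv_parity u (even_part w) p true); auto; [|fold p in Hm; now destruct p, (Z.even m)].
  rewrite (conv_parity u _ p (Bool.eqb p p)); auto.
  - ring.
  - apply conv_parity; auto.
  - fold p in Hm. now destruct p, (Z.even m).
Qed.

(** The Taylor coefficients are in the definition of [reduced]; what remains is to pass from the
    unconditional sum to the ordinary series. *)
Lemma reduced_analytic n Om sg w r Mw s0 eta eps0 a b m :
  bnd (wt r) w Mw -> 0 < eta -> 8 * eta * (Rabs Om + Mw + 12 * Rabs sg * s0 ^ 2) <= 1 ->
  bnd (wt r) (core n a b) s0 -> eps0 <= eta ->
  analytic_near_0 eps0 (fun eps => reduced n Om sg w m eps a b).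
Proof.
  intros Hw He Hs Hab Hle. exists (fun k => gnl n Om sg w a b (m, S k)).
  intros eps Heps.
  assert (Hsum : summable (fun k => RtoC (eps ^ k) * gnl n Om sg w a b (m, S k))%C).
  { eexists. apply (reduced_term_bdd n Om sg w r Mw s0 eta Hw He Hs a b Hab). lra. }
  unfold is_pseries, is_series. apply filterlim_Cmod. intros e Hpos.
  destruct (CS_spec _ Hsum e Hpos) as [l0 Hl0].
  exists (list_max l0). intros N HN. rewrite sum_n_csum.
  rewrite (csum_ext _ (fun k => RtoC (eps ^ k) * gnl n Om sg w a b (m, S k))%C).
  - apply Hl0; [apply seq_NoDup|]. intros k Hk. apply in_seq.
    pose proof (proj1 (list_max_le l0 _) (Nat.le_refl _)) as Hm.
    rewrite Forall_forall in Hm. specialize (Hm k Hk). lia.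
  - intros k _. rewrite pow_n_pow. destruct (gnl n Om sg w a b (m, S k)) as [x y].
    unfold scal; simpl. unfold prod_scal, scal; simpl. unfold mult; simpl.
    unfold Cmult, RtoC; simpl. f_equal; ring.
Qed.

Section Equivalence.
Context (n : nat) (Om sg eps : R) (W : R -> R) (w u : Z -> C) (Mw : R).
Hypothesis Heps : 0 < eps.
Hypothesis Hw : bnd (wt 0) w Mw.
Hypothesis HW : forall x, fs w x = RtoC (W x).

(* With U = sqrt eps * fs u the elliptic equation reads U'' = sqrt eps * fs flux. *)
Definition flux (m : Z) : C :=
  (- RtoC ((INR n) ^ 2 / 4) * u m + RtoC eps * nlin (G := modes) Om sg w u m)%C.

Lemma flux_fs M x : bnd (wt 0) u M ->
  (RtoC (sqrt eps) * fs flux x + RtoC ((INR n) ^ 2 / 4 + eps * Om) * (RtoC (sqrt eps) * fs u x)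
    + RtoC eps * RtoC (W x) * (RtoC (sqrt eps) * fs u x) =
   RtoC sg * RtoC ((Cmod (RtoC (sqrt eps) * fs u x)) ^ 2) * (RtoC (sqrt eps) * fs u x))%C.
Proof.
  intros Hu.
  assert (S1 : summable u).
  { exists M. eapply bdd_le; [|apply Rle_refl|apply Hu]. intros m; unfold wt; simpl; lra. }
  assert (S2 : summable (nlin (G := modes) Om sg w u)).
  { eexists. eapply bdd_le; [|apply Rle_refl|apply (nlin_bnd (G := modes) _ (wt_weight 0) Om sg w u Mw M Hw Hu)].
    intros m; unfold wt; simpl; lra. }
  unfold flux. rewrite fs_plus, !fs_scal, (fs_nlin Om sg w u x Mw M Hw Hu), HW
    by auto using summable_scal.
  rewrite Cmod_mult, Cmod_R, Rabs_pos_eq by apply sqrt_pos.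
  rewrite Rpow_mult_distr. replace (sqrt eps ^ 2) with eps by (simpl; rewrite Rmult_1_r, sqrt_sqrt; lra).
  rewrite RtoC_plus, !RtoC_mult. ring.
Qed.

Lemma dmul_sqr k : (dmul k * dmul k)%C = RtoC (- ((IZR k) ^ 2 / 4)).
Proof. unfold dmul, Cmult, RtoC; simpl. f_equal; field. Qed.

Lemma flux_balance k :
  flux k = (dmul k * dmul k * u k)%C <->
  (RtoC eps * nlin (G := modes) Om sg w u k = RtoC (((INR n) ^ 2 - (IZR k) ^ 2) / 4) * u k)%C.
Proof.
  rewrite dmul_sqr.
  replace (((INR n) ^ 2 - (IZR k) ^ 2) / 4) with ((INR n) ^ 2 / 4 + - ((IZR k) ^ 2 / 4)) by field.
  rewrite RtoC_plus. unfold flux. set (N := nlin (G := modes) Om sg w u k).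
  split; intros E.
  - replace (RtoC eps * N)%C with ((- RtoC ((INR n) ^ 2 / 4) * u k + RtoC eps * N) + RtoC ((INR n) ^ 2 / 4) * u k)%C
      by ring. rewrite E. ring.
  - rewrite E. ring.
Qed.

Lemma solution_form U : summable u -> has_form eps u U ->
  forall x, U x = (RtoC (sqrt eps) * fs u x)%C.
Proof.
  intros Su HU x.
  assert (E : (fun m => RtoC (sqrt eps) * (u m * cis (IZR m * x / 2)))%C =
              (fun m => RtoC (sqrt eps) * (cis (IZR m * x / 2) * u m))%C).
  { apply functional_extensionality. intros m. ring. }
  rewrite (is_Zsum_unique (fun m => RtoC (sqrt eps) * (u m * cis (IZR m * x / 2)))%C (U x)); auto.
  - rewrite E, CS_scal; auto. now apply fs_summable.
  - rewrite E. apply summable_scal. now apply fs_summable.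
Qed.

Lemma form_fs : summable u -> has_form eps u (fun x => RtoC (sqrt eps) * fs u x)%C.
Proof.
  intros Su x.
  replace (fun m => RtoC (sqrt eps) * (u m * cis (IZR m * x / 2)))%C with
              (fun m => RtoC (sqrt eps) * (cis (IZR m * x / 2) * u m))%C
    by (apply functional_extensionality; intros m; ring).
  unfold fs. rewrite <- CS_scal by now apply fs_summable.
  apply is_Zsum_CS. apply summable_scal. now apply fs_summable.
Qed.

(** Only weight 0 is at hand, so U'' is not computed termwise: the equation itself exhibits it as an
    absolutely convergent series with coefficients [flux], up to the scale [sqrt eps], and
    [coefficient_equation] compares coefficients. *)
Lemma solution_coefficients M U :
  bnd (wt 0) u M -> elliptic_solution ((INR n) ^ 2 / 4 + eps * Om) eps sg W U -> has_form eps u U ->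
  forall k, (RtoC eps * nlin (G := modes) Om sg w u k = RtoC (((INR n) ^ 2 - (IZR k) ^ 2) / 4) * u k)%C.
Proof.
  intros Hu (U1 & U2 & HU) Hf k.
  assert (S1 : summable u).
  { exists M. eapply bdd_le; [|apply Rle_refl|apply Hu]. intros m; unfold wt; simpl; lra. }
  assert (S2 : summable flux).
  { apply summable_plus; apply summable_scal; auto.
    eexists. eapply bdd_le; [|apply Rle_refl|apply (nlin_bnd (G := modes) _ (wt_weight 0) Om sg w u Mw M Hw Hu)].
    intros m; unfold wt; simpl; lra. }
  pose proof (solution_form U S1 Hf) as HU0.
  assert (Hs : RtoC (sqrt eps) <> RtoC 0).
  { intros E. apply RtoC_inj in E. pose proof (sqrt_lt_R0 eps Heps). lra. }
  apply flux_balance.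
  pose proof (coefficient_equation U U1 U2 (fun m => RtoC (sqrt eps) * u m)%C
    (fun m => RtoC (sqrt eps) * flux m)%C (summable_scal _ _ S1) (summable_scal _ _ S2)) as HC.
  specialize (HC ltac:(intros x; rewrite fs_scal; auto)).
  assert (E2 : forall x, U2 x = fs (fun m => RtoC (sqrt eps) * flux m)%C x).
  { intros x. rewrite fs_scal by auto. destruct (HU x) as (_ & _ & E). rewrite HU0 in E.
    pose proof (flux_fs M x Hu) as E'. rewrite <- E' in E.
    set (t := (RtoC ((INR n) ^ 2 / 4 + eps * Om) * (RtoC (sqrt eps) * fs u x))%C) in *.
    set (v := (RtoC eps * RtoC (W x) * (RtoC (sqrt eps) * fs u x))%C) in *.
    replace (U2 x) with ((U2 x + t + v) - t - v)%C by ring. rewrite E. ring. }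
  specialize (HC E2 ltac:(intros x; apply is_derive_Cderiv, HU) ltac:(intros x; apply is_derive_Cderiv, HU) k).
  cbv beta in HC.
  replace (flux k) with (/ RtoC (sqrt eps) * (RtoC (sqrt eps) * flux k))%C by (field; auto).
  rewrite HC. field. auto.
Qed.

(** Weight 2 dominates [dmul m] squared, which licenses two termwise differentiations. *)
Lemma coefficients_solution M :
  bnd (wt 2) u M ->
  (forall k, (RtoC eps * nlin (G := modes) Om sg w u k = RtoC (((INR n) ^ 2 - (IZR k) ^ 2) / 4) * u k)%C) ->
  elliptic_solution ((INR n) ^ 2 / 4 + eps * Om) eps sg W (fun x => RtoC (sqrt eps) * fs u x)%C.
Proof.
  intros Hu Hk.
  assert (Hb : forall c : Z -> C, (forall m, Cmod (c m) <= wt 2 m) -> summable (fun m => c m * u m)%C).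
  { intros c Hc. exists M. eapply bdd_le; [|apply Rle_refl|apply Hu].
    intros m. cbv beta. rewrite Cmod_mult. apply Rmult_le_compat_r; auto using Cmod_ge_0. }
  assert (Hw2 : forall m, 1 <= wt 2 m /\ Rabs (IZR m) / 2 <= wt 2 m /\ Rabs (IZR m) / 2 * (Rabs (IZR m) / 2) <= wt 2 m).
  { intros m. unfold wt. pose proof (Rabs_pos (IZR m)). repeat split; nra. }
  assert (Hu0 : bnd (wt 0) u M).
  { eapply bdd_le; [|apply Rle_refl|apply Hu]. intros m. cbv beta. apply Rmult_le_compat_r; [apply Cmod_ge_0|].
    unfold wt at 1. simpl pow. apply Hw2. }
  assert (S0 : summable u).
  { exists M. eapply bdd_le; [|apply Rle_refl|apply Hu0]. intros m; unfold wt; simpl; lra. }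
  assert (S1 : summable (fun m => dmul m * u m)%C).
  { apply Hb. intros m. rewrite Cmod_dmul. apply Hw2. }
  assert (S2 : summable (fun m => dmul m * (dmul m * u m))%C).
  { replace (fun m => dmul m * (dmul m * u m))%C with (fun m => (dmul m * dmul m) * u m)%C
      by (apply functional_extensionality; intros; ring).
    apply Hb. intros m. rewrite Cmod_mult, Cmod_dmul. apply Hw2. }
  assert (D : forall v x, summable v -> summable (fun m => dmul m * v m)%C ->
    Cderiv (fun y => RtoC (sqrt eps) * fs v y)%C x (RtoC (sqrt eps) * fs (fun m => dmul m * v m)%C x)%C).
  { intros v x Sv Sdv. rewrite Cmult_comm.
    replace (fun y => RtoC (sqrt eps) * fs v y)%C with (fun y => fs v y * RtoC (sqrt eps))%C
      by (apply functional_extensionality; intros; ring).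
    now apply Cderiv_const_mult, fs_deriv. }
  exists (fun x => RtoC (sqrt eps) * fs (fun m => dmul m * u m)%C x)%C,
    (fun x => RtoC (sqrt eps) * fs flux x)%C.
  intros x. split; [|split].
  - now apply is_derive_Cderiv, D.
  - apply is_derive_Cderiv.
    replace flux with (fun m => dmul m * (dmul m * u m))%C.
    + now apply (D (fun m => dmul m * u m)%C).
    + apply functional_extensionality. intros m. rewrite (proj2 (flux_balance m) (Hk m)). ring.
  - apply (flux_fs M x Hu0).
Qed.

End Equivalence.

(** * Reduction to the two resonant modes *)

Lemma bnd_wt0 r u M : bnd (wt r) u M -> bnd (wt 0) u M.
Proof.
  intros H. eapply bdd_le; [|apply Rle_refl|apply H].
  intros m. apply Rmult_le_compat_r; [apply Cmod_ge_0|]. unfold wt at 1. apply wt_ge_1.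
Qed.

Lemma core_remainder n u m : (1 <= n)%nat ->
  (core n (u (Z.of_nat n)) (u (- Z.of_nat n)%Z) m + remainder n u m)%C = u m.
Proof.
  intros Hn. unfold core, remainder.
  destruct (Z.eqb_spec m (Z.of_nat n)) as [->|E1]; [|destruct (Z.eqb_spec m (- Z.of_nat n)) as [->|E2]].
  - rewrite Z.abs_eq, Z.eqb_refl by lia. ring.
  - rewrite Z.abs_opp, Z.abs_eq, Z.eqb_refl by lia. ring.
  - destruct (Z.eqb_spec (Z.abs m) (Z.of_nat n)); [lia|ring].
Qed.

(** The resonant modes are bounded by [delta], the others through [rho]; the resulting l^1 radius is
    independent of eps, so one smallness condition on eps serves all solutions in range. *)
Lemma in_range_l1 s n delta rho u H :
  (1 <= n)%nat -> bdd (fun m : Z => Rpower (1 + (IZR m) ^ 2 / 4) (- s)) H ->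
  in_l2s s n u -> in_range s n delta rho u ->
  bnd (wt 0) u (delta + (H + rho ^ 2) / 2).
Proof.
  intros Hn HH [_ Hl] [Hd Hr].
  pose proof (Zpartial_bdd _ (l2s_term_ge0 s u) Hl) as Hb.
  assert (Hrem : ex_finite_lim_seq (Zpartial (l2s_term s (remainder n u)))).
  { apply (bdd_Zpartial _ _ (l2s_term_ge0 s _) (bdd_le _ _ _ _ (l2s_remainder_le s n u) (Rle_refl _) Hb)). }
  pose proof (l2s_l1 s _ _ H HH (l2s_norm_bdd s _ rho Hrem Hr)) as Hv.
  replace u with (fun m => core n (u (Z.of_nat n)) (u (- Z.of_nat n)%Z) m + remainder n u m)%C
    by (apply functional_extensionality; intros m; now apply core_remainder).
  apply bnd_plus.
  - intros m. unfold wt. simpl. lra.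
  - eapply bdd_le; [intros; apply Rle_refl| |apply (core_bnd 0 n (u (Z.of_nat n)) (u (- Z.of_nat n)%Z) Hn)].
    unfold wt. simpl pow. lra.
  - eapply bdd_le; [|apply Rle_refl|apply Hv]. intros m. unfold wt. simpl. lra.
Qed.

Lemma usol_diff_bnd n Om sg w r Mw s0 eta a b eps :
  bnd (wt r) w Mw -> 0 < eta -> 8 * eta * (Rabs Om + Mw + 12 * Rabs sg * s0 ^ 2) <= 1 ->
  bnd (wt r) (core n a b) s0 -> Rabs eps <= eta ->
  bnd (wt r) (fun m => usol n Om sg w eps a b m - core n a b m)%C
    (Rabs eps * (4 * (nlin_const Om sg Mw s0 * s0))).
Proof.
  intros Hw He Hs Hab Hle.
  replace (fun m => usol n Om sg w eps a b m - core n a b m)%C with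
    (fun m => RtoC eps * (ell n m * nlin (G := modes) Om sg w (usol n Om sg w eps a b) m))%C.
  - rewrite <- Cmod_R. apply bnd_scal.
    apply (ell_bnd (fun m : Z => m)); [intros m; apply Rlt_le, (weight_pos _ (wt_weight r))|].
    unfold nlin_const.
    replace ((2 * (Rabs Om + Mw) + 8 * Rabs sg * s0 ^ 2) * s0) with
      ((Rabs Om + Mw) * (2 * s0) + Rabs sg * (2 * s0) ^ 3) by ring.
    apply (nlin_bnd (G := modes) _ (wt_weight r)); auto.
    eapply usol_bnd; eauto.
  - apply functional_extensionality. intros m.
    rewrite (usol_eq n Om sg w r Mw s0 eta Hw He Hs a b Hab eps Hle m). ring.
Qed.

(** The fixed-point map at a given value of eps. A solution of the elliptic problem is not given as
    a power series in eps, so uniqueness has to be proved here and not for [gstep]. *)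
Definition zstep (n : nat) (Om sg eps : R) (w : Z -> C) (a b : C) (f : Z -> C) (m : Z) : C :=
  (core n a b m + eps * (ell n m * nlin (G := modes) Om sg w f m))%C.

Lemma zstep_unique n Om sg w Mw M eps a b f h :
  bnd (wt 0) w Mw -> 8 * Rabs eps * (Rabs Om + Mw + 3 * Rabs sg * M ^ 2) <= 1 ->
  bnd (wt 0) f M -> bnd (wt 0) h M ->
  zstep n Om sg eps w a b f = f -> zstep n Om sg eps w a b h = h -> f = h.
Proof.
  intros Hw Hs. apply fixpoint_unique; [apply (wt_weight 0)|].
  intros f' h' D Hf Hh Hd. pose proof (bdd_ge0 _ _ Hd) as HD.
  replace (fun m => zstep n Om sg eps w a b f' m - zstep n Om sg eps w a b h' m)%C with
    (fun m => RtoC eps * (ell n m * (nlin (G := modes) Om sg w f' m - nlin (G := modes) Om sg w h' m)))%C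
    by (apply functional_extensionality; intros m; unfold zstep; ring).
  eapply bdd_le; [intros; apply Rle_refl| |apply bnd_scal, (ell_bnd (fun m : Z => m));
    [|apply (nlin_lip (G := modes) _ (wt_weight 0) Om sg w f' h' Mw M D Hw Hf Hh Hd)]].
  - rewrite Cmod_R. nra.
  - intros m. apply Rlt_le, (weight_pos _ (wt_weight 0)).
Qed.

(* ell vanishes exactly where the mode equation is either resonant or void. *)
Lemma balance_zstep n Om sg eps w u : (1 <= n)%nat -> eps <> 0 ->
  supported_Z' n u ->
  (forall k, (RtoC eps * nlin (G := modes) Om sg w u k = RtoC (((INR n) ^ 2 - (IZR k) ^ 2) / 4) * u k)%C) ->
  zstep n Om sg eps w (u (Z.of_nat n)) (u (- Z.of_nat n)%Z) u = u /\
  nlin (G := modes) Om sg w u (Z.of_nat n) = RtoC 0 /\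
  nlin (G := modes) Om sg w u (- Z.of_nat n)%Z = RtoC 0.
Proof.
  intros Hn He Hp Hk.
  assert (HeC : RtoC eps <> RtoC 0) by (intros E; apply RtoC_inj in E; auto).
  assert (R0 : forall k, IZR k ^ 2 = INR n ^ 2 -> nlin (G := modes) Om sg w u k = RtoC 0).
  { intros k E. specialize (Hk k). rewrite E in Hk.
    replace ((INR n ^ 2 - INR n ^ 2) / 4) with 0 in Hk by field.
    rewrite Cmult_0_l in Hk.
    replace (nlin (G := modes) Om sg w u k) with (/ RtoC eps * (RtoC eps * nlin (G := modes) Om sg w u k))%C
      by (field; auto).
    rewrite Hk. ring. }
  split; [|split; apply R0; [|rewrite opp_IZR]; rewrite <- INR_IZR_INZ; ring].
  apply functional_extensionality. intros m. unfold zstep.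
  rewrite <- (core_remainder n u m Hn). f_equal. unfold remainder, ell.
  destruct (Z.eqb_spec (Z.abs m) (Z.of_nat n)) as [E|E].
  - rewrite Bool.andb_false_r. ring.
  - rewrite Bool.andb_true_r. destruct (Bool.eqb_spec (Z.even m) (Z.even (Z.of_nat n))) as [Ee|Ee].
    + rewrite Cmult_assoc, (Cmult_comm (RtoC eps)), <- Cmult_assoc, Hk.
      assert (Hd : INR n ^ 2 - IZR m ^ 2 <> 0).
      { intros E0. pose proof (ell_denominator n m E) as H. rewrite E0, Rabs_R0 in H. lra. }
      rewrite Cmult_assoc, <- RtoC_mult.
      replace (4 / (INR n ^ 2 - IZR m ^ 2) * ((INR n ^ 2 - IZR m ^ 2) / 4)) with 1 by (field; exact Hd).
      ring.
    + rewrite (Hp m Ee). ring.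
Qed.

(** For the balance, the resonant modes are covered by the two hypotheses and the other modes of the
    right parity by the fixed-point equation; at modes of the wrong parity both sides vanish,
    because [nlin] preserves the support. *)
Lemma usol_balance n Om sg w r Mw s0 eta a b eps :
  (1 <= n)%nat ->
  bnd (wt r) (even_part w) Mw -> 0 < eta -> 8 * eta * (Rabs Om + Mw + 12 * Rabs sg * s0 ^ 2) <= 1 ->
  bnd (wt r) (core n a b) s0 -> Rabs eps <= eta ->
  let u := usol n Om sg (even_part w) eps a b in
  u (Z.of_nat n) = a /\ u (- Z.of_nat n)%Z = b /\ supported_Z' n u /\
  (nlin (G := modes) Om sg (even_part w) u (Z.of_nat n) = RtoC 0 ->
   nlin (G := modes) Om sg (even_part w) u (- Z.of_nat n)%Z = RtoC 0 ->
   forall k, (RtoC eps * nlin (G := modes) Om sg (even_part w) u k = RtoC (((INR n) ^ 2 - (IZR k) ^ 2) / 4) * u k)%C).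
Proof.
  intros Hn Hw He Hs Hab Hle u.
  pose proof (usol_eq n Om sg (even_part w) r Mw s0 eta Hw He Hs a b Hab eps Hle) as Eu. fold u in Eu.
  destruct (core_at n a b Hn) as (Ca & Cb & C0).
  assert (L0 : forall m, Z.abs m = Z.of_nat n -> ell n m = 0).
  { intros m E. unfold ell. rewrite E, Z.eqb_refl, Bool.andb_false_r. easy. }
  assert (Hsup : supported_Z' n u).
  { intros m Hm. rewrite Eu. rewrite C0.
    - unfold ell. destruct (Bool.eqb_spec (Z.even m) (Z.even (Z.of_nat n))); [easy|]. simpl. ring.
    - intros E. apply Hm. rewrite <- E. destruct (Z.abs_eq_or_opp m) as [-> | ->]; auto. now rewrite Z.even_opp. }
  repeat split; auto.
  - rewrite Eu, Ca, L0 by lia. ring.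
  - rewrite Eu, Cb, L0 by lia. ring.
  - intros N1 N2 k.
    destruct (Z.eq_dec (Z.abs k) (Z.of_nat n)) as [E|E].
    + assert (Ek : IZR k ^ 2 = INR n ^ 2).
      { rewrite <- (pow2_abs (IZR k)), <- abs_IZR, E, <- INR_IZR_INZ. easy. }
      rewrite Ek. replace ((INR n ^ 2 - INR n ^ 2) / 4) with 0 by field.
      assert (Hnk : nlin (G := modes) Om sg (even_part w) u k = RtoC 0).
      { destruct (Z.abs_eq_or_opp k) as [E'|E'].
        - now replace k with (Z.of_nat n) by lia. - now replace k with (- Z.of_nat n)%Z by lia. }
      rewrite Hnk. ring.
    + destruct (Bool.bool_dec (Z.even k) (Z.even (Z.of_nat n))) as [Ee|Ee].
      * rewrite (Eu k), C0 by auto. unfold ell. rewrite Ee, Bool.eqb_reflx.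
        destruct (Z.eqb_spec (Z.abs k) (Z.of_nat n)); [easy|]. simpl andb. cbv iota.
        assert (Hd : INR n ^ 2 - IZR k ^ 2 <> 0).
        { intros E0. pose proof (ell_denominator n k E) as H. rewrite E0, Rabs_R0 in H. lra. }
        set (N := nlin (G := modes) Om sg (even_part w) u k).
        replace (RtoC ((INR n ^ 2 - IZR k ^ 2) / 4) * (0 + eps * (RtoC (4 / (INR n ^ 2 - IZR k ^ 2)) * N)))%C
          with (RtoC ((INR n ^ 2 - IZR k ^ 2) / 4) * RtoC (4 / (INR n ^ 2 - IZR k ^ 2)) * (eps * N))%C by ring.
        rewrite <- RtoC_mult.
        replace ((INR n ^ 2 - IZR k ^ 2) / 4 * (4 / (INR n ^ 2 - IZR k ^ 2))) with 1 by (field; exact Hd).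
        ring.
      * rewrite (Hsup k Ee), (nlin_parity n Om sg w u Hsup k Ee). ring.
Qed.

Lemma bifurcation_eqs_nlin n Om sg w r Mw s0 eta a b eps :
  (1 <= n)%nat -> w 0%Z = RtoC 0 ->
  bnd (wt r) (even_part w) Mw -> 0 < eta -> 8 * eta * (Rabs Om + Mw + 12 * Rabs sg * s0 ^ 2) <= 1 ->
  bnd (wt r) (core n a b) s0 -> Rabs eps <= eta ->
  bifurcation_eqs w Om sg eps n (reduced n Om sg (even_part w) (Z.of_nat n))
    (reduced n Om sg (even_part w) (- Z.of_nat n)%Z) a b <->
  nlin (G := modes) Om sg (even_part w) (usol n Om sg (even_part w) eps a b) (Z.of_nat n) = RtoC 0 /\
  nlin (G := modes) Om sg (even_part w) (usol n Om sg (even_part w) eps a b) (- Z.of_nat n)%Z = RtoC 0.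
Proof.
  intros Hn Hw0 Hw He Hs Hab Hle.
  rewrite !(usol_nlin_split n Om sg (even_part w) r Mw s0 eta Hw He Hs a b Hab eps Hle),
    !(gnl_order0 n Om sg (even_part w) r Mw s0 eta a b _ Hw He Hs Hab).
  destruct (nlin_core n Om sg (even_part w) a b Hn) as [-> ->]; [exact Hw0|].
  replace (even_part w (2 * Z.of_nat n)%Z) with (w (2 * Z.of_nat n)%Z)
    by (unfold even_part; now rewrite Z.even_mul).
  replace (even_part w (- (2 * Z.of_nat n))%Z) with (w (- (2 * Z.of_nat n))%Z)
    by (unfold even_part; now rewrite Z.even_opp, Z.even_mul).
  assert (E : forall x y : C, x = y <-> (- x + y)%C = RtoC 0).
  { intros x y. split; intros E; [rewrite E; ring|].
    symmetry. apply Cminus_eq_0. rewrite <- E. ring. }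
  unfold bifurcation_eqs. now rewrite <- !E.
Qed.

Theorem theorem1 :
  forall (W : R -> R) (w : Z -> C) (n : nat) (Omega sigma : R),
    smooth W ->
    (forall x : R, W (x + 2 * PI) = W x) ->
    is_RInt W 0 (2 * PI) 0 ->
    (forall x : R, W (- x) = W x) ->
    (forall x : R,
       is_Zsum (V := C_R_NormedModule)
         (fun m => (w (2 * m)%Z * cis (IZR m * x))%C) (RtoC (W x))) ->
    (forall s : R, 1 / 2 < s ->
       ex_finite_lim_seq
         (Zpartial (fun m : Z =>
            Rpower (1 + (IZR m) ^ 2) s * (Cmod (w (2 * m)%Z)) ^ 2))) ->
    w 0%Z = RtoC 0 ->
    (forall m : Z, (1 <= m)%Z ->
       w (2 * m)%Z = w (- (2 * m))%Z /\ w (- (2 * m))%Z = Cconj (w (2 * m)%Z)) ->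
    (1 <= n)%nat ->
    w (2 * Z.of_nat n)%Z <> RtoC 0 ->
    exists A B : R -> C -> C -> C,
      (forall (eps : R) (a b : C),
         A eps a b = Cconj (B eps (Cconj b) (Cconj a))) /\
      forall s : R, 1 / 2 < s ->
      forall delta rho : R, 0 < delta -> 0 < rho ->
      exists eps0 CA CB K : R,
        0 < eps0 /\ 0 < CA /\ 0 < CB /\ 0 < K /\
        (forall a b : C, Cmod a + Cmod b < delta ->
           analytic_near_0 eps0 (fun eps => A eps a b) /\
           analytic_near_0 eps0 (fun eps => B eps a b)) /\
        (forall eps : R, Rabs eps < eps0 ->
         forall a b : C, Cmod a + Cmod b < delta ->
           Cmod (A eps a b) <= CA * (Cmod a + Cmod b) /\
           Cmod (B eps a b) <= CB * (Cmod a + Cmod b)) /\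
        forall eps : R, 0 < eps < eps0 ->
          ((exists (u : Z -> C) (U : R -> C),
              nontrivial_solution W Omega sigma s eps n u U /\
              in_range s n delta rho u)
           <->
           (exists a b : C,
              Cmod a + Cmod b < delta /\
              nontrivial_pair a b /\
              bifurcation_eqs w Omega sigma eps n A B a b)) /\
          (forall a b : C, Cmod a + Cmod b < delta ->
             ((exists (u : Z -> C) (U : R -> C),
                 nontrivial_solution W Omega sigma s eps n u U /\
                 in_range s n delta rho u /\
                 u (Z.of_nat n) = a /\ u (- Z.of_nat n)%Z = b)
              <->
              (nontrivial_pair a b /\
               bifurcation_eqs w Omega sigma eps n A B a b))) /\
          (forall (u : Z -> C) (U : R -> C) (a b : C),
             nontrivial_solution W Omega sigma s eps n u U ->
             in_range s n delta rho u ->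
             u (Z.of_nat n) = a -> u (- Z.of_nat n)%Z = b ->
             Rbar_le
               (Cb0_norm (fun x =>
                  (U x - RtoC (sqrt eps) *
                     (a * cis (INR n * x / 2) + b * cis (- (INR n * x / 2))))%C))
               (Finite (K * Rpower eps (3 / 2)))).
Proof.
  intros W w n Om sg _ _ _ _ HW Hsum Hw0 Hwsym Hn _.
  pose proof (even_part_dag w Hw0 Hwsym) as Hdag.
  exists (reduced n Om sg (even_part w) (Z.of_nat n)),
    (reduced n Om sg (even_part w) (- Z.of_nat n)%Z).
  split; [intros eps a b; now apply reduced_dag|].
  intros s Hs delta rho Hdelta Hrho.
  (* Order [s] puts the constructed sequence into l^2_s; order 2 makes its Fourier series twice
     differentiable. *)
  assert (Hr : exists r : nat, s <= INR r /\ 2 <= INR r /\ (2 <= r)%nat).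
  { destruct (archimed s) as [Hup _]. assert (0 <= up s)%Z by (apply le_IZR; lra).
    exists (2 + Z.to_nat (up s))%nat. rewrite plus_INR, (INR_IZR_INZ (Z.to_nat _)), Z2Nat.id by auto.
    assert (0 <= IZR (up s)) by lra. simpl INR. repeat split; try lra. lia. }
  destruct Hr as (r & Hsr & _ & Hr2).
  destruct (even_part_bnd w r Hsum) as [Mw Hw].
  pose proof (bdd_ge0 _ _ Hw) as HMw. pose proof (bnd_wt0 r _ _ Hw) as Hw'.
  assert (HWfs : forall x, fs (even_part w) x = RtoC (W x)).
  { intros x. apply even_part_fs; auto.
    exists Mw. eapply bdd_le; [|apply Rle_refl|apply Hw']. intros m; unfold wt; simpl; lra. }
  destruct (Rpower_modes_bdd s Hs) as [H HH]. pose proof (bdd_ge0 _ _ HH) as HH0.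
  pose proof (Rabs_pos Om) as HOm. pose proof (Rabs_pos sg) as Hsg.
  set (th := wt r (Z.of_nat n)). assert (Hth : 1 <= th) by apply wt_ge_1.
  (* Bounds the weighted norm of [core n a b] over the whole ball |a| + |b| < [delta]. *)
  set (S := th * delta). assert (HS : 0 < S) by (unfold S; nra).
  set (Kn := nlin_const Om sg Mw S).
  assert (HKn : 0 <= Kn) by (unfold Kn, nlin_const; pose proof (pow2_ge_0 S); nra).
  set (c1 := Rabs Om + Mw + 12 * Rabs sg * S ^ 2).
  assert (Hc1 : 0 <= c1) by (unfold c1; pose proof (pow2_ge_0 S); nra).
  set (eta := / (8 * (c1 + 1))).
  assert (Heta : 0 < eta) by (apply Rinv_0_lt_compat; lra).
  assert (Heta1 : 8 * eta * (c1 + 1) = 1) by (unfold eta; field; lra).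
  (* A common l^1 radius for the constructed sequence, bounded by [2 * S], and for any solution in
     range, bounded by the bracket. [e2] below makes [zstep] a contraction there. *)
  set (M := 2 * S + (delta + (H + rho ^ 2) / 2)).
  set (c2 := Rabs Om + Mw + 3 * Rabs sg * M ^ 2).
  assert (Hc2 : 0 <= c2) by (unfold c2; pose proof (pow2_ge_0 M); nra).
  set (e2 := / (8 * (c2 + 1))).
  assert (He2 : 0 < e2) by (apply Rinv_0_lt_compat; lra).
  assert (He21 : 8 * e2 * (c2 + 1) = 1) by (unfold e2; field; lra).
  (* The constructed sequence differs from its core by at most [eps * D]; [e3] keeps this below
     [rho]. *)
  set (D := 4 * (Kn * S)). assert (HD : 0 <= D) by (unfold D; nra).
  set (e3 := rho / (D + 1)). assert (He3 : 0 < e3) by (apply Rdiv_lt_0_compat; lra).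
  assert (He31 : e3 * (D + 1) = rho) by (unfold e3; field; lra).
  set (eps0 := Rmin eta (Rmin e2 e3)).
  assert (Heps0 : 0 < eps0) by (repeat apply Rmin_pos; auto).
  assert (L1 : eps0 <= eta) by apply Rmin_l.
  assert (L2 : eps0 <= e2) by (eapply Rle_trans; [apply Rmin_r|apply Rmin_l]).
  assert (L3 : eps0 <= e3) by (eapply Rle_trans; [apply Rmin_r|apply Rmin_r]).
  (* With every radius up to [S] allowed, the estimates can be applied at the radius
     [th * (Cmod a + Cmod b)] of the pair itself, which gives bounds linear in |a| + |b|. *)
  assert (Hsmall : forall t, 0 <= t <= S -> 8 * eta * (Rabs Om + Mw + 12 * Rabs sg * t ^ 2) <= 1).
  { intros t Ht. assert (t ^ 2 <= S ^ 2) by (apply pow_incr; auto).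
    assert (Rabs Om + Mw + 12 * Rabs sg * t ^ 2 <= c1 + 1) by (unfold c1; nra). nra. }
  assert (HsS : 8 * eta * (Rabs Om + Mw + 12 * Rabs sg * S ^ 2) <= 1) by (apply Hsmall; lra).
  assert (Hab : forall a b : C, Cmod a + Cmod b < delta ->
    0 <= th * (Cmod a + Cmod b) <= S /\ bnd (wt r) (core n a b) (th * (Cmod a + Cmod b)) /\
    bnd (wt r) (core n a b) S).
  { intros a b Hlt. pose proof (Cmod_ge_0 a). pose proof (Cmod_ge_0 b).
    assert (0 <= th * (Cmod a + Cmod b) <= S) by (unfold S; nra).
    split; [auto|]. split; [now apply core_bnd|].
    eapply bdd_le; [intros; apply Rle_refl| |apply (core_bnd r n a b Hn)]. unfold S, th in *. lra. }
  (* The constants for [A] and [B] come from [reduced_le], the last one from [D]; each added 1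
     ensures positivity. *)
  exists eps0, (/ eta * Kn * th + 1), (/ eta * Kn * th + 1), (D + 1).
  assert (Hie : 0 < / eta) by now apply Rinv_0_lt_compat.
  assert (HCA : 0 <= / eta * Kn * th) by (apply Rmult_le_pos; [apply Rmult_le_pos|]; lra).
  do 4 (split; [lra|]).
  split; [|split].
  { intros a b Hlt. destruct (Hab a b Hlt) as (_ & _ & HbS).
    split; apply (reduced_analytic n Om sg (even_part w) r Mw S eta); auto. }
  { intros eps Heps a b Hlt. destruct (Hab a b Hlt) as (Ht & Hbt & _).
    assert (B : forall m, Cmod (reduced n Om sg (even_part w) m eps a b) <=
       (/ eta * Kn * th + 1) * (Cmod a + Cmod b)).
    { intros m. eapply Rle_trans;
        [apply (reduced_le n Om sg (even_part w) r Mw _ eta Hw Heta (Hsmall _ Ht) a b Hbt); lra|].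
      assert (Kt : nlin_const Om sg Mw (th * (Cmod a + Cmod b)) <= Kn).
      { unfold Kn, nlin_const. apply Rplus_le_compat_l, Rmult_le_compat_l; [lra|]. now apply pow_incr. }
      pose proof (Cmod_ge_0 a). pose proof (Cmod_ge_0 b).
      apply Rle_trans with (/ eta * (Kn * (th * (Cmod a + Cmod b)))); [|nra].
      apply Rmult_le_compat_l; [lra|]. apply Rmult_le_compat_r; lra. }
    split; apply B. }
  intros eps Heps.
  assert (Ha : Rabs eps = eps) by (apply Rabs_pos_eq; lra).
  assert (Hle : Rabs eps <= eta) by lra.
  set (V := usol n Om sg (even_part w) eps).
  (* Any solution in range is the constructed one: both are fixed points of [zstep] for the same [a]
     and [b] in the ball of radius [M]. *)
  assert (Fwd : forall u U a b, nontrivial_solution W Om sg s eps n u U -> in_range s n delta rho u ->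
     u (Z.of_nat n) = a -> u (- Z.of_nat n)%Z = b ->
     Cmod a + Cmod b < delta /\ u = V a b /\ (forall x, U x = (RtoC (sqrt eps) * fs u x)%C) /\
     nlin (G := modes) Om sg (even_part w) u (Z.of_nat n) = RtoC 0 /\
     nlin (G := modes) Om sg (even_part w) u (- Z.of_nat n)%Z = RtoC 0).
  { intros u U a b (HU & _ & Hu & Hf) Hrg Ea Eb.
    assert (Hlt : Cmod a + Cmod b < delta) by (destruct Hrg as [Hrg _]; now rewrite Ea, Eb in Hrg).
    destruct (Hab a b Hlt) as (_ & _ & HbS).
    pose proof (in_range_l1 s n delta rho u H Hn HH Hu Hrg) as Hu1.
    assert (Su : summable u).
    { eexists. eapply bdd_le; [|apply Rle_refl|apply Hu1]. intros m; unfold wt; simpl; lra. }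
    pose proof (solution_coefficients n Om sg eps W (even_part w) u Mw (proj1 Heps) Hw' HWfs _ U Hu1 HU Hf) as Hk.
    destruct (balance_zstep n Om sg eps (even_part w) u Hn ltac:(lra) (proj1 Hu) Hk) as (Ez & N1 & N2).
    rewrite Ea, Eb in Ez.
    split; [auto|]. split; [|split; [now apply solution_form|now split]].
    apply (zstep_unique n Om sg (even_part w) Mw M eps a b); auto.
    - fold c2. rewrite Ha. assert (8 * eps <= 8 * e2) by lra. nra.
    - eapply bdd_le; [intros; apply Rle_refl| |apply Hu1]. unfold M. lra.
    - eapply bdd_le; [intros; apply Rle_refl| |
        apply (bnd_wt0 r), (usol_bnd n Om sg (even_part w) r Mw S eta Hw Heta HsS a b HbS eps Hle)].
      unfold M. pose proof (pow2_ge_0 rho). lra.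
    - apply functional_extensionality. intros m. symmetry.
      apply (usol_eq n Om sg (even_part w) r Mw S eta Hw Heta HsS a b HbS eps Hle). }
  assert (Dif : forall a b, Cmod a + Cmod b < delta ->
     bnd (wt r) (fun m => V a b m - core n a b m)%C (eps * D)).
  { intros a b Hlt. destruct (Hab a b Hlt) as (_ & _ & HbS). rewrite <- Ha at 1.
    apply (usol_diff_bnd n Om sg (even_part w) r Mw S eta a b eps Hw Heta HsS HbS Hle). }
  assert (Equiv : forall a b : C, Cmod a + Cmod b < delta ->
     ((exists (u : Z -> C) (U : R -> C),
         nontrivial_solution W Om sg s eps n u U /\ in_range s n delta rho u /\
         u (Z.of_nat n) = a /\ u (- Z.of_nat n)%Z = b) <->
      (nontrivial_pair a b /\
       bifurcation_eqs w Om sg eps n (reduced n Om sg (even_part w) (Z.of_nat n))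
         (reduced n Om sg (even_part w) (- Z.of_nat n)%Z) a b))).
  { intros a b Hlt. destruct (Hab a b Hlt) as (_ & Hbt & HbS).
    rewrite (bifurcation_eqs_nlin n Om sg w r Mw S eta a b eps Hn Hw0 Hw Heta HsS HbS Hle).
    fold (V a b). split.
    - intros (u & U & Hsol & Hrg & Ea & Eb).
      destruct (Fwd u U a b Hsol Hrg Ea Eb) as (_ & Eu & HUf & N1 & N2).
      rewrite <- Eu. split; [|now split].
      intros E. injection E as Ea0 Eb0. destruct Hsol as (_ & [x Hx] & _). apply Hx.
      rewrite HUf. unfold fs. rewrite CS_zero; [ring|]. intros m.
      enough (u m = RtoC 0) as -> by ring.
      (* For a = b = 0 the radius [th * (Cmod a + Cmod b)] is 0, so the bound forces [u], and with
         it [U], to vanish. *)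
      pose proof (usol_bnd n Om sg (even_part w) r Mw _ eta Hw Heta
        (Hsmall _ (proj1 (Hab a b Hlt))) a b Hbt eps Hle) as Hz.
      fold (V a b) in Hz. rewrite <- Eu, Ea0, Eb0, Cmod_0 in Hz.
      apply (bdd_term _ _ m) in Hz. cbv beta in Hz. pose proof (wt_ge_1 r m). pose proof (Cmod_ge_0 (u m)).
      apply Cmod_eq_0. nra.
    - intros (Hnt & N1 & N2).
      destruct (usol_balance n Om sg w r Mw S eta a b eps Hn Hw Heta HsS HbS Hle) as (Ea & Eb & Hsup & Hbal).
      fold (V a b) in Ea, Eb, Hsup, Hbal. specialize (Hbal N1 N2).
      pose proof (usol_bnd n Om sg (even_part w) r Mw S eta Hw Heta HsS a b HbS eps Hle) as HV.
      fold (V a b) in HV.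
      assert (SV : summable (V a b)).
      { eexists. eapply bdd_le; [|apply Rle_refl|apply (bnd_wt0 r), HV]. intros m; unfold wt; simpl; lra. }
      exists (V a b), (fun x => RtoC (sqrt eps) * fs (V a b) x)%C.
      split; [|split; [|now split]].
      + split; [|split; [|split]].
        * apply (coefficients_solution n Om sg eps W (even_part w) (V a b) Mw (proj1 Heps) Hw' HWfs (2 * S)); auto.
          eapply bdd_le; [|apply Rle_refl|apply HV]. intros m. apply Rmult_le_compat_r; [apply Cmod_ge_0|].
          apply Rle_pow; auto. pose proof (Rabs_pos (IZR m)). lra.
        (* If the function vanished identically, uniqueness of Fourier coefficients would make
           [V a b] vanish, including its entries [a] and [b]. *)
        * apply NNPP. intros Hno. apply Hnt.
          assert (Z0 : forall k, V a b k = RtoC 0).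
          { apply fs_unique; auto. intros x. apply NNPP. intros Hx. apply Hno. exists x. intros E.
            assert (Hse : RtoC (sqrt eps) <> RtoC 0).
            { intros E0. apply RtoC_inj in E0. pose proof (sqrt_lt_R0 eps (proj1 Heps)). lra. }
            apply Hx. replace (fs (V a b) x) with (/ RtoC (sqrt eps) * (RtoC (sqrt eps) * fs (V a b) x))%C
              by (field; auto).
            rewrite E. ring. }
          f_equal; [rewrite <- Ea|rewrite <- Eb]; apply Z0.
        * split; auto. apply (bdd_Zpartial _ _ (l2s_term_ge0 s _) (l1_l2s s r _ _ Hsr HV)).
        * now apply form_fs.
      + split; [now rewrite Ea, Eb|].
        (* Since [V a b] has the entries [a] and [b] at the resonant modes, deleting these modes
           amounts to subtracting the core, and [Dif] applies. *)
        assert (Er : remainder n (V a b) = (fun m => V a b m - core n a b m)%C).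
        { apply functional_extensionality. intros m.
          rewrite <- (core_remainder n (V a b) m Hn). rewrite Ea, Eb. ring. }
        rewrite Er. unfold l2s_norm.
        pose proof (Dif a b Hlt) as Hdif.
        destruct (bdd_Zpartial _ _ (l2s_term_ge0 s _) (l1_l2s s r _ _ Hsr Hdif)) as [_ HL].
        apply Rle_lt_trans with (sqrt ((eps * D) ^ 2)); [now apply sqrt_le_1_alt|].
        rewrite sqrt_pow2 by nra. nra. }
  split; [|split; [exact Equiv|]].
  - split.
    + intros (u & U & Hsol & Hrg).
      exists (u (Z.of_nat n)), (u (- Z.of_nat n)%Z). split; [apply Hrg|].
      apply Equiv; [apply Hrg|]. now exists u, U.
    + intros (a & b & Hlt & Hbif). apply Equiv in Hbif; auto.
      destruct Hbif as (u & U & Hsol & Hrg & _). now exists u, U.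
  - intros u U a b Hsol Hrg Ea Eb.
    destruct (Fwd u U a b Hsol Hrg Ea Eb) as (Hlt & Eu & HUf & _).
    pose proof (Dif a b Hlt) as Hdif. rewrite <- Eu in Hdif. apply bnd_wt0 in Hdif.
    assert (Hd1 : bdd (fun m => Cmod (u m - core n a b m)) (eps * D)).
    { eapply bdd_le; [|apply Rle_refl|apply Hdif]. intros m; unfold wt; simpl; lra. }
    unfold Cb0_norm. apply Lub_Rbar_correct. intros t [x ->]. simpl.
    rewrite HUf, <- (fs_core n a b x Hn).
    assert (Sd : summable (fun m => u m - core n a b m)%C) by (now exists (eps * D)).
    assert (Sc : summable (core n a b)).
    { exists S. eapply bdd_le; [|apply Rle_refl|apply (bnd_wt0 r), (Hab a b Hlt)].
      intros m; unfold wt; simpl; lra. }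
    assert (E : fs u x = (fs (fun m => u m - core n a b m) x + fs (core n a b) x)%C).
    { rewrite <- fs_plus by auto. f_equal. apply functional_extensionality. intros m. ring. }
    rewrite E.
    replace (RtoC (sqrt eps) * (fs (fun m => u m - core n a b m) x + fs (core n a b) x)
       - RtoC (sqrt eps) * fs (core n a b) x)%C with (RtoC (sqrt eps) * fs (fun m => u m - core n a b m) x)%C by ring.
    rewrite Cmod_mult, Cmod_R, Rabs_pos_eq by apply sqrt_pos.
    pose proof (fs_le _ _ x Hd1) as Hfs.
    (* One half comes from the scaling by [sqrt eps], the full power from [Dif]. *)
    replace (3 / 2) with (/ 2 + 1) by field.
    rewrite Rpower_plus, Rpower_sqrt, Rpower_1 by lra.
    pose proof (sqrt_pos eps).
    apply Rle_trans with (sqrt eps * (eps * D)); [now apply Rmult_le_compat_l|nra].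
Qed.
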